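(* Let $a,b,c,d,e,f,g$ be complex numbers and let $z=\frac{bcde}{aq}$, such that $\left|\frac{a^2q}{fgz}\right|<1$ and $\left|\frac{aq}{fg}\right|<1$. Then \begin{align*} &{}_{8}W_{7}\left[\tfrac{b^2}{a};\tfrac{bc}{a},\tfrac{bd}{a},\tfrac{be}{a},\tfrac{bf}{a},\tfrac{bg}{a};q,\tfrac{a^2q}{fgz}\right]\\ &=\left(1-\tfrac1z\right)\frac{\theta(bz/a,\,z/b)}{\theta(z/a,\,z)}\, \frac{(b^2q/a;q)_\infty}{\Omega\!\left(\tfrac{aq}{b},bq;f,g\right)}\, \frac{\Omega(q;b,c,d,e)\;\Omega(aq;\,f,g,cd,ce,de,fg,fz,gz)}{\Omega(bq;b,c,d,e)\;\Omega\!\left(\tfrac1z;\tfrac1b,\tfrac1c,\tfrac1d,\tfrac1e,\tfrac{fg}{a^2q}\right)}\\ &\qquad\times{}_{8}\psi_{8}\left[z;b,c,d,e,\tfrac{fz}{a},\tfrac{gz}{a};q,\tfrac{aq}{fg}\right]\\ &\quad+\frac{(zq/b;q)_\infty}{(z^2q/a;q)_\infty}\,\frac{\theta(1/b)}{\theta(z/a)}\, \frac{\Omega\!\left(\tfrac ba;\tfrac1{bq},\tfrac1c,\tfrac1d,\tfrac1e\right)\Omega(zq;f,g)}{\Omega\!\left(\tfrac1z;\tfrac{z}{aq},\tfrac1c,\tfrac1d,\tfrac1e\right)\Omega\!\left(\tfrac{aq}{b};f,g\right)}\, \frac{\Omega\!\left(\tfrac{aq}{z};b,c,d,e,f,g\right)}{\Omega(bq;b,c,d,e,f,g)}\\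 &\qquad\times{}_{8}\psi_{8}\left[\tfrac{z^2}{a};\tfrac{bz}{a},\tfrac{cz}{a},\tfrac{dz}{a},\tfrac{ez}{a},\tfrac{fz}{a},\tfrac{gz}{a};q,\tfrac{a^2q}{fgz}\right]. \end{align*}
   Context: Fix a complex number $q$ with $0<|q|<1$. Set $(x;q)_\infty=\prod_{n\ge 0}(1-xq^n)$, $(x;q)_n=(x;q)_\infty/(xq^n;q)_\infty$ for every integer $n$ (positive, zero or negative), and $(x_1,\dots,x_m;q)_n=\prod_i (x_i;q)_n$ (also for $n=\infty$). Theta function: for $x\ne0$, $\theta(x)=\frac{1}{(q;q)_\infty}\sum_{n=-\infty}^\infty(-1)^nq^{n(n-1)/2}x^n$, which by the Jacobi triple product equals $(x,q/x;q)_\infty$; $\theta(x_1,\dots,x_m)=\prod_i\theta(x_i)$. Notation: $\Omega(x_1,\dots,x_n;a_1,\dots,a_m)=\prod_{i=1}^n\prod_{j=1}^m (x_i/a_j;q)_\infty$. Very-well-poised bilateral series: ${}_8\psi_8[a;a_3,\dots,a_8;q,Z]=\sum_{n=-\infty}^{\infty}\frac{1-aq^{2n}}{1-a}\prod_{i=3}^{8}\frac{(a_i;q)_n}{(aq/a_i;q)_n}\,Z^n$. Very-well-poised unilateral series: ${}_8W_7[a_1;a_4,\dots,a_8;q,Z]=\sum_{n=0}^{\infty}\frac{1-a_1q^{2n}}{1-a_1}\frac{(a_1;q)_n}{(q;q)_n}\prod_{i=4}^{8}\frac{(a_i;q)_n}{(a_1q/a_i;q)_n}\,Z^n$. Convention: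 all parameters are nonzero and such that no denominator appearing (in coefficients or in terms of series) vanishes. *)

(* Defs.v *)
From HB Require Import structures.
From mathcomp Require Import all_boot all_order all_algebra.
From mathcomp Require Import all_classical all_reals all_analysis.
From mathcomp Require Export complex.

Set Implicit Arguments.
Unset Strict Implicit.
Unset Printing Implicit Defensive.

Import Order.TTheory GRing.Theory Num.Theory.
Import numFieldNormedType.Exports.

Local Open Scope classical_set_scope.
Local Open Scope ring_scope.

(* Everything is defined over an arbitrary numFieldType C, which carries its norm
   topology (the concrete type R[i] has no declared topology); the intended
   instance is C := R[i] with R : realType. *)

Section QSeries.
Variables (C : numFieldType) (q : C).
Implicit Types (x a Z : C) (l xs ys : seq C).

Definition qpoch x (n : nat) : C := \prod_(0 <= k < n) (1 - x * q ^+ k).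

Definition qpoch_inf x : C := limn (qpoch x).

(* (x;q)_n for n in Z, with (x;q)_(-m) = 1/(x q^(-m);q)_m.  This is the quotient
   (x;q)_oo / (x q^n;q)_oo with its common factors cancelled (lemma qpochzE), so
   that it keeps its usual value where that quotient reads 0/0, as in
   (q^(-m);q)_n with 0 <= n <= m.  Where (x;q)_n is infinite, i.e. x = q^m and
   n <= -m with 0 < m, it is set to 0; its inverse is then 0, as it should be. *)
Definition qpochz x (n : int) : C :=
  match n with
  | Posz m => qpoch x m
  | Negz m => (qpoch (x * q ^- m.+1) m.+1)^-1
  end.

Lemma qpoch_addn x (n m : nat) :
  qpoch x (n + m) = qpoch x n * qpoch (x * q ^+ n) m.
Proof.
rewrite /qpoch (@big_cat_nat _ _ _ n) //=; last exact: leq_addr.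
congr (_ * _); rewrite -[X in \prod_(X <= _ < _) _]add0n big_addn addKn.
by apply: eq_bigr => k _; rewrite -mulrA -exprD addnC.
Qed.

Lemma qpoch_inf_neq0_cvg x : qpoch_inf x != 0 -> cvgn (qpoch x).
Proof.
move=> x0; apply: contrapT => /dvgP dx.
by move: x0; rewrite /qpoch_inf dx eqxx.
Qed.

Lemma qpoch_inf_shift x (n : nat) : cvgn (qpoch (x * q ^+ n)) ->
  qpoch_inf x = qpoch x n * qpoch_inf (x * q ^+ n).
Proof.
move=> cx; apply/cvg_lim => //.
rewrite -(cvg_shiftn n).
under eq_fun do rewrite addnC qpoch_addn.
by apply: cvgMl_tmp.
Qed.

Lemma qpochzE x (n : int) : q != 0 -> qpoch_inf (x * q ^ n) != 0 ->
  qpochz x n = qpoch_inf x / qpoch_inf (x * q ^ n).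
Proof.
move=> q0; case: n => [m|m] /= nz.
  by rewrite (qpoch_inf_shift (qpoch_inf_neq0_cvg nz)) mulfK.
rewrite NegzE -exprnN in nz *.
set y := x * q ^- m.+1 in nz *; have -> : x = y * q ^+ m.+1.
  by rewrite /y mulfVK // expf_neq0.
have cy := qpoch_inf_neq0_cvg nz.
have P0 : qpoch y m.+1 != 0.
  apply: contra_neq nz => P0; apply/cvg_lim => //.
  rewrite -(cvg_shiftn m.+1).
  under eq_fun do rewrite addnC qpoch_addn P0 mul0r.
  exact: cvg_cst.
have cx : cvgn (qpoch (y * q ^+ m.+1)).
  have -> : qpoch (y * q ^+ m.+1) =
      (fun k => (qpoch y m.+1)^-1 * qpoch y (k + m.+1)%N).
    by apply/funext => k; rewrite addnC qpoch_addn mulKf.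
  apply: is_cvgMl_tmp; apply/cvg_ex; exists (limn (qpoch y)).
  by rewrite cvg_shiftn.
rewrite (qpoch_inf_shift cx) in nz *.
by move: nz; rewrite mulf_eq0 negb_or => /andP[_ nz]; rewrite invfM mulrCA divff ?mulr1.
Qed.

Definition bilateral_sum (u : int -> C) : C :=
  limn (series (fun n => u (Posz n))) + limn (series (fun n => u (Negz n))).

Definition theta x : C :=
  (qpoch_inf q)^-1 *
  bilateral_sum (fun n => (-1) ^ n * q ^ (n * (n - 1) %/ 2)%Z * x ^ n).

(* Omega [:: x_1; ...; x_n] [:: a_1; ...; a_m] *)
Definition Omega xs ys : C :=
  \prod_(x <- xs) \prod_(y <- ys) qpoch_inf (x / y).

(* 8psi8[a; a_3, ..., a_8; q, Z] for l = [:: a_3; ...; a_8] *)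
Definition psi_term a l Z (n : int) : C :=
  (1 - a * q ^ (2 * n)) / (1 - a)
  * (\prod_(x <- l) (qpochz x n / qpochz (a * q / x) n)) * Z ^ n.

Definition psi88 a l Z : C := bilateral_sum (psi_term a l Z).

(* 8W7[a; a_4, ..., a_8; q, Z] for l = [:: a_4; ...; a_8] *)
Definition W_term a l Z (n : nat) : C :=
  (1 - a * q ^+ (2 * n)) / (1 - a) * (qpoch a n / qpoch q n)
  * (\prod_(x <- l) (qpoch x n / qpoch (a * q / x) n)) * Z ^+ n.

Definition W87 a l Z : C := limn (series (W_term a l Z)).

(* No denominator vanishes in the terms of the series: for n < 0 the factor
   (x;q)_n = 1/(x q^n;q)_(-n) of a bilateral series has a denominator as well,
   whereas 1/(a q/x;q)_n = (a q^(1+n)/x;q)_(-n) has none. *)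
Definition psi_regular a l : Prop :=
  1 - a != 0 /\
  {in l, forall x (n : nat),
    qpoch (a * q / x) n != 0 /\ qpoch (x * q ^- n) n != 0}.

Definition W_regular a l : Prop :=
  1 - a != 0 /\ {in l, forall x (n : nat), qpoch (a * q / x) n != 0}.

End QSeries.

(* Main.v *)
Require Import Defs.
From mathcomp Require Import all_boot all_order all_algebra.
From mathcomp Require Import all_classical all_reals all_analysis.
From mathcomp Require Import complex ring zify.

Set Implicit Arguments.
Unset Strict Implicit.
Unset Printing Implicit Defensive.

Import Order.TTheory GRing.Theory Num.Theory.
Import numFieldNormedType.Exports.

Local Open Scope classical_set_scope.
Local Open Scope ring_scope.

(* Interpolating at the points c/a + 1/c, in which well-poised products are polynomials,
   and letting the number of points grow gives Slater's relation between well-poised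
   series with different bases.  For the bases a, q, b, c it writes an 8psi8 as a
   combination of two 8W7's.  Both 8psi8's of the theorem are so expanded; the
   transformation of an 8W7 that follows from Jackson's summation by exchanging two sums
   matches, up to explicit factors, the 8W7's of one expansion with those of the other.
   The 8W7's with bases b^2/a and c^2/a therefore satisfy two linear equations, and the
   second one is eliminated; the resulting determinant is a single product by the
   three-term relation for theta functions, itself a case of Slater's relation.  All this
   requires finitely many monomials in the parameters not to be powers of q, which a small
   perturbation of the parameters achieves; the general case follows by continuity. *)

(** The 8W7 with base c^2/a is auxiliary: c is singled out among c, d, e, in which the final formula
    is symmetric, only to have a second base. The two 8psi8's have different arguments, aq/(fg) and
    a^2q/(fgz), and z = bcde/(aq) is exactly the condition under which the 8W7 transformation, with
    multiplier z/a, relates the bases b^2/z and c^2/z at the first argument to b^2/a and c^2/a at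
    the second. The obstacle is that the intermediate steps divide by far more than the formula
    does, for instance by products that vanish when b = c. The perturbation multiplies each
    parameter by a power of a real number t > 1 tending to 1; the exponents preserve the relation
    that defines z, and they shrink both arguments, so that convergence is never lost. All limits,
    from finite sums to series and from perturbed to given parameters, rest on a geometric majorant.
    This is why (x;q)_n and its inverse are bounded uniformly both in n and in x close to its
    limit. *)

(** * Tannery's theorem and uniform bounds *)

(* The part of completeness that the proof uses: [R[i]] has no declared structure of
   complete normed module. *)
Definition geometrically_complete (C : numFieldType) : Prop :=
  forall (u : nat -> C) (K r : C), 0 <= r -> r < 1 ->
  (forall k, `|u k| <= K * r ^+ k) -> cvgn (series u).

Section Tannery.
Variables (C : numFieldType) (gc : geometrically_complete C).
Implicit Types (u : nat -> C) (K r : C).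

(** The ordered field need not be archimedean, so r^n -> 0 is not automatic: it holds because the
    geometric series converges by [gc]. *)
Lemma geometric_cvg0 r : 0 <= r -> r < 1 -> r ^+ n @[n --> \oo] --> (0 : C).
Proof.
move=> r0 r1; apply: cvg_series_cvg_0; apply: (gc (K := 1) r0 r1) => k.
by rewrite mul1r ger0_norm // exprn_ge0.
Qed.

Lemma sum_geometric_le r m n : 0 <= r -> r < 1 ->
  \sum_(m <= k < n) r ^+ k <= r ^+ m / (1 - r).
Proof.
move=> r0 r1; have r1' : 0 < 1 - r by rewrite subr_gt0.
have [nm|mn] := leqP n m.
  by rewrite big_geq // divr_ge0 ?exprn_ge0 // ltW.
rewrite ler_pdivlMr // mulr_suml.
under eq_bigr do rewrite mulrBr mulr1 -exprSr -opprB.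
rewrite sumrN telescope_sumr ?(ltnW mn)// opprB gerBl exprn_ge0 //.
Qed.

Lemma series_dist_le u K r m n : 0 <= r -> r < 1 ->
  (forall k, `|u k| <= K * r ^+ k) -> (m <= n)%N ->
  `|series u n - series u m| <= K * r ^+ m / (1 - r).
Proof.
move=> r0 r1 hu mn; rewrite /series /= (@big_cat_nat _ _ _ m 0 n) //=.
rewrite addrAC subrr add0r.
have K0 : 0 <= K by have := hu 0%N; rewrite expr0 mulr1; apply: le_trans.
apply: le_trans (ler_norm_sum _ _ _) _.
apply: le_trans (ler_sum _ (fun k _ => hu k)) _.
by rewrite -mulr_sumr -mulrA ler_wpM2l // sum_geometric_le.
Qed.

Lemma lim_series_dist_le u K r m : 0 <= r -> r < 1 ->
  (forall k, `|u k| <= K * r ^+ k) ->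
  `|limn (series u) - series u m| <= K * r ^+ m / (1 - r).
Proof.
move=> r0 r1 hu; apply/ler_addgt0Pr => e e0.
have cu := gc r0 r1 hu.
have /cvgrPdist_le /(_ _ e0) [N _ hN] := cu.
have := hN (maxn N m) (leq_maxl _ _) => h1.
rewrite (le_trans (ler_distD (series u (maxn N m)) _ _)) // addrC lerD //.
by apply: series_dist_le => //; exact: leq_maxr.
Qed.

(** The majorant is asked only for large N, since in the applications it comes from the convergence
    of parameters. It passes to the limit [g], so that one tail estimate serves both series. *)
Lemma tannery (f : nat -> nat -> C) (g : nat -> C) K r : 0 <= r -> r < 1 ->
  (\forall N \near \oo, forall k, `|f N k| <= K * r ^+ k) ->
  (forall k, f N k @[N --> \oo] --> g k) ->
  limn (series (f N)) @[N --> \oo] --> limn (series g).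
Proof.
move=> r0 r1 fK fg.
have gK k : `|g k| <= K * r ^+ k.
  apply/ler_addgt0Pr => e e0.
  have /cvgrPdist_le /(_ _ e0) [N1 _ h1] := fg k.
  have [N2 _ h2] := fK; pose N := maxn N1 N2.
  have := h1 N (leq_maxl _ _) => d1; have := h2 N (leq_maxr _ _) k => d2.
  rewrite -(subrK (f N k) (g k)) (le_trans (ler_normD _ _)) // addrC lerD //.
have r1' : 0 < 1 - r by rewrite subr_gt0.
have K0 : 0 <= K by have := gK 0%N; rewrite expr0 mulr1; apply: le_trans.
apply/cvgrPdist_le => e e0.
have e3 : 0 < e / 3 by rewrite divr_gt0.
have tail0 : K * r ^+ m / (1 - r) @[m --> \oo] --> (0 : C).
  have -> : (0 : C) = K * 0 / (1 - r) by rewrite mulr0 mul0r.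
  by apply: cvgMr_tmp; apply: cvgMl_tmp; exact: geometric_cvg0.
have /cvgrPdist_le /(_ _ e3) [m _ hm] := tail0.
have {hm} hm : K * r ^+ m / (1 - r) <= e / 3.
  have := hm m (leqnn m); rewrite sub0r normrN ger0_norm //.
  by rewrite !mulr_ge0 ?invr_ge0 ?exprn_ge0 // ltW.
have fin : series (f N) m @[N --> \oo] --> series g m.
  by rewrite /series /=; apply: cvg_big => //; exact: add_continuous.
have /cvgrPdist_le /(_ _ e3) fin3 := fin.
near=> N.
have hf : forall k, `|f N k| <= K * r ^+ k by near: N.
have := lim_series_dist_le m r0 r1 gK => g1.
have := lim_series_dist_le m r0 r1 hf => f1.
have s1 : `|series g m - series (f N) m| <= e / 3 by near: N.
have -> : limn (series g) - limn (series (f N)) =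
  (limn (series g) - series g m) + (series g m - series (f N) m)
  - (limn (series (f N)) - series (f N) m) by ring.
have -> : e = e / 3 + e / 3 + e / 3 by field.
rewrite (le_trans (ler_normB _ _)) // lerD ?(le_trans f1) //.
by rewrite (le_trans (ler_normD _ _)) // lerD ?(le_trans g1).
Unshelve. all: by end_near.
Qed.

Lemma lim_series_finite u n : (forall k, (n <= k)%N -> u k = 0) ->
  limn (series u) = \sum_(k < n) u k.
Proof.
move=> un; apply/cvg_lim => //; rewrite -(cvg_shiftn n).
have -> : [sequence series u (m + n)%N]_m = fun=> \sum_(k < n) u k.
  apply/funext => m; rewrite /series /= (@big_cat_nat _ _ _ n) ?leq_addl //=.
  rewrite [X in _ + X = _]big_nat_cond [X in _ + X = _]big1 ?addr0 ?big_mkord // => k.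
  by rewrite andbT => /andP[nk _]; exact: un.
exact: cvg_cst.
Qed.

End Tannery.

Section UniformBounds.
Variable C : numFieldType.

(** The bound is uniform in the index t but required only for large N: an inverse such as
    1/(x_N;q)_k is controlled only once x_N is close to a limit at which no factor vanishes. *)
Definition unif_bounded (T : Type) (f : nat -> T -> C) : Prop :=
  exists K : C, \forall N \near \oo, forall t, `|f N t| <= K.

Section Operations.
Variable T : Type.
Implicit Types f g : nat -> T -> C.

Lemma unif_bounded_cst (c : C) : unif_bounded (fun _ (_ : T) => c).
Proof. by exists `|c|; near=> N. Unshelve. all: by end_near. Qed.

Lemma unif_boundedM f g : unif_bounded f -> unif_bounded g ->
  unif_bounded (fun N k => f N k * g N k).
Proof.
move=> [K hK] [L hL]; exists (K * L); apply: filterS2 hK hL => N hf hg k.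
by rewrite normrM ler_pM.
Qed.

Lemma unif_boundedB f g : unif_bounded f -> unif_bounded g ->
  unif_bounded (fun N k => f N k - g N k).
Proof.
move=> [K hK] [L hL]; exists (K + L); apply: filterS2 hK hL => N hf hg k.
by rewrite (le_trans (ler_normB _ _)) // lerD.
Qed.

Lemma unif_bounded_prod (I : Type) (r : seq I) (P : pred I) (F : I -> nat -> T -> C) :
  (forall i, P i -> unif_bounded (F i)) ->
  unif_bounded (fun N k => \prod_(i <- r | P i) F i N k).
Proof.
move=> hF; elim: r => [|i r ih].
  have [K hK] := unif_bounded_cst 1; exists K; apply: filterS hK => N hN k.
  by rewrite big_nil; exact: hN k.
case Pi: (P i).
  have [K hK] := unif_boundedM (hF i Pi) ih; exists K.
  by apply: filterS hK => N hN k; rewrite big_cons Pi; exact: hN k.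
have [K hK] := ih; exists K.
by apply: filterS hK => N hN k; rewrite big_cons Pi; exact: hN k.
Qed.

Lemma unif_bounded_reindex (S : Type) f (h : nat -> S -> T) :
  unif_bounded f -> unif_bounded (fun N s => f N (h N s)).
Proof. by move=> [K hK]; exists K; apply: filterS hK. Qed.

Lemma unif_bounded_cvg (x_ : nat -> C) (x : C) :
  x_ N @[N --> \oo] --> x -> unif_bounded (fun N (_ : T) => x_ N).
Proof.
move=> cx; exists (`|x| + 1).
have x1 : `|x| < `|x| + 1 by rewrite ltrDl.
have hN : \forall N \near \oo, `|x_ N| <= `|x| + 1.
  exact: (@cvgr_norm_le _ _ _ _ _ _ _ cx _ x1).
by apply: filterS hN.
Qed.

Lemma unif_bounded_const (g : T -> C) : unif_bounded (fun _ => g) ->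
  exists K, forall t, `|g t| <= K.
Proof. by move=> [K [N _ /(_ N (leqnn N))]]; exists K. Qed.

End Operations.

Lemma cvg_powers (x_ : nat -> C) (x : C) k :
  x_ N @[N --> \oo] --> x -> x_ N ^+ k @[N --> \oo] --> x ^+ k.
Proof.
move=> cx; elim: k => [|k ih].
  by under eq_fun do rewrite expr0; rewrite expr0; exact: cvg_cst.
by rewrite exprS; under eq_fun do rewrite exprS; exact: cvgM.
Qed.

Lemma cvg_prods (I : Type) (r : seq I) (P : pred I) (F : I -> nat -> C)
  (G : I -> C) : (forall i, P i -> F i N @[N --> \oo] --> G i) ->
  \prod_(i <- r | P i) F i N @[N --> \oo] --> \prod_(i <- r | P i) G i.
Proof. by move=> h; apply: cvg_big => //; exact: mul_continuous. Qed.

End UniformBounds.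

(** * Bounds, limits and non-vanishing of q-shifted factorials *)

Section Pochhammer.
Variables (C : numFieldType) (gc : geometrically_complete C) (q : C).
Hypothesis q1 : `|q| < 1.
Implicit Types (x y : C) (n k : nat).
Local Notation poch := (qpoch q).
Local Notation pinf := (qpoch_inf q).

Lemma qpochn0 x : poch x 0 = 1.
Proof. by rewrite /qpoch big_geq. Qed.

Lemma qpochSr x n : poch x n.+1 = poch x n * (1 - x * q ^+ n).
Proof. by rewrite /qpoch big_nat_recr. Qed.

Lemma qpochSl x n : poch x n.+1 = (1 - x) * poch (x * q) n.
Proof. by rewrite -add1n qpoch_addn qpochSr qpochn0 mul1r expr0 mulr1 expr1. Qed.

Lemma qpoch_neq0P x :
  (forall n, 1 - x * q ^+ n != 0) <-> (forall n, poch x n != 0).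
Proof.
split=> h n; last by have := h n.+1; rewrite qpochSr mulf_eq0 negb_or => /andP[].
by elim: n => [|n ih]; rewrite ?qpochn0 ?oner_eq0 // qpochSr mulf_neq0.
Qed.

(** An elementary substitute for logarithms: if S is the sum of the |x q^k|, inductions give 1 - S
    <= |(x;q)_n| and |(x;q)_n| (1 - S) <= 1, while S <= 1/2 by hypothesis. *)
Lemma qpoch_tail_bounds x n : `|x| / (1 - `|q|) <= 2^-1 ->
  2^-1 <= `|poch x n| <= 2.
Proof.
move=> hx; have q1' : 0 < 1 - `|q| by rewrite subr_gt0.
pose t k := `|x| * `|q| ^+ k.
have t0 k : 0 <= t k by rewrite mulr_ge0 ?exprn_ge0.
have ht m : \sum_(0 <= k < m) t k <= 2^-1.
  rewrite -mulr_sumr; apply: le_trans hx.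
  by rewrite ler_wpM2l // (le_trans (sum_geometric_le _ _ _ _)) // expr0 mul1r.
have nx k : `|x * q ^+ k| = t k by rewrite normrM normrX.
have s0 m : 0 <= \sum_(0 <= k < m) t k by rewrite sumr_ge0.
have lo : 1 - \sum_(0 <= k < n) t k <= `|poch x n|.
  elim: n => [|n ih]; first by rewrite big_geq // subr0 qpochn0 normr1.
  rewrite qpochSr normrM big_nat_recr //=.
  have lb : 1 - t n <= `|1 - x * q ^+ n|.
    by rewrite -nx -[X in X - _](normr1 C) lerB_dist.
  have tn1 : t n <= 1.
    rewrite (le_trans _ (le_trans (ht n.+1) _)) //.
      by rewrite big_nat_recr //= lerDr.
    by rewrite invf_le1 ?ler1n.
  apply: le_trans (ler_pM _ _ ih lb); rewrite ?subr_ge0 //.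
    rewrite -subr_ge0; have -> : forall a b : C, (1 - a) * (1 - b) - (1 - (a + b)) = a * b
      by move=> a b; ring.
    exact: mulr_ge0.
  by rewrite (le_trans (ht n)) // invf_le1 ?ler1n.
have up : `|poch x n| * (1 - \sum_(0 <= k < n) t k) <= 1.
  elim: n {lo} => [|n ih]; first by rewrite big_geq // subr0 qpochn0 normr1 mulr1.
  rewrite qpochSr normrM big_nat_recr //=.
  have ub : `|1 - x * q ^+ n| <= 1 + t n.
    by rewrite -nx (le_trans (ler_normB _ _)) // normr1.
  apply: le_trans ih; rewrite -mulrA ler_wpM2l //.
  have h1 : 0 <= 1 - (\sum_(0 <= k < n) t k + t n).
    rewrite subr_ge0 -big_nat_recr //= (le_trans (ht _)) // invf_le1 ?ler1n //.
  apply: le_trans (ler_wpM2r h1 ub) _.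
  rewrite -subr_ge0; have -> : forall a b : C,
    1 - a - (1 + b) * (1 - (a + b)) = b * (a + b) by move=> a b; ring.
  by rewrite mulr_ge0 ?addr_ge0.
have half : 2^-1 = 1 - 2^-1 :> C by field.
have h2 : 2^-1 <= 1 - \sum_(0 <= k < n) t k by rewrite [leLHS]half lerB.
rewrite (le_trans h2 lo) /=.
have : `|poch x n| * 2^-1 <= 1 by apply: le_trans up; rewrite ler_wpM2l.
by rewrite ler_pdivrMr // mul1r.
Qed.

(** One [M] serves the whole disc |x| <= X and all n, so that only a head of fixed length remains to
    be controlled. *)
Lemma qpoch_tail_start (X : C) : 0 <= X ->
  exists M, forall x n, `|x| <= X -> 2^-1 <= `|poch (x * q ^+ M) n| <= 2.
Proof.
move=> X0; have q1' : 0 < 1 - `|q| by rewrite subr_gt0.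
have h0 : X * `|q| ^+ M / (1 - `|q|) @[M --> \oo] --> (0 : C).
  have -> : (0 : C) = X * 0 / (1 - `|q|) by rewrite mulr0 mul0r.
  by apply: cvgMr_tmp; apply: cvgMl_tmp; exact: geometric_cvg0.
have h2 : (0 : C) < 2^-1 by [].
have /cvgrPdist_le /(_ _ h2) [M _ hM] := h0.
exists M => x n xX; apply: qpoch_tail_bounds; apply: le_trans (hM M (leqnn M)).
rewrite sub0r normrN [leRHS]ger0_norm ?mulr_ge0 ?invr_ge0 ?exprn_ge0 ?(ltW q1')//.
by rewrite normrM normrX ler_pM2r ?invr_gt0 // ler_wpM2r ?exprn_ge0.
Qed.

Lemma qpoch_le (X : C) : 0 <= X ->
  exists B, forall x n, `|x| <= X -> `|poch x n| <= B.
Proof.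
move=> X0; have [M hM] := qpoch_tail_start X0.
have hs x n : `|x| <= X -> (n <= M)%N -> `|poch x n| <= (1 + X) ^+ M.
  move=> xX nM; apply: (@le_trans _ _ ((1 + X) ^+ n)); last first.
    by apply: ler_weXn2l => //; rewrite lerDl.
  elim: n {nM} => [|n ih]; first by rewrite qpochn0 normr1 expr0.
  rewrite qpochSr normrM exprSr ler_pM //.
  rewrite (le_trans (ler_normB _ _)) // normr1 lerD2l normrM normrX.
  by rewrite (le_trans _ xX) // ler_piMr // exprn_ile1 // ltW.
have X1 : 1 <= (1 + X) ^+ M by rewrite exprn_ege1 // lerDl.
exists ((1 + X) ^+ M * 2) => x n xX; have [nM|Mn] := leqP n M.
  rewrite (le_trans (hs _ _ xX nM)) // ler_peMr ?(le_trans ler01)// ler1n //.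
rewrite -(subnKC (ltnW Mn)) qpoch_addn normrM ler_pM ?hs //.
by have /andP[] := hM x (n - M)%N xX.
Qed.

Lemma unif_bounded_qpoch (x_ : nat -> C) x : x_ N @[N --> \oo] --> x ->
  unif_bounded (fun N k => poch (x_ N) k).
Proof.
move=> /(@unif_bounded_cvg _ nat) [X hX].
have [N0 _ h0] := hX; have X0 : 0 <= X by apply: le_trans (h0 N0 (leqnn _) 0%N).
have [B hB] := qpoch_le X0; exists B.
by apply: filterS hX => N hN k; apply: hB; exact: hN 0%N.
Qed.

Lemma cvg_qpoch (x_ : nat -> C) x n : x_ N @[N --> \oo] --> x ->
  poch (x_ N) n @[N --> \oo] --> poch x n.
Proof.
move=> cx; apply: cvg_prods => k _.
by apply: cvgB; [exact: cvg_cst|apply: cvgMr_tmp].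
Qed.

(** Beyond M factors the tail has norm at least 1/2, and the head of M factors has a nonzero limit.
    For k <= M the inverse is recovered from the inverse of that single head by multiplying back the
    missing factors, [v] below. *)
Lemma unif_bounded_qpochV (x_ : nat -> C) x : x_ N @[N --> \oo] --> x ->
  (forall n, poch x n != 0) -> unif_bounded (fun N k => (poch (x_ N) k)^-1).
Proof.
move=> cx x0.
have [X hX] := @unif_bounded_cvg _ nat _ _ cx.
have [N0 _ h0] := hX; have X0 : 0 <= X by apply: le_trans (h0 N0 (leqnn _) 0%N).
have [M hM] := qpoch_tail_start X0; have [B hB] := qpoch_le X0.
have [K hK] : unif_bounded (fun N (_ : nat) => (poch (x_ N) M)^-1).
  by apply: unif_bounded_cvg; apply: cvgV => //; exact: cvg_qpoch.
have B0 : 0 <= B by apply: le_trans (hB 0 0%N _); rewrite ?normr0.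
have nz : \forall N \near \oo, poch (x_ N) M != 0.
  by apply: cvgr_neq0 (x0 M); exact: cvg_qpoch.
exists (K * (B + 2)); apply: filterS3 hX hK nz => N xX KN zN k.
have K0 : 0 <= K by apply: le_trans (KN 0%N).
have [kM|Mk] := leqP k M.
  move: zN (KN 0%N); rewrite -(subnKC kM) qpoch_addn mulf_eq0 negb_or.
  set u := poch (x_ N) k; set v := poch _ (M - k) => /andP[u0 v0] hu.
  have vB : `|v| <= B.
    apply: hB; rewrite normrM normrX (le_trans _ (xX 0%N)) //.
    by rewrite ler_piMr // exprn_ile1 // ltW.
  have -> : u^-1 = (u * v)^-1 * v by field; rewrite u0 v0.
  rewrite normrM ler_pM // (le_trans vB) // lerDl //.
rewrite -(subnKC (ltnW Mk)) qpoch_addn invfM normrM ler_pM ?(KN 0%N)//.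
have /andP[h _] := hM _ (k - M)%N (xX 0%N).
rewrite normfV -[leRHS]invrK lef_pV2 ?posrE ?invr_gt0 ?ltr_wpDl //.
  by apply: le_trans h; rewrite lef_pV2 ?posrE ?ltr_wpDl // lerDr.
by apply: lt_le_trans h.
Qed.

(** This telescoping turns the infinite product into a series with a geometric majorant, from which
    both its convergence and its continuity in x follow. *)
Lemma qpoch_series x n : poch x n = 1 - series (fun k => x * q ^+ k * poch x k) n.
Proof.
elim: n => [|n ih]; first by rewrite /series /= big_geq // subr0 qpochn0.
by rewrite qpochSr mulrBr mulr1 {1}ih /series /= big_nat_recr //=; ring.
Qed.

Lemma cvg_qpoch_inf (x_ : nat -> C) x : x_ N @[N --> \oo] --> x ->
  pinf (x_ N) @[N --> \oo] --> pinf x.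
Proof.
move=> cx; pose f y k : C := y * q ^+ k * poch y k.
have fE y B : (forall k, `|f y k| <= B * `|q| ^+ k) ->
    pinf y = 1 - limn (series (f y)).
  move=> fB; apply/cvg_lim => //; rewrite (_ : poch y = fun n => 1 - series (f y) n).
    by apply: cvgB; [exact: cvg_cst|exact: gc fB].
  by apply/funext => n; exact: qpoch_series.
have [K hK] : unif_bounded (fun N (k : nat) => x_ N * poch (x_ N) k).
  by apply: unif_boundedM; [exact: (@unif_bounded_cvg _ nat _ _ cx)|exact: unif_bounded_qpoch cx].
have hf : \forall N \near \oo, forall k, `|f (x_ N) k| <= K * `|q| ^+ k.
  apply: filterS hK => N hN k; rewrite /f mulrAC normrM normrX.
  by rewrite ler_wpM2r ?exprn_ge0.
have [L hL] : unif_bounded (fun (_ : nat) k => x * poch x k).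
  by apply: unif_boundedM;
      [exact: unif_bounded_cst|exact: unif_bounded_qpoch (cvg_cst _)].
have [N0 _ {}hL] := hL.
have hx k : `|f x k| <= L * `|q| ^+ k.
  rewrite /f mulrAC normrM normrX ler_wpM2r ?exprn_ge0 //.
  exact: hL (leqnn N0) k.
rewrite (fE _ _ hx).
have : 1 - limn (series (f (x_ N))) @[N --> \oo] --> 1 - limn (series (f x)).
  apply: cvgB; first exact: cvg_cst.
  apply: tannery hf _ => // k; apply: cvgM; last exact: cvg_qpoch.
  by apply: cvgMr_tmp.
apply: cvg_trans; apply: near_eq_cvg.
by apply: filterS hf => N hN; rewrite (fE _ _ hN).
Qed.

Lemma qpoch_cvg x : poch x n @[n --> \oo] --> pinf x.
Proof.
have [L hL] : unif_bounded (fun (_ : nat) k => x * poch x k).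
  by apply: unif_boundedM;
      [exact: unif_bounded_cst|exact: unif_bounded_qpoch (cvg_cst _)].
have [N0 _ {}hL] := hL.
have : cvgn (series (fun k => x * q ^+ k * poch x k)).
  apply: (gc (K := L) (r := `|q|)) => // k.
  rewrite mulrAC normrM normrX ler_wpM2r ?exprn_ge0 //.
  exact: hL (leqnn N0) k.
move=> cs; have : cvgn (poch x).
  have -> : poch x = fun n => 1 - series (fun k => x * q ^+ k * poch x k) n.
    by apply/funext => n; exact: qpoch_series.
  by apply/cvg_ex; eexists; apply: cvgB; [exact: cvg_cst|exact: cs].
by [].
Qed.

Lemma qpoch_inf_split x n : pinf x = poch x n * pinf (x * q ^+ n).
Proof. by apply: qpoch_inf_shift; apply/cvg_ex; eexists; exact: qpoch_cvg. Qed.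

Lemma qpoch_infS x : pinf x = (1 - x) * pinf (x * q).
Proof. by rewrite (qpoch_inf_split x 1) qpochSr qpochn0 mul1r expr0 mulr1 expr1. Qed.

(** The uniform bound on the inverses keeps the partial products, hence their limit, away from 0. *)
Lemma qpoch_inf_neq0 x : (forall n, poch x n != 0) -> pinf x != 0.
Proof.
move=> x0; have [K hK] := unif_bounded_qpochV (cvg_cst x) x0.
have [N0 _ {}hK] := hK; have {}hK n : `|poch x n|^-1 <= K.
  by rewrite -normfV; exact: hK (leqnn N0) n.
have K1 : 1 <= K by have := hK 0%N; rewrite qpochn0 normr1 invr1.
have K0 : 0 < K by apply: lt_le_trans K1.
have lb n : K^-1 <= `|poch x n|.
  by rewrite -[leRHS]invrK lef_pV2 ?posrE ?invr_gt0 ?normr_gt0.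
apply/eqP => p0; have Ki : 0 < K^-1 / 2 by rewrite divr_gt0 ?invr_gt0.
have /cvgrPdist_le /(_ _ Ki) [N _ /(_ N (leqnn N))] := @qpoch_cvg x.
rewrite p0 sub0r normrN => /(le_trans (lb N)).
by rewrite ler_pdivlMr // ger_pMr ?invr_gt0 // -[X in _ <= X]add0r -[2]/(1 + 1) lerD2r ler10.
Qed.

Lemma cvg_geometric0 x : x * q ^+ n @[n --> \oo] --> (0 : C).
Proof.
have -> : (0 : C) = x * 0 by rewrite mulr0.
apply: cvgMl_tmp; apply/cvgrPdist_le => e e0.
have h : `|q| ^+ n @[n --> \oo] --> (0 : C) by exact: geometric_cvg0.
have /cvgrPdist_le /(_ _ e0) := h; apply: filterS => n.
by rewrite !sub0r !normrN !normrX normr_id.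
Qed.

End Pochhammer.

(** * Geometric completeness of the complex numbers *)

Section ComplexCompleteness.
Variable R : realType.
Local Open Scope complex_scope.

Lemma complex_geometrically_complete : geometrically_complete R[i].
Proof.
move=> u K r r0 r1 hu.
have K0 : 0 <= K by have := hu 0%N; rewrite expr0 mulr1; apply: le_trans.
(* In R[i] the inequalities 0 <= r and 0 <= K force r and K to be real, so that everything reduces
   to two real series. *)
have rE : r = (complex.Re r)%:C by rewrite RRe_real // ger0_real.
have KE : K = (complex.Re K)%:C by rewrite RRe_real // ger0_real.
move: r0 r1 K0 hu; rewrite rE KE; set r' := complex.Re r; set K' := complex.Re K.
rewrite !lecR ltcR => r0 r1 K0 hu.
have cb (v : nat -> R) : (forall k, `|v k| <= K' * r' ^+ k) -> cvgn (series v).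
  move=> hv; apply: normed_cvg; apply: (@series_le_cvg _ _ (geometric K' r')) => //.
  - by move=> n /=.
  - by move=> n; rewrite /geometric /= mulr_ge0 ?exprn_ge0.
  - by apply: is_cvg_geometric_series; rewrite ger0_norm.
have cRe : cvgn (series (fun k => complex.Re (u k))).
  apply: cb => k; rewrite -lecR rmorphM rmorphXn.
  by apply: le_trans (hu k); exact: normc_ge_Re.
have cIm : cvgn (series (fun k => complex.Im (u k))).
  apply: cb => k; rewrite -lecR rmorphM rmorphXn; apply: le_trans (hu k).
  by rewrite normc_def lecR -sqrtr_sqr ler_wsqrtr // lerDr sqr_ge0.
set a := limn (series (fun k => complex.Re (u k))) in cRe.
set b := limn (series (fun k => complex.Im (u k))) in cIm.
have sE n : series u n = (series (fun k => complex.Re (u k)) n) +i*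
    (series (fun k => complex.Im (u k)) n).
  rewrite /series /=; elim: n => [|n ih]; first by rewrite !big_geq.
  by rewrite !big_nat_recr //= ih; case: (u n).
apply/cvg_ex; exists (a +i* b); apply/cvgrPdist_le => e e0.
have eE : e = (complex.Re e)%:C by rewrite RRe_real // gtr0_real.
move: e0; rewrite eE ltcR; set e' := complex.Re e => e0.
have e2 : 0 < e' / 2 by rewrite divr_gt0.
move/cvgrPdist_le : cRe => /(_ _ e2) h1; move/cvgrPdist_le : cIm => /(_ _ e2) h2.
apply: filterS2 h1 h2 => n h1 h2; rewrite sE.
set s := series _ n in h1 *; set t := series _ n in h2 *.
have -> : a +i* b - (s +i* t) = (a - s)%:C + 'i * (b - t)%:C.
  by apply/eqP; rewrite eq_complex /=; apply/andP; split; apply/eqP; ring.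
rewrite (le_trans (ler_normD _ _)) // normrM.
have nr (x : R) : `|x%:C| = `|x|%:C by rewrite normc_def /= expr0n /= addr0 sqrtr_sqr.
have -> : `|'i : R[i]| = 1 by rewrite normc_def /= expr0n /= add0r expr1n sqrtr1.
rewrite !nr mul1r -rmorphD lecR; apply: le_trans (lerD h1 h2) _.
by rewrite -splitr.
Qed.

End ComplexCompleteness.

(** * Jackson's sum, the 6phi5 sum and the transformation of 8W7 *)

Section Jackson.
Variables (C : numFieldType) (q : C).
Local Notation poch := (qpoch q).

(** The polynomial identity on which the telescoping in [stepS] rests; there [K] is q^(k-1) and [J]
    is q^(n-k) for the summation index k. *)
Lemma jackson_step_identity (b c d m K J : C) :
  (1 - b * c * d * m * q * K ^+ 2) *
   ((1 - b * c * d * m * m * q * K ^+ 2 * J) * (1 - m * J)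
     * ((1 - q * (q * K * J)) * (1 - c * d * m * (q * K * J))
        * (1 - b * d * m * (q * K * J)) * (1 - b * c * m * (q * K * J)))
   - (1 - b * c * d * m * m * K * J) * (1 - b * m * (q * K * J))
       * (1 - c * m * (q * K * J)) * (1 - d * m * (q * K * J))
       * ((1 - b * c * d * m * q ^+ 2 * K ^+ 2 * J) * (1 - q * J)))
  = - J * (1 - b * c * d * m ^+ 2 * q ^+ 2 * K ^+ 2 * J ^+ 2)
    * (m * ((1 - b * c * d * m * K) * (1 - b * (q * K))
         * (1 - c * (q * K)) * (1 - d * (q * K)))
       * ((1 - b * c * d * m * m * q * K ^+ 2 * J) * (1 - q * J))
     - q * ((1 - q * K) * (1 - c * d * m * K) * (1 - b * d * m * K)
          * (1 - b * c * m * K))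
       * ((1 - m * J) * (1 - b * c * d * m * q ^+ 2 * K ^+ 2 * J))).
Proof. ring. Qed.

Section JacksonSum.
Variables (a b c d m : C).
Hypothesis aE : a * q = b * c * d * m.
Hypothesis aq0 : forall n, poch (a * q) n != 0.
Hypothesis qq0 : forall n, poch q n != 0.
Hypothesis b0 : forall n, poch (c * d * m) n != 0.
Hypothesis c0 : forall n, poch (b * d * m) n != 0.
Hypothesis d0 : forall n, poch (b * c * m) n != 0.

Let V k := (1 - a * q ^+ (2 * k))
  * (poch a k * poch b k * poch c k * poch d k
     / (poch q k * poch (c * d * m) k * poch (b * d * m) k * poch (b * c * m) k))
  * m ^+ k.
Let t n k := V k * (poch (a * m) (n + k) * poch m (n - k)
  / (poch (a * q) (n + k) * poch q (n - k))).
Let num n := (1 - a * m * q ^+ n) * (1 - b * m * q ^+ n) * (1 - c * m * q ^+ n)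
  * (1 - d * m * q ^+ n).
Let den n := (1 - q * q ^+ n) * (1 - c * d * m * q ^+ n)
  * (1 - b * d * m * q ^+ n) * (1 - b * c * m * q ^+ n).
(** The certificate of a creative telescoping: t(n+1,k) den(n) - t(n,k) num(n) = H(n,k) - H(n,k-1),
    where num(n)/den(n) is the quotient of two consecutive values of the closed form [rhs]. *)
Let H n k := - q ^+ (n - k) * (1 - a * m * q ^+ (n + n.+1))
  * (poch a k.+1 * poch b k.+1 * poch c k.+1 * poch d k.+1
     / (poch q k * poch (c * d * m) k * poch (b * d * m) k * poch (b * c * m) k))
  * m ^+ k.+1 * (poch (a * m) (n + k).+1 * poch m (n - k)
  / (poch (a * q) (n + k).+1 * poch q (n - k))).

Let split4 x k : (forall n, poch x n != 0) -> 1 - x * q ^+ k != 0.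
Proof. by move=> h; move/qpoch_neq0P: h. Qed.

Let step0 n : t n.+1 0 * den n - t n 0 * num n = H n 0.
Proof.
rewrite /t /V /H !addn0 !subn0 !muln0 !expr0 !qpochn0 !qpochSr !qpochn0 !expr0.
have := aq0 n; have := qq0 n; have := split4 n aq0; have := split4 n qq0.
rewrite /num /den exprD exprS aE.
have -> : a * m * (q ^+ n * (q * q ^+ n)) = b * c * d * m * m * (q ^+ n * q ^+ n).
  by rewrite -aE; ring.
move: (poch (a * m) n) (poch m n) (poch (b * c * d * m) n) (poch q n) => A B D E.
set Q := q ^+ n => h1 h2 h3 h4; field.
by rewrite h1 h2 h3 h4.
Qed.

Let stepS n m' j : n = (m'.+1 + j)%N ->
  t n.+1 m'.+1 * den n - t n m'.+1 * num n = H n m'.+1 - H n m'.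
Proof.
move=> nE; rewrite /t /V /H.
have -> : (n.+1 - m'.+1 = j.+1)%N by lia.
have -> : (n - m'.+1 = j)%N by lia.
have -> : (n - m' = j.+1)%N by lia.
rewrite !addSn !addnS; set s := (n + m')%N.
have qn : q ^+ n = q * q ^+ m' * q ^+ j by rewrite nE exprD exprS.
have qs : q ^+ s = q * (q ^+ m') ^+ 2 * q ^+ j by rewrite /s exprD qn; ring.
have q2 : a * q ^+ (2 * m'.+1) = b * c * d * m * q * (q ^+ m') ^+ 2.
  by rewrite mul2n -addnn exprD exprS -aE; ring.
have qnn : a * m * q ^+ (n + n).+1
    = b * c * d * m ^+ 2 * q ^+ 2 * (q ^+ m') ^+ 2 * (q ^+ j) ^+ 2.
  by rewrite exprS exprD qn -[_ * m ^+ 2]mulrA; transitivity (a * q * m * (q * q ^+ m' * q ^+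
    j) ^+ 2); [ring|rewrite aE; ring].
rewrite qnn q2 /num /den qn.
rewrite !(qpochSr q _ m'.+1) !(qpochSr q _ s.+1) !(qpochSr q _ j).
rewrite (qpochSr q q m') (qpochSr q (c * d * m) m') (qpochSr q (b * d * m) m')
  (qpochSr q (b * c * m) m').
have n1 := aq0 s.+1; have n2 := qq0 j; have n3 := qq0 m'; have n4 := b0 m'.
have n5 := c0 m'; have n6 := d0 m'; have n7 := split4 s.+1 aq0.
have n8 := split4 j qq0; have n9 := split4 m' qq0; have n10 := split4 m' b0.
have n11 := split4 m' c0; have n12 := split4 m' d0.
move: n1 n2 n3 n4 n5 n6 n7 n8 n9 n10 n11 n12.
have -> : a * q * q ^+ s.+1 = b * c * d * m * q ^+ 2 * q ^+ m' ^+ 2 * q ^+ j.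
  by rewrite exprS qs aE; ring.
have -> : a * m * q ^+ s.+1 = b * c * d * m * m * q * q ^+ m' ^+ 2 * q ^+ j.
  by rewrite exprS qs; transitivity (a * q * m * (q * q ^+ m' ^+ 2 * q ^+ j)); [ring|rewrite
    aE; ring].
have -> : a * m * (q * q ^+ m' * q ^+ j) = b * c * d * m * m * q ^+ m' * q ^+ j.
  by transitivity (a * q * m * (q ^+ m' * q ^+ j)); [ring|rewrite aE; ring].
have -> : a * q ^+ m'.+1 = b * c * d * m * q ^+ m' by rewrite exprS mulrA aE.
rewrite !(exprS _ j) (exprS _ m'.+1) !(exprS _ m').
have := jackson_step_identity b c d m (q ^+ m') (q ^+ j).
move: (q ^+ m') (q ^+ j) (poch a m'.+1) (poch b m'.+1) (poch c m'.+1) (poch d m'.+1)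
  (poch q m') (poch (c * d * m) m') (poch (b * d * m) m') (poch (b * c * m) m')
  (poch (a * m) s.+1) (poch m j) (poch (a * q) s.+1) (poch q j) (m ^+ m').
move=> K J A1 A2 A3 A4 B1 B2 B3 B4 E1 E2 E3 E4 M.
(* The linear factors become indeterminates: the claim now follows linearly from the polynomial
   identity, and [field] need not expand them. *)
move: (1 - b * c * d * m * q * K ^+ 2) (1 - b * c * d * m * m * q * K ^+ 2 * J)
  (1 - m * J) (1 - q * (q * K * J)) (1 - c * d * m * (q * K * J))
  (1 - b * d * m * (q * K * J)) (1 - b * c * m * (q * K * J))
  (1 - b * c * d * m * m * K * J) (1 - b * m * (q * K * J))
  (1 - c * m * (q * K * J)) (1 - d * m * (q * K * J))
  (1 - b * c * d * m * q ^+ 2 * K ^+ 2 * J) (1 - q * J)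
  (1 - b * c * d * m ^+ 2 * q ^+ 2 * K ^+ 2 * J ^+ 2)
  (1 - b * c * d * m * K) (1 - b * (q * K)) (1 - c * (q * K)) (1 - d * (q * K))
  (1 - q * K) (1 - c * d * m * K) (1 - b * d * m * K) (1 - b * c * m * K).
move=> L u1 u2 D1 D2 D3 D4 N1 N2 N3 N4 v1 v2 W p1 p2 p3 p4 r1 r2 r3 r4.
move=> /eqP; rewrite -subr_eq0 => /eqP core.
move=> n1 n2 n3 n4 n5 n6 n7 n8 n9 n10 n11 n12.
apply/eqP; rewrite -subr_eq0; apply/eqP.
(* The difference of the two sides is the identity [core] times this common factor of its terms. *)
rewrite -[RHS](mulr0 (A1 * A2 * A3 * A4 * m * M * E1 * E2 /
  (B1 * B2 * B3 * B4 * r1 * r2 * r3 * r4 * E3 * E4 * v1 * v2))) -core.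
field.
by rewrite n1 n2 n3 n4 n5 n6 n7 n8 n9 n10 n11 n12.
Qed.

(** The last index is treated apart: t(n,n+1) should be 0, because of 1/(q;q)_(-1), but the
    truncated subtraction n - (n+1) = 0 gives it another value. *)
Let step_last n : t n.+1 n.+1 * den n = - H n n.
Proof.
rewrite /t /V /H !subnn !qpochn0 expr0 !addSn !addnS (qpochSr q _ (n + n).+1).
rewrite (qpochSr q (a * q) (n + n).+1).
rewrite (qpochSr q q n) (qpochSr q (c * d * m) n) (qpochSr q (b * d * m) n)
  (qpochSr q (b * c * m) n) /den.
have n1 := aq0 (n + n).+1; have n2 := split4 (n + n).+1 aq0; have n3 := qq0 n.
have n4 := b0 n; have n5 := c0 n; have n6 := d0 n; have n9 := split4 n qq0.
have n10 := split4 n b0; have n11 := split4 n c0; have n12 := split4 n d0.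
have -> : a * q ^+ (2 * n.+1) = a * q * q ^+ (n + n).+1.
  by rewrite -mulrA -exprS; congr (_ * _ ^+ _); lia.
move: n1 n2 n3 n4 n5 n6 n9 n10 n11 n12.
move: (1 - a * q * q ^+ (n + n).+1) (1 - a * m * q ^+ (n + n).+1) (1 - q * q ^+ n)
  (1 - c * d * m * q ^+ n) (1 - b * d * m * q ^+ n) (1 - b * c * m * q ^+ n).
move=> v1 v2 v3 v4 v5 v6 n1 n2 n3 n4 n5 n6 n9 n10 n11 n12; field.
by rewrite n1 n2 n3 n4 n5 n6 n9 n10 n11 n12.
Qed.

Let telescoped n k : (k <= n)%N ->
  \sum_(0 <= i < k.+1) (t n.+1 i * den n - t n i * num n) = H n k.
Proof.
elim: k => [|k ih] kn; first by rewrite big_nat1 step0.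
rewrite big_nat_recr //= ih ?(ltnW kn)//.
rewrite (@stepS n k (n - k.+1)) ?subnKC //; ring.
Qed.

Let rhs n := poch (a * m) n * poch (b * m) n * poch (c * m) n * poch (d * m) n
  / (poch q n * poch (c * d * m) n * poch (b * d * m) n * poch (b * c * m) n).

Let sum_t n : \sum_(0 <= k < n.+1) t n k = (1 - a) * rhs n.
Proof.
elim: n => [|n ih].
  by rewrite big_nat1 /t /V /rhs !qpochn0 muln0 !expr0; field.
have den0 : den n != 0 by rewrite /den !mulf_neq0 ?split4.
apply: (mulIf den0).
have rec : rhs n.+1 * den n = rhs n * num n.
  rewrite /rhs /num /den !qpochSr.
  have n3 := qq0 n; have n4 := b0 n; have n5 := c0 n; have n6 := d0 n.
  have n9 := split4 n qq0; have n10 := split4 n b0; have n11 := split4 n c0.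
  have n12 := split4 n d0.
  by field; rewrite n3 n4 n5 n6 n9 n10 n11 n12.
have -> : (1 - a) * rhs n.+1 * den n = (\sum_(0 <= k < n.+1) t n k) * num n.
  by rewrite ih -[LHS]mulrA rec mulrA.
rewrite big_nat_recr //= mulrDl step_last -telescoped //.
by rewrite sumrB !mulr_suml; ring.
Qed.

(** Jackson's terminating sum with parameters b, c, d, a m q^n, q^-n, where m = aq/(bcd), so that c
    d m is aq/b, and so on. It is multiplied by (am;q)_n (m;q)_n / ((aq;q)_n (q;q)_n), which turns
    the two parameters that depend on n into products of n+k and n-k factors and removes all
    negative powers of q. *)
Lemma jackson_sum n : 1 - a != 0 ->
  \sum_(0 <= k < n.+1)
    (1 - a * q ^+ (2 * k)) / (1 - a)
  * (poch a k * poch b k * poch c k * poch d k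
     / (poch q k * poch (c * d * m) k * poch (b * d * m) k * poch (b * c * m) k))
  * m ^+ k * (poch (a * m) (n + k) * poch m (n - k)
  / (poch (a * q) (n + k) * poch q (n - k)))
  = poch (a * m) n * poch (b * m) n * poch (c * m) n * poch (d * m) n
  / (poch q n * poch (c * d * m) n * poch (b * d * m) n * poch (b * c * m) n).
Proof.
move=> a1; have := sum_t n; rewrite -/(rhs n) => h.
apply: (mulfI a1); rewrite -h mulr_sumr; apply: eq_bigr => k _.
by rewrite /t /V -!mulrA [LHS]mulrCA mulVKf.
Qed.
End JacksonSum.
End Jackson.

(** * Series with bounded coefficients and the 6phi5 sum *)

Section BoundedSeries.
Variable C : numFieldType.

Lemma unif_boundedVM (T : Type) (f g : nat -> T -> C) :
  unif_bounded (fun N t => (f N t)^-1) -> unif_bounded (fun N t => (g N t)^-1) ->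
  unif_bounded (fun N t => (f N t * g N t)^-1).
Proof.
move=> hf hg; have [K hK] := unif_boundedM hf hg; exists K.
by apply: filterS hK => N hN t; rewrite invfM; exact: hN.
Qed.

Lemma unif_bounded_if (T : Type) (c : nat -> T -> bool) (f : nat -> T -> C) :
  unif_bounded f -> unif_bounded (fun N t => if c N t then f N t else 0).
Proof.
move=> [K hK]; exists K; apply: filterS hK => N hN t; case: ifP => // _.
by rewrite normr0; apply: le_trans (hN t).
Qed.

Variables (gc : geometrically_complete C).

Lemma lim_series_scale (c : C) (u : nat -> C) : cvgn (series u) ->
  limn (series (fun k => c * u k)) = c * limn (series u).
Proof.
move=> cu; apply/cvg_lim => //.
have -> : series (fun k => c * u k) = (fun n => c * series u n).
  by apply/funext => n; rewrite /series /= mulr_sumr.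
by apply: cvgMl_tmp.
Qed.

Lemma cvg_series_bounded (u : nat -> C) (z : C) : `|z| < 1 ->
  unif_bounded (fun (_ : nat) k => u k) -> cvgn (series (fun k => u k * z ^+ k)).
Proof.
move=> z1 /unif_bounded_const [K hK]; apply: (gc (K := K) (r := `|z|)) => // k.
by rewrite normrM normrX ler_wpM2r ?exprn_ge0.
Qed.

Lemma tannery_bounded (f : nat -> nat -> C) (g : nat -> C) (z : C) : `|z| < 1 ->
  unif_bounded f -> (forall k, f N k @[N --> \oo] --> g k) ->
  limn (series (fun k => f N k * z ^+ k)) @[N --> \oo]
    --> limn (series (fun k => g k * z ^+ k)).
Proof.
move=> z1 [K hK] fg; apply: (tannery gc (K := K) (r := `|z|)) => //.
  by apply: filterS hK => N hN k; rewrite normrM normrX ler_wpM2r ?exprn_ge0.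
by move=> k; apply: cvgMr_tmp.
Qed.

(** A sum up to N is a series whose coefficients are set to 0 beyond N; this changes neither the
    bound nor the limits. *)
Lemma tannery_finite (f : nat -> nat -> C) (g : nat -> C) (z : C) : `|z| < 1 ->
  unif_bounded f -> (forall k, f N k @[N --> \oo] --> g k) ->
  \sum_(0 <= k < N.+1) f N k * z ^+ k @[N --> \oo]
    --> limn (series (fun k => g k * z ^+ k)).
Proof.
move=> z1 fb fg.
have h := @tannery_bounded (fun N k => if (k <= N)%N then f N k else 0) g z z1
  (unif_bounded_if _ fb).
apply: cvg_trans (h _); last first.
  move=> k; apply: cvg_trans (fg k); apply: near_eq_cvg.
  by near=> N; rewrite ifT //; near: N; exact: nbhs_infty_ge.
apply: near_eq_cvg; near=> N.
rewrite (@lim_series_finite _ _ N.+1) => [|k Nk]; last by rewrite leqNgt Nk mul0r.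
by rewrite big_mkord; apply: eq_bigr => k _; rewrite -ltnS ltn_ord.
Unshelve. all: by end_near. Qed.

Variable q : C.
Hypothesis q1 : `|q| < 1.
Local Notation poch := (qpoch q).
Local Notation pinf := (qpoch_inf q).

Lemma unif_bounded_qpoch_at (T : Type) (x : C) (h : nat -> T -> nat) :
  unif_bounded (fun N t => poch x (h N t)).
Proof.
exact: (unif_bounded_reindex h (unif_bounded_qpoch gc q1 (cvg_cst x))).
Qed.

Lemma unif_bounded_qpochV_at (T : Type) (x : C) (h : nat -> T -> nat) :
  (forall n, poch x n != 0) -> unif_bounded (fun N t => (poch x (h N t))^-1).
Proof.
move=> x0.
exact: (unif_bounded_reindex h (unif_bounded_qpochV gc q1 (cvg_cst x) x0)).
Qed.

Lemma unif_bounded_expn (T : Type) (z : C) (h : nat -> T -> nat) :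
  `|z| <= 1 -> unif_bounded (fun N t => z ^+ h N t).
Proof.
by move=> z1; exists 1; near=> N => t; rewrite normrX exprn_ile1.
Unshelve. all: by end_near. Qed.

Lemma cvg_qpoch_at (x : C) (h : nat -> nat) : (forall m, \forall N \near \oo, (m <= h N)%N) ->
  poch x (h N) @[N --> \oo] --> pinf x.
Proof.
move=> hh; apply: (cvg_comp h (poch x) _ (@qpoch_cvg _ gc _ q1 x)).
by move=> A [m _ hm]; apply: filterS (hh m) => N; exact: hm.
Qed.

Lemma cvg_qpochD x k : poch x (N + k) @[N --> \oo] --> pinf x.
Proof.
apply: cvg_qpoch_at => m; near=> N; apply: leq_trans (leq_addr _ _).
by near: N; exact: nbhs_infty_ge.
Unshelve. all: by end_near. Qed.

Lemma cvg_qpochB x k : poch x (N - k) @[N --> \oo] --> pinf x.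
Proof.
apply: cvg_qpoch_at => m; near=> N; rewrite leq_subRL; last first.
  by near: N; exact: nbhs_infty_ge.
by near: N; exact: nbhs_infty_ge.
Unshelve. all: by end_near. Qed.

Lemma qpoch_small_neq0 x n : `|x| < 1 -> poch x n != 0.
Proof.
move=> x1; move: n; apply/qpoch_neq0P => n; rewrite subr_eq0; apply/eqP => h.
have : `|x * q ^+ n| < 1.
  rewrite normrM normrX (le_lt_trans _ x1) // ler_piMr // exprn_ile1 // ltW //.
by rewrite -h normr1 ltxx.
Qed.

(** The limit n -> oo of [jackson_sum]: the products of n+k and n-k factors tend to a constant
    [Kinf] that does not depend on k. The condition on a m allows this constant to be cancelled. *)
Lemma six_phi_five (a b c d m : C) : a * q = b * c * d * m -> `|m| < 1 ->
  1 - a != 0 ->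
  (forall n, poch (a * q) n != 0) -> (forall n, poch (a * m) n != 0) ->
  (forall n, poch (c * d * m) n != 0) -> (forall n, poch (b * d * m) n != 0) ->
  (forall n, poch (b * c * m) n != 0) ->
  limn (series (fun k =>
    (1 - a * q ^+ (2 * k)) / (1 - a)
    * (poch a k * poch b k * poch c k * poch d k
     / (poch q k * poch (c * d * m) k * poch (b * d * m) k * poch (b * c * m) k))
    * m ^+ k))
  = pinf (a * q) * pinf (b * m) * pinf (c * m) * pinf (d * m)
    / (pinf m * pinf (c * d * m) * pinf (b * d * m) * pinf (b * c * m)).
Proof.
move=> aE m1 a1 aq0 am0 b0 c0 d0.
have qq0 n : poch q n != 0 by exact: qpoch_small_neq0.
have mm0 n : poch m n != 0 by exact: qpoch_small_neq0.
pose u k := (1 - a * q ^+ (2 * k)) / (1 - a)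
    * (poch a k * poch b k * poch c k * poch d k
     / (poch q k * poch (c * d * m) k * poch (b * d * m) k * poch (b * c * m) k)).
have ub : unif_bounded (fun (_ : nat) k => u k).
  apply: unif_boundedM.
    apply: unif_boundedM; last exact: unif_bounded_cst.
    apply: unif_boundedB; first exact: unif_bounded_cst.
    by apply: unif_boundedM; [exact: unif_bounded_cst|apply: unif_bounded_expn; exact: ltW].
  apply: unif_boundedM.
    by do !apply: unif_boundedM; exact: unif_bounded_qpoch_at.
  by do !apply: unif_boundedVM; exact: unif_bounded_qpochV_at.
pose f N k := u k * (poch (a * m) (N + k) * poch m (N - k)
  / (poch (a * q) (N + k) * poch q (N - k))).
pose Kinf := pinf (a * m) * pinf m / (pinf (a * q) * pinf q).
have fb : unif_bounded f.
  apply: unif_boundedM; first exact: (unif_bounded_reindex (fun _ k => k) ub).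
  apply: unif_boundedM; first by apply: unif_boundedM; exact: unif_bounded_qpoch_at.
  by apply: unif_boundedVM; exact: unif_bounded_qpochV_at.
have n1 := qpoch_inf_neq0 gc q1 aq0; have n2 := qpoch_inf_neq0 gc q1 qq0.
have n3 := qpoch_inf_neq0 gc q1 b0; have n4 := qpoch_inf_neq0 gc q1 c0.
have n5 := qpoch_inf_neq0 gc q1 d0; have n6 := qpoch_inf_neq0 gc q1 am0.
have n7 := qpoch_inf_neq0 gc q1 mm0.
have fl k : f N k @[N --> \oo] --> u k * Kinf.
  apply: cvgMl_tmp; apply: cvgM.
    by apply: cvgM; [exact: cvg_qpochD|exact: cvg_qpochB].
  apply: cvgV; first by rewrite mulf_neq0.
  by apply: cvgM; [exact: cvg_qpochD|exact: cvg_qpochB].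
have := tannery_finite m1 fb fl.
have -> : limn (series (fun k => u k * Kinf * m ^+ k))
    = Kinf * limn (series (fun k => u k * m ^+ k)).
  rewrite -lim_series_scale; last exact: cvg_series_bounded.
  by congr (limn (series _)); apply/funext => k; rewrite mulrAC mulrC.
have -> : (fun N => \sum_(0 <= k < N.+1) f N k * m ^+ k) = (fun N =>
    poch (a * m) N * poch (b * m) N * poch (c * m) N * poch (d * m) N
  / (poch q N * poch (c * d * m) N * poch (b * d * m) N * poch (b * c * m) N)).
  apply/funext => N; rewrite -(jackson_sum aE) //.
  by apply: eq_bigr => k _; rewrite /f /u mulrAC.
have c2 : poch (a * m) N * poch (b * m) N * poch (c * m) N * poch (d * m) N
  / (poch q N * poch (c * d * m) N * poch (b * d * m) N * poch (b * c * m) N)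
  @[N --> \oo] --> pinf (a * m) * pinf (b * m) * pinf (c * m) * pinf (d * m)
  / (pinf q * pinf (c * d * m) * pinf (b * d * m) * pinf (b * c * m)).
  apply: cvgM; first by do !apply: cvgM; exact: qpoch_cvg.
  apply: cvgV; first by rewrite !mulf_neq0.
  by do !apply: cvgM; exact: qpoch_cvg.
move=> c1; set L := limn _ in c1 *.
have hL := cvg_unique (@norm_hausdorff _ _) c1 c2.
apply: (mulfI (x := pinf (a * m) * pinf m / (pinf (a * q) * pinf q))).
  by rewrite !mulf_neq0 ?invr_neq0 ?mulf_neq0.
rewrite -/Kinf hL /Kinf; field.
by rewrite n1 n2 n3 n4 n5 n7.
Qed.

End BoundedSeries.

Lemma sum_triangle (V : zmodType) (g : nat -> nat -> V) M :
  \sum_(0 <= n < M) \sum_(0 <= j < n.+1) g j (n - j)%N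
  = \sum_(0 <= j < M) \sum_(0 <= i < M - j) g j i.
Proof.
elim: M => [|M ih]; first by rewrite !big_geq.
rewrite big_nat_recr //= ih [RHS]big_nat_recr //= subSnn big_nat1.
rewrite [X in _ + X]big_nat_recr //= subnn addrA -big_split /=; congr (_ + _).
by apply: eq_big_nat => j /andP[_ jM]; rewrite (subSn (ltnW jM)) [RHS]big_nat_recr.
Qed.

(** * Bailey's transformation between nonterminating 8W7 series *)

Section Transformation.
Variables (C : numFieldType) (gc : geometrically_complete C) (q : C).
Hypothesis q1 : `|q| < 1.
Local Notation poch := (qpoch q).
Local Notation pinf := (qpoch_inf q).

Section Statement.
Variables (a l b c d m e f : C).
Let z := l * q / (e * f).
Let w := a * q / (e * f).
Hypothesis aE : a = l * m.
Hypothesis lE : l * q = b * c * d * m.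
Hypothesis e0 : e != 0.
Hypothesis f0 : f != 0.
Hypothesis z1 : `|z| < 1.
Hypothesis w1 : `|w| < 1.
Hypothesis a1 : forall n, poch a n != 0.
Hypothesis l1 : 1 - l != 0.
Hypothesis lq0 : forall n, poch (l * q) n != 0.
Hypothesis az0 : forall n, poch (a * z) n != 0.
Hypothesis b0 : forall n, poch (c * d * m) n != 0.
Hypothesis c0 : forall n, poch (b * d * m) n != 0.
Hypothesis d0 : forall n, poch (b * c * m) n != 0.
Hypothesis ae0 : forall n, poch (a * q / e) n != 0.
Hypothesis af0 : forall n, poch (a * q / f) n != 0.
Hypothesis le0 : forall n, poch (l * q / e) n != 0.
Hypothesis lf0 : forall n, poch (l * q / f) n != 0.

Let qq0 n : poch q n != 0.
Proof. exact: qpoch_small_neq0. Qed.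

Let zz0 n : poch z n != 0.
Proof. exact: qpoch_small_neq0. Qed.

Let a1k k : 1 - a * q ^+ k != 0.
Proof. by move/qpoch_neq0P : a1. Qed.

Let a10 : 1 - a != 0.
Proof. by have := a1k 0; rewrite mulr1. Qed.

Let aq0 n : poch (a * q) n != 0.
Proof. by have := a1 n.+1; rewrite qpochSl mulf_eq0 negb_or => /andP[]. Qed.

Let V j := (1 - l * q ^+ (2 * j)) / (1 - l)
  * (poch l j * poch b j * poch c j * poch d j
     / (poch q j * poch (c * d * m) j * poch (b * d * m) j * poch (b * c * m) j)).
(** The double series obtained by expanding the k-th term by Jackson's sum, with k = i + j. Its
    weight m^j z^(i+j) is z^i w^j since w = m z, and its coefficients [G] are bounded in both
    indices. *)
Let G j i := V j
  * (poch a (i + 2 * j) * poch m i / (poch (l * q) (i + 2 * j) * poch q i))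
  * ((1 - a * q ^+ (2 * (i + j))) / (1 - a))
  * (poch e (i + j) * poch f (i + j)
     / (poch (a * q / e) (i + j) * poch (a * q / f) (i + j))).
Let g j i := G j i * z ^+ i * w ^+ j.
Let L k := (1 - a * q ^+ (2 * k)) / (1 - a)
  * (poch a k * poch (b * m) k * poch (c * m) k * poch (d * m) k
     / (poch q k * poch (c * d * m) k * poch (b * d * m) k * poch (b * c * m) k))
  * (poch e k * poch f k / (poch (a * q / e) k * poch (a * q / f) k)).
Let r j := V j * (poch e j * poch f j / (poch (l * q / e) j * poch (l * q / f) j)).
Let pref := pinf (a * q) * pinf w * pinf (l * q / e) * pinf (l * q / f)
  / (pinf (l * q) * pinf (a * q / e) * pinf (a * q / f) * pinf z).

Let wE : w = m * z. Proof. by rewrite /w /z aE; ring. Qed.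

Let partial_sum M : \sum_(0 <= k < M) L k * z ^+ k
  = \sum_(0 <= j < M) \sum_(0 <= i < M - j) g j i.
Proof.
rewrite -sum_triangle; apply: eq_bigr => k _.
have := jackson_sum lE lq0 qq0 b0 c0 d0 k l1; rewrite -aE /L => <-.
rewrite mulr_sumr !mulr_suml; apply: eq_big_nat => j /andP[_ jk].
rewrite /g /G subnK -1?ltnS //.
have -> : (k - j + 2 * j = k + j)%N by lia.
have -> : z ^+ k = z ^+ (k - j) * z ^+ j by rewrite -exprD subnK.
by rewrite wE [(m * z) ^+ j]exprMn /V; move: (z ^+ (k - j)) (z ^+ j) => y1 y2; ring.
Qed.

Let G_bounded : unif_bounded (fun (_ : nat) (p : nat * nat) => G p.1 p.2).
Proof.
have hV : unif_bounded (fun (_ : nat) (p : nat * nat) => V p.1).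
  apply: unif_boundedM.
    apply: unif_boundedM; last exact: unif_bounded_cst.
    apply: unif_boundedB; first exact: unif_bounded_cst.
    apply: unif_boundedM; [exact: unif_bounded_cst|].
    by apply: (@unif_bounded_expn _ _ q (fun _ p => 2 * p.1)%N); exact: ltW.
  apply: unif_boundedM.
    do !apply: unif_boundedM.
    - exact: (unif_bounded_qpoch_at gc q1 _ (fun _ p => p.1)).
    - exact: (unif_bounded_qpoch_at gc q1 _ (fun _ p => p.1)).
    - exact: (unif_bounded_qpoch_at gc q1 _ (fun _ p => p.1)).
    - exact: (unif_bounded_qpoch_at gc q1 _ (fun _ p => p.1)).
  do !apply: unif_boundedVM.
  - exact: (unif_bounded_qpochV_at gc q1 (fun _ p => p.1)).
  - exact: (unif_bounded_qpochV_at gc q1 (fun _ p => p.1)).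
  - exact: (unif_bounded_qpochV_at gc q1 (fun _ p => p.1)).
  - exact: (unif_bounded_qpochV_at gc q1 (fun _ p => p.1)).
apply: unif_boundedM; last first.
  apply: unif_boundedM.
    by apply: unif_boundedM;
      exact: (unif_bounded_qpoch_at gc q1 _ (fun _ p => p.2 + p.1)%N).
  by apply: unif_boundedVM;
    exact: (unif_bounded_qpochV_at gc q1 (fun _ p => p.2 + p.1)%N).
apply: unif_boundedM; last first.
  apply: unif_boundedM; last exact: unif_bounded_cst.
  apply: unif_boundedB; first exact: unif_bounded_cst.
  apply: unif_boundedM; [exact: unif_bounded_cst|].
  by apply: (@unif_bounded_expn _ _ q (fun _ p => 2 * (p.2 + p.1))%N); exact: ltW.
apply: unif_boundedM; first exact: hV.
apply: unif_boundedM.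
  apply: unif_boundedM.
    exact: (unif_bounded_qpoch_at gc q1 _ (fun _ p => p.2 + 2 * p.1)%N).
  exact: (unif_bounded_qpoch_at gc q1 _ (fun _ p => p.2)%N).
apply: unif_boundedVM.
  exact: (unif_bounded_qpochV_at gc q1 (fun _ p => p.2 + 2 * p.1)%N).
exact: (unif_bounded_qpochV_at gc q1 (fun _ p => p.2)%N).
Qed.

(** For fixed j the sum over i is a 6phi5 with base a q^(2j), parameters m, e q^j, f q^j and
    argument z. Its value is, up to a constant, the j-th coefficient of the series with base l. *)
Let inner j : limn (series (fun i => G j i * z ^+ i)) = pref * r j.
Proof.
pose A := a * q ^+ (2 * j).
pose K := V j * (poch e j * poch f j / (poch (a * q / e) j * poch (a * q / f) j))
  * (poch (a * q) (2 * j) / poch (l * q) (2 * j)).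
have x1 : e * q ^+ j * (f * q ^+ j) * z = l * q * q ^+ (2 * j).
  by rewrite /z mul2n -addnn exprD; field; rewrite e0 f0.
have x2 : m * (f * q ^+ j) * z = a * q / e * q ^+ j.
  by rewrite /z aE; field; rewrite e0 f0.
have x3 : m * (e * q ^+ j) * z = a * q / f * q ^+ j.
  by rewrite /z aE; field; rewrite e0 f0.
have x4 : e * q ^+ j * z = l * q / f * q ^+ j by rewrite /z; field; rewrite e0 f0.
have x5 : f * q ^+ j * z = l * q / e * q ^+ j by rewrite /z; field; rewrite e0 f0.
have x6 : A * q = m * (e * q ^+ j) * (f * q ^+ j) * z.
  have -> : m * (e * q ^+ j) * (f * q ^+ j) * z
      = m * (e * q ^+ j * (f * q ^+ j) * z) by ring.
  by rewrite x1 /A aE; ring.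
have sh x k : (forall n, poch x n != 0) -> forall n, poch (x * q ^+ k) n != 0.
  by move=> h n; have := h (k + n)%N; rewrite qpoch_addn mulf_eq0 negb_or => /andP[].
have A1 : 1 - A != 0 by exact: a1k.
have Aq : A * q = a * q * q ^+ (2 * j) by rewrite /A; ring.
have Az : A * z = a * z * q ^+ (2 * j) by rewrite /A; ring.
have := @six_phi_five C gc q q1 A m (e * q ^+ j) (f * q ^+ j) z x6 z1 A1.
rewrite x1 x2 x3 x4 x5 Aq Az -wE.
move=> /(_ (sh _ _ aq0) (sh _ _ az0) (sh _ _ lq0) (sh _ _ ae0) (sh _ _ af0)).
set six := fun k => _ => sixE.
have aq2 : poch a (2 * j) * (1 - A) = (1 - a) * poch (a * q) (2 * j).
  by rewrite -qpochSr qpochSl.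
have GE i : G j i * z ^+ i = K * (six i).
  rewrite /G /six /K mulnDr exprD
    [q ^+ (2 * i) * _]mulrC (mulrA a) -/A.
  rewrite (addnC i j) (addnC i (2 * j)%N) (qpoch_addn q a) (qpoch_addn q (l * q)).
  rewrite (qpoch_addn q e) (qpoch_addn q f) (qpoch_addn q (a * q / e)).
  rewrite (qpoch_addn q (a * q / f)) -/A.
  have -> : poch (a * q) (2 * j) = poch a (2 * j) * (1 - A) / (1 - a).
    by rewrite aq2 mulrAC divff ?mul1r.
  have n1 := lq0 (2 * j)%N; have n2 := ae0 j; have n3 := af0 j.
  have n4 := sh _ (2 * j)%N lq0 i; have n5 := sh _ j ae0 i; have n6 := sh _ j af0 i.
  have n7 := qq0 i.
  move: (z ^+ i) (V j) => zi v; field.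
  by rewrite n1 n2 n3 n4 n5 n6 n7 a10 A1.
have -> : (fun i => G j i * z ^+ i) = (fun i => K * six i) by apply/funext.
have csix : cvgn (series six).
  apply: cvg_series_bounded => //; apply: unif_boundedM.
    apply: unif_boundedM; last exact: unif_bounded_cst.
    apply: unif_boundedB; first exact: unif_bounded_cst.
    apply: unif_boundedM; [exact: unif_bounded_cst|].
    by apply: unif_bounded_expn; exact: ltW.
  apply: unif_boundedM; first by do !apply: unif_boundedM; exact: unif_bounded_qpoch_at.
  by do !apply: unif_boundedVM; apply: unif_bounded_qpochV_at => //; exact: sh.
rewrite lim_series_scale // sixE /K /r /pref.
rewrite (qpoch_inf_split gc q1 (a * q) (2 * j)) (qpoch_inf_split gc q1 (l * q) (2 * j)).
rewrite (qpoch_inf_split gc q1 (a * q / e) j) (qpoch_inf_split gc q1 (a * q / f) j).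
rewrite (qpoch_inf_split gc q1 (l * q / e) j) (qpoch_inf_split gc q1 (l * q / f) j).
have n1 := lq0 (2 * j)%N; have n2 := ae0 j; have n3 := af0 j.
have n4 := qpoch_inf_neq0 gc q1 (sh _ (2 * j)%N lq0).
have n5 := qpoch_inf_neq0 gc q1 (sh _ j ae0).
have n6 := qpoch_inf_neq0 gc q1 (sh _ j af0).
have n7 := qpoch_inf_neq0 gc q1 zz0; have n8 := le0 j; have n9 := lf0 j.
move: (V j) => v; field.
by rewrite n1 n2 n3 n4 n5 n6 n7 n8 n9.
Qed.

(** In the term of index k of the left series, the factors with b m, c m, d m are the closed form of
    Jackson's sum in base l. Replacing them by that sum and summing over i = k - j first leaves a
    single series in j. *)
Lemma well_poised_transformation :
  limn (series (fun k => L k * z ^+ k)) = pref * limn (series (fun j => r j * w ^+ j)).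
Proof.
(* The partial sums of the left series run over the triangle i + j <= M, so the inner sums are
   truncated at a point that depends on j. They are bounded by K / (1 - |z|), which leaves w^j as
   majorant of the outer sum. *)
pose F (M j : nat) := if (j <= M)%N then \sum_(0 <= i < M.+1 - j) G j i * z ^+ i else 0.
have [K hK] := unif_bounded_const G_bounded.
have Fb : unif_bounded F.
  apply: unif_bounded_if; exists (K / (1 - `|z|)); near=> M => j.
  apply: le_trans (ler_norm_sum _ _ _) _.
  have K0 : 0 <= K by apply: le_trans (hK (0, 0)%N).
  apply: (@le_trans _ _ (\sum_(0 <= i < M.+1 - j) K * `|z| ^+ i)).
    apply: ler_sum => i _; rewrite normrM normrX ler_wpM2r ?exprn_ge0 //.
    exact: hK (j, i).
  rewrite -mulr_sumr ler_wpM2l // (le_trans (sum_geometric_le _ _ _ _)) //.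
  by rewrite expr0 mul1r.
have cG j : cvgn (series (fun i => G j i * z ^+ i)).
  apply: (gc (K := K) (r := `|z|)) => // i.
  rewrite normrM normrX ler_wpM2r ?exprn_ge0 //; exact: hK (j, i).
have Fl j : F M j @[M --> \oo] --> pref * r j.
  rewrite -inner; apply: (@cvg_trans _ (series (fun i => G j i * z ^+ i) (M.+1 - j)%N
      @[M --> \oo])).
    apply: near_eq_cvg; near=> M; rewrite /F ifT //.
    by near: M; exact: nbhs_infty_ge.
  apply: (cvg_comp (fun M => M.+1 - j)%N _ _ (cG j)) => A [p _ hp].
  have h : \forall M \near \oo, (p <= M.+1 - j)%N.
    near=> M; have pjM : (p + j <= M)%N by near: M; exact: nbhs_infty_ge.
    by lia.
  by apply: filterS h => M; exact: hp.
have crs : cvgn (series (fun j => r j * w ^+ j)).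
  apply: cvg_series_bounded => //; apply: unif_boundedM; last first.
    apply: unif_boundedM; first by apply: unif_boundedM; exact: unif_bounded_qpoch_at.
    by apply: unif_boundedVM; exact: unif_bounded_qpochV_at.
  apply: unif_boundedM.
    apply: unif_boundedM; last exact: unif_bounded_cst.
    apply: unif_boundedB; first exact: unif_bounded_cst.
    apply: unif_boundedM; [exact: unif_bounded_cst|].
    by apply: unif_bounded_expn; exact: ltW.
  apply: unif_boundedM; first by do !apply: unif_boundedM; exact: unif_bounded_qpoch_at.
  by do !apply: unif_boundedVM; exact: unif_bounded_qpochV_at.
have := tannery_finite gc w1 Fb Fl.
have -> : limn (series (fun k => pref * r k * w ^+ k))
    = pref * limn (series (fun j => r j * w ^+ j)).
  rewrite -lim_series_scale //.
  by congr (limn (series _)); apply/funext => k; rewrite -mulrA.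
have -> : (fun N => \sum_(0 <= k < N.+1) F N k * w ^+ k)
    = (fun N => series (fun k => L k * z ^+ k) N.+1).
  apply/funext => N; rewrite /series /= partial_sum; apply: eq_big_nat => j /andP[_ jN].
  by rewrite /F -ltnS jN mulr_suml.
by rewrite (cvg_shiftS (series _)) => h; exact/cvg_lim.
Unshelve. all: by end_near. Qed.

End Statement.
End Transformation.

(** * Slater's relation *)

Section PartialFractions.
Variable F : fieldType.

(** The sum is the coefficient of degree #|I| - 1 in Lagrange's interpolation formula for P, and P
    has smaller degree. *)
Lemma lagrange_top_coef (I : finType) (u : I -> F) (P : {poly F}) :
  injective u -> (size P < #|I|)%N ->
  \sum_i P.[u i] / \prod_(j | j != i) (u i - u j) = 0.
Proof.
move=> uI sP.
pose c i := P.[u i] / \prod_(j | j != i) (u i - u j).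
pose B i : {poly F} := \prod_(j | j != i) ('X - (u j)%:P).
have d0 i : \prod_(j | j != i) (u i - u j) != 0.
  by apply/prodf_neq0 => j ji; rewrite subr_eq0 (inj_eq uI) eq_sym.
have BE i k : (B k).[u i] = if i == k then \prod_(j | j != i) (u i - u j) else 0.
  rewrite horner_prod; case: eqVneq => [->|ik].
    by apply: eq_bigr => j _; rewrite hornerXsubC.
  by rewrite (bigD1 i) //= hornerXsubC subrr mul0r.
have sB i : size (B i) = #|I|.
  rewrite /B -big_filter size_prod_XsubC deprecated_filter_index_enum.
  by rewrite -cardE cardC1 prednK //; apply/card_gt0P; exists i.
pose Q : {poly F} := \sum_i c i *: B i.
have sQ : (size Q <= #|I|)%N.
  apply: (leq_trans (size_sum _ _ _)); apply/bigmax_leqP => i _.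
  by rewrite (leq_trans (size_scale_leq _ _)) // sB.
have PQ : P = Q.
  apply/eqP; rewrite -subr_eq0; apply/eqP.
  apply: (@roots_geq_poly_eq0 _ _ [seq u i | i <- enum I]).
  - apply/allP => _ /mapP[i _ ->]; apply/rootP.
    rewrite hornerD hornerN /Q horner_sum (bigD1 i) //= big1 => [|k ki].
      by rewrite addr0 hornerZ BE eqxx /c divfK // subrr.
    by rewrite hornerZ BE eq_sym (negPf ki) mulr0.
  - by rewrite map_inj_uniq // enum_uniq.
  - rewrite size_map -cardE (leq_trans (size_polyD _ _)) // size_polyN geq_max sQ.
    by rewrite ltnW.
transitivity (Q`_(#|I|.-1)); last first.
  rewrite -PQ nth_default //; move: sP; case: #|I| => //.
rewrite /Q coef_sum; apply: eq_bigr => i _; rewrite coefZ.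
have -> : (B i)`_(#|I|.-1) = 1.
  by rewrite -(sB i) -lead_coefE; apply/monicP; exact: monic_prod_XsubC.
by rewrite mulr1.
Qed.

(* The points c and a / c are identified through u = c / a + 1 / c, in which
   every factor below is affine. *)
Lemma well_poised_partial_fractions (I K : finType) (a : F) (c : I -> F)
  (e : K -> F) : a != 0 -> (forall i, c i != 0) ->
  (forall i j, i != j -> 1 - c i * c j / a != 0) ->
  (forall i j, i != j -> 1 - c j / c i != 0) -> (#|K|.+1 < #|I|)%N ->
  \sum_i (c i)^-1 * \prod_k ((1 - c i * e k) * (1 - a * e k / c i))
    / \prod_(j | j != i) ((1 - c i * c j / a) * (1 - c j / c i)) = 0.
Proof.
move=> a0 c0 ca cc KI.
pose u i := c i / a + (c i)^-1.
have uE i j : (1 - c i * c j / a) * (1 - c j / c i) = - c j * (u i - u j).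
  by rewrite /u; field; rewrite a0 !c0.
have uI : injective u.
  move=> i j uij; apply/eqP; apply/negPn/negP => ij.
  have := mulf_neq0 (ca _ _ ij) (cc _ _ ij).
  by rewrite uE uij subrr mulr0 eqxx.
pose P : {poly F} := \prod_k ((1 + a * e k ^+ 2)%:P - (a * e k) *: 'X).
have PE i : P.[u i] = \prod_k ((1 - c i * e k) * (1 - a * e k / c i)).
  rewrite horner_prod; apply: eq_bigr => k _.
  by rewrite hornerD hornerN hornerC hornerZ hornerX /u; field; rewrite a0 c0.
have sP : (size P < #|I|)%N.
  apply: leq_trans KI; rewrite ltnS.
  apply: (leq_trans (size_poly_prod_leq _ _)).
  have h : (\sum_(k : K) size ((1 + a * e k ^+ 2)%:P - (a * e k) *: 'X : {poly F})%R
      <= \sum_(k : K) 2)%N.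
    apply: leq_sum => k _; rewrite (leq_trans (size_polyD _ _)) // size_polyN geq_max.
    rewrite (leq_trans (size_polyC_leq1 _)) //=.
    by rewrite (leq_trans (size_scale_leq _ _)) // size_polyX.
  rewrite leq_subLR addnS ltnS (leq_trans h) // sum_nat_const.
  by rewrite muln2 -addnn leq_add2l.
have := lagrange_top_coef uI sP.
(* The factors - c j extracted by [uE] omit j = i. Completing them to the full product [D] costs a
   factor - c i, which the weight (c i)^-1 of the statement compensates. *)
pose D := \prod_j (- c j).
have DE i : D = - c i * \prod_(j | j != i) (- c j) by rewrite /D (bigD1 i).
move=> h; transitivity (- D^-1 * \sum_i P.[u i] / \prod_(j | j != i) (u i - u j)).
  2: by rewrite h mulr0.
rewrite mulr_sumr; apply: eq_bigr => i _.
have -> : \prod_(j | j != i) ((1 - c i * c j / a) * (1 - c j / c i))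
    = \prod_(j | j != i) (- c j) * \prod_(j | j != i) (u i - u j).
  by rewrite -big_split; apply: eq_bigr => j _; exact: uE.
rewrite PE (DE i).
have p0 : \prod_(j | j != i) (- c j) != 0.
  by apply/prodf_neq0 => j _; rewrite oppr_eq0.
have p1 : \prod_(j | j != i) (u i - u j) != 0.
  by apply/prodf_neq0 => j ji; rewrite subr_eq0 (inj_eq uI) eq_sym.
move: p0 p1; move: (\prod_(j | _) _) (\prod_(j | _) _) => x y x0 y0.
by move: (\prod_k _) => t; field; rewrite x0 y0 oppr_eq0 c0.
Qed.

End PartialFractions.

Section Slater.
Variables (C : numFieldType) (gc : geometrically_complete C) (q : C).
Hypothesis q0 : q != 0.
Hypothesis q1 : `|q| < 1.
Local Notation poch := (qpoch q).
Local Notation pinf := (qpoch_inf q).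

(** The monomial that appears when (y q^-k;q)_k is read backwards as a multiple of (q/y;q)_k. In a
    quotient of two such products only a k-th power survives. *)
Let rev (y : C) k := \prod_(0 <= i < k) (- y / q ^+ i.+1).

Lemma qpoch_rev (y : C) k : y != 0 -> poch (y / q ^+ k) k = rev y k * poch (q / y) k.
Proof.
move=> y0; rewrite /qpoch /rev big_nat_rev -big_split /=; apply: eq_big_nat => i /andP[_ ik].
rewrite add0n; have -> : (k = (k - i.+1) + i.+1)%N by rewrite subnK.
have h n : q ^+ n != 0 by rewrite expf_neq0.
by rewrite addnK exprD [q ^+ i.+1]exprS; field; rewrite y0 q0 !h.
Qed.

Lemma qpoch_div (y : C) k N : y != 0 -> (k <= N)%N ->
  poch (y / q ^+ k) N = rev y k * poch (q / y) k * poch y (N - k).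
Proof.
move=> y0 kN; rewrite -{1}(subnKC kN) qpoch_addn qpoch_rev // divfK //.
by rewrite expf_neq0.
Qed.

Lemma qpoch_mul (y : C) k N : poch y k != 0 ->
  poch (y * q ^+ k) N = poch y (k + N) / poch y k.
Proof. by move=> y0; rewrite qpoch_addn mulrAC divff ?mul1r. Qed.

Lemma rev_ratio (y w : C) k : y != 0 -> w != 0 -> rev y k / rev w k = (y / w) ^+ k.
Proof.
move=> y0 w0; rewrite /rev -prodf_div -(subn0 k) -prodr_const_nat.
rewrite subn0; apply: eq_bigr => i _; have h n : q ^+ n != 0 by rewrite expf_neq0.
by field; rewrite w0 h.
Qed.

Lemma qpoch_div_ratio (y w : C) k : y != 0 -> w != 0 ->
  poch (y / q ^+ k) k / poch (w / q ^+ k) k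
  = (y / w) ^+ k * (poch (q / y) k / poch (q / w) k).
Proof. by move=> y0 w0; rewrite !qpoch_rev // -rev_ratio // invfM mulrACA. Qed.

Variables (r : nat) (a : C) (s x : 'I_r -> C).
Hypothesis r2 : (1 < r)%N.
Hypothesis a0 : a != 0.
Hypothesis s0 : forall i, s i != 0.
Hypothesis x0 : forall i, x i != 0.
Hypothesis ss0 : forall i j n, poch (s i * s j / a) n != 0.
Hypothesis sr0 : forall i j n, i != j -> poch (s j / s i) n != 0.
Hypothesis sx0 : forall i j n, poch (s i * q / x j) n != 0.

(** The very-well-poised series with base s_i^2/a: for j = i the first quotient is (s_i^2/a;q)_k /
    (q;q)_k. Its k-th term comes from the interpolation point s_i q^k. *)
Definition slater_term i k :=
  (1 - s i ^+ 2 / a * q ^+ (2 * k)) * \prod_j (poch (s i * s j / a) k / poch (s i * q / s j) k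
     * (poch (s i * x j / a) k / poch (s i * q / x j) k)).
Definition slater_arg := q^-1 * \prod_j (a * q / (x j * s j)).
(** For j = i the product (s_j/s_i;q)_oo would be (1;q)_oo = 0; without its vanishing factor it is
    (q;q)_oo. *)
Definition slater_coef i := (s i)^-1 * \prod_j (pinf (s i * q / x j) * pinf (a * q / (x j * s i))
  / (pinf (s i * s j / a) * (if j == i then pinf q else pinf (s j / s i)))).

(** The finite form of [slater_coef], without the factor (s i)^-1: it carries all the dependence on
    N, and its limit does not depend on k. *)
Let H i N k := \prod_j (poch (s i * q / x j) (k + N) * poch (a * q / (x j * s i)) (N - k)
  / (poch (s i * s j / a) (k + N.+1)
     * (if j == i then poch q (N - k) else poch (s j / s i) (N.+1 - k)))).

Let qq0 n : poch q n != 0.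
Proof. exact: qpoch_small_neq0. Qed.

Let ow0 i j n : poch (s i * q / s j) n != 0.
Proof.
have [->|ij] := eqVneq i j; first by rewrite mulrC mulrA mulVf ?mul1r.
have := sr0 n.+1 (negbT (introF eqP (fun h => negP ij (introT eqP (esym h))))).
by rewrite qpochSl mulrAC mulf_eq0 negb_or => /andP[].
Qed.

(** The points are s_i q^l with l <= N. Those with the same i as the given point s_i q^k omit l = k,
    and restoring the missing factor in the first product produces the very-well-poised factor 1 -
    s_i^2 q^(2k) / a. *)
Let own i (N : nat) (k : 'I_N.+1) :
  \prod_(l : 'I_N.+1 | l != k) ((1 - s i * q ^+ k * (s i * q ^+ l) / a)
    * (1 - s i * q ^+ l / (s i * q ^+ k)))
  = poch (s i * s i / a) (k + N.+1) / poch (s i * s i / a) k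
    / (1 - s i ^+ 2 / a * q ^+ (2 * k)) * (rev 1 k * poch q k * poch q (N - k)).
Proof.
have A0 : 1 - s i ^+ 2 / a * q ^+ (2 * k) != 0.
  by have := ss0 i i; move/qpoch_neq0P => /(_ (2 * k)%N).
rewrite big_split /=; congr (_ * _).
  rewrite -qpoch_mul ?ss0 // /qpoch big_mkord [X in _ = X / _](bigD1 k) //=.
  have -> : 1 - s i * s i / a * q ^+ k * q ^+ k = 1 - s i ^+ 2 / a * q ^+ (2 * k).
    by rewrite mul2n -addnn exprD expr2; ring.
  by rewrite mulrAC divff ?mul1r //; apply: eq_bigr => l _; ring.
have h n : q ^+ n != 0 by rewrite expf_neq0.
have -> : rev 1 k * poch q k = poch (1 / q ^+ k) k.
  by rewrite qpoch_rev ?oner_eq0 // divr1.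
transitivity (\prod_(l < N.+1) (if l != k then 1 - q ^+ l / q ^+ k else 1)).
  by rewrite -big_mkcond; apply: eq_bigr => l _; rewrite invfM mulrACA divff ?mul1r.
pose F l := if l != k :> nat then 1 - q ^+ l / q ^+ k else 1.
rewrite (eq_bigr (fun l : 'I_N.+1 => F l)) => [|l _]; last by rewrite /F.
rewrite -(big_mkord xpredT F) (@big_cat_nat _ _ _ k) //=; last by rewrite ltnW // ltn_ord.
rewrite [X in _ * X]big_ltn // {2}/F eqxx /= mul1r; congr (_ * _).
  rewrite /qpoch; apply: eq_big_nat => l /andP[_ lk].
  by rewrite /F neq_ltn lk /=; congr (1 - _); rewrite div1r mulrC.
rewrite -[X in \prod_(X <= _ < _) _]add0n big_addn subSS /qpoch.
apply: eq_big_nat => l _; rewrite /F gtn_eqF /=; last by rewrite addnS ltnS leq_addl.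
by rewrite addnS -addSn exprD mulfK // exprS.
Qed.

Let other i j (N : nat) (k : 'I_N.+1) : i != j ->
  \prod_(l : 'I_N.+1) ((1 - s i * q ^+ k * (s j * q ^+ l) / a)
    * (1 - s j * q ^+ l / (s i * q ^+ k)))
  = poch (s i * s j / a) (k + N.+1) / poch (s i * s j / a) k
    * (rev (s j / s i) k * poch (s i * q / s j) k * poch (s j / s i) (N.+1 - k)).
Proof.
move=> ij; have kN : (k <= N.+1)%N by exact: ltnW.
have h n : q ^+ n != 0 by rewrite expf_neq0.
have -> : s i * q / s j = q / (s j / s i) by field; rewrite !s0.
rewrite -qpoch_div ?mulf_neq0 ?invr_neq0 // -qpoch_mul ?ss0 // big_split /=.
rewrite /qpoch !big_mkord; congr (_ * _); apply: eq_bigr => l _; first by ring.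
by congr (1 - _); field; rewrite s0 h.
Qed.

Let numer i j (N : nat) (k : 'I_N.+1) :
  \prod_(l : 'I_N) ((1 - s i * q ^+ k * (q ^+ l.+1 / x j))
    * (1 - a * (q ^+ l.+1 / x j) / (s i * q ^+ k)))
  = poch (s i * q / x j) (k + N) / poch (s i * q / x j) k
    * (rev (a * q / (x j * s i)) k * poch (s i * x j / a) k
       * poch (a * q / (x j * s i)) (N - k)).
Proof.
have kN : (k <= N)%N by rewrite -ltnS.
have h n : q ^+ n != 0 by rewrite expf_neq0.
have -> : s i * x j / a = q / (a * q / (x j * s i)) by field; rewrite !x0 s0 a0 q0.
rewrite -qpoch_div ?mulf_neq0 ?invr_neq0 ?mulf_neq0 // -qpoch_mul // big_split /=.
rewrite /qpoch !big_mkord; congr (_ * _); apply: eq_bigr => l _; congr (1 - _).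
  by rewrite exprS; ring.
by rewrite exprS; field; rewrite s0 x0 h.
Qed.

Let prod_neq_pair (I J : finType) (i : I) (k : J) (f : I * J -> C) :
  \prod_(p | p != (i, k)) f p
  = (\prod_(l | l != k) f (i, l)) * \prod_(j | j != i) \prod_l f (j, l).
Proof.
rewrite big_mkcond /=.
transitivity (\prod_j \prod_l (if (j, l) != (i, k) then f (j, l) else 1)).
  by rewrite pair_bigA; apply: eq_bigr => -[].
rewrite (bigD1 i) //=; congr (_ * _).
  by rewrite -big_mkcond; apply: eq_bigl => l; rewrite xpair_eqE eqxx.
by apply: eq_bigr => j ji; apply: eq_bigr => l _; rewrite xpair_eqE (negPf ji).
Qed.

Let summand i N (k : 'I_N.+1) :
  (s i)^-1 * (slater_term i k * H i N k * slater_arg ^+ k)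
  = (s i * q ^+ k)^-1 * (\prod_j \prod_(l : 'I_N) ((1 - s i * q ^+ k * (q ^+ l.+1 / x j))
    * (1 - a * (q ^+ l.+1 / x j) / (s i * q ^+ k)))) /
   ((\prod_(l : 'I_N.+1 | l != k) ((1 - s i * q ^+ k * (s i * q ^+ l) / a)
    * (1 - s i * q ^+ l / (s i * q ^+ k)))) *
   \prod_(j | j != i) \prod_(l : 'I_N.+1) ((1 - s i * q ^+ k * (s j * q ^+ l) / a)
    * (1 - s j * q ^+ l / (s i * q ^+ k)))).
Proof.
have A0 : 1 - s i ^+ 2 / a * q ^+ (2 * k) != 0.
  by have := ss0 i i; move/qpoch_neq0P => /(_ (2 * k)%N).
have h n : q ^+ n != 0 by rewrite expf_neq0.
pose Y j := poch (s i * s j / a) (k + N.+1) / poch (s i * s j / a) k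
    * (rev (s j / s i) k * poch (s i * q / s j) k *
    (if j == i then poch q (N - k) else poch (s j / s i) (N.+1 - k))).
have YE : (\prod_(l : 'I_N.+1 | l != k) ((1 - s i * q ^+ k * (s i * q ^+ l) / a)
    * (1 - s i * q ^+ l / (s i * q ^+ k)))) *
   \prod_(j | j != i) \prod_(l : 'I_N.+1) ((1 - s i * q ^+ k * (s j * q ^+ l) / a)
    * (1 - s j * q ^+ l / (s i * q ^+ k)))
    = (\prod_j Y j) / (1 - s i ^+ 2 / a * q ^+ (2 * k)).
  rewrite [in RHS](bigD1 i) //= mulrAC own; congr (_ * _).
    rewrite /Y eqxx divff // [s i * q / s i]mulrAC divff // mul1r.
    by rewrite mulrAC.
  apply: eq_bigr => j ji; rewrite other; last by rewrite eq_sym.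
  by rewrite /Y (negPf ji).
rewrite YE (eq_bigr _ (fun j _ => numer i j k)) /slater_term /H /slater_arg.
have rev0 y n : y != 0 -> rev y n != 0.
  move=> y0; rewrite prodf_seq_neq0; apply/allP => l _.
  by rewrite implyTb mulf_neq0 ?oppr_eq0 ?invr_neq0 ?oppr_eq0.
have if0 j : (if j == i then poch q (N - k) else poch (s j / s i) (N.+1 - k)) != 0.
  by case: (eqVneq j i) => [_|ji]; [exact: qq0|apply: sr0; rewrite eq_sym].
have w0 j : s j / s i != 0 by rewrite mulf_neq0 ?invr_neq0.
have Y0 j : Y j != 0.
  by rewrite /Y; apply: mulf_neq0; [rewrite mulf_neq0 ?invr_neq0|
    rewrite mulf_neq0 ?mulf_neq0 ?rev0].
rewrite invf_div exprMn exprVn -prodrXl.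
rewrite [LHS](_ : _ = (s i * q ^+ k)^-1 * (1 - s i ^+ 2 / a * q ^+ (2 * k)) *
  \prod_j (poch (s i * s j / a) k / poch (s i * q / s j) k
     * (poch (s i * x j / a) k / poch (s i * q / x j) k)
   * (poch (s i * q / x j) (k + N) * poch (a * q / (x j * s i)) (N - k)
  / (poch (s i * s j / a) (k + N.+1)
     * (if j == i then poch q (N - k) else poch (s j / s i) (N.+1 - k))))
   * (a * q / (x j * s j)) ^+ k)); last first.
  rewrite [in RHS]big_split /= [in RHS]big_split /= invfM.
  by move: (\prod_j _) (\prod_j _) (\prod_j _) => P1 P2 P3; ring.
rewrite -!mulrA; congr (_ * _); rewrite [RHS]mulrCA; congr (_ * _).
rewrite -prodf_div; apply: eq_bigr => j _; rewrite /Y.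
have -> : a * q / (x j * s j) = (a * q / (x j * s i)) / (s j / s i).
  by field; rewrite x0 !s0.
have p0 : a * q / (x j * s i) != 0 by rewrite !mulf_neq0 ?invr_neq0 ?mulf_neq0.
rewrite -rev_ratio //; have n1 := rev0 _ k (w0 j); have n2 := if0 j.
have n3 := ss0 i j k; have n4 := ow0 i j k; have n5 := sx0 i j k.
have n6 := ss0 i j (k + N.+1); move: n1 n2 n3 n4 n5 n6.
move: (rev _ _) (rev _ _) => R1 R2; move: (if _ then _ else _) => I.
move: (poch _ _) (poch _ _) (poch _ _) (poch _ _) (poch _ _) (poch _ _) (poch _ _).
by move=> t1 t2 t3 t4 t5 t6 t7 n1 n2 n3 n4 n5 n6; field; rewrite n1 n2 n3 n4 n5 n6.
Qed.

(** Partial fractions at the r(N+1) points s_i q^k, k <= N, with a numerator built from the rN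
    quantities q^(l+1)/x_j, l < N. *)
Let finite_sum N :
  \sum_i (s i)^-1 * \sum_(0 <= k < N.+1) slater_term i k * H i N k * slater_arg ^+ k = 0.
Proof.
have h n : q ^+ n != 0 by rewrite expf_neq0.
pose c (p : 'I_r * 'I_N.+1) := s p.1 * q ^+ p.2.
pose e (p : 'I_r * 'I_N) := q ^+ p.2.+1 / x p.1.
have c0 p : c p != 0 by rewrite mulf_neq0.
have ca p p' : p != p' -> 1 - c p * c p' / a != 0.
  move=> _; have -> : c p * c p' / a = s p.1 * s p'.1 / a * q ^+ (p.2 + p'.2).
    by rewrite exprD /c; ring.
  by have := ss0 p.1 p'.1; move/qpoch_neq0P; exact.
have qn n m : (n < m)%N -> 1 - q ^+ n / q ^+ m != 0 /\ 1 - q ^+ m / q ^+ n != 0.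
  move=> nm; have := qq0 (m - n); rewrite -(subnK nm).
  have -> : (m - n.+1 + n.+1 - n = (m - n.+1).+1)%N by lia.
  set t := (m - n.+1)%N; rewrite qpochSr mulf_eq0 negb_or -exprS => /andP[_ h1].
  have e1 : q ^+ (t + n.+1) / q ^+ n = q ^+ t.+1.
    by rewrite addnS -addSn exprD mulfK.
  split; last by rewrite e1.
  have -> : q ^+ n / q ^+ (t + n.+1) = (q ^+ t.+1)^-1 by rewrite -e1 invf_div.
  by rewrite subr_eq0 eq_sym invr_eq1 -subr_eq0 -oppr_eq0 opprB.
have cc p p' : p != p' -> 1 - c p' / c p != 0.
  case: p p' => [i k] [j l] /= ne; rewrite /c /=.
  have [ij|ij] := eqVneq i j; last first.
    have e1 : s j * q ^+ l / (s i * q ^+ k) = s j / s i * (q ^+ l / q ^+ k).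
      by field; rewrite s0 h.
    have [kl|lk] := leqP k l.
      rewrite e1 -(subnK kl) exprD mulfK //.
      by have := (fun n => sr0 n ij); move/qpoch_neq0P; exact.
    have e2 : s i / s j * q ^+ (k - l) = (s j / s i * (q ^+ l / q ^+ k))^-1.
      by rewrite -{2}(subnK (ltnW lk)) exprD; field; rewrite !s0 !h.
    rewrite e1 subr_eq0 eq_sym -invr_eq1 -e2.
    rewrite eq_sym in ij; have := (fun n => sr0 n ij); move/qpoch_neq0P => /(_ (k - l)%N).
    by rewrite subr_eq0 eq_sym.
  rewrite -ij; have -> : s i * q ^+ l / (s i * q ^+ k) = q ^+ l / q ^+ k.
    by field; rewrite s0 h.
  have : (k : nat) != l by apply: contra ne => /eqP kl; rewrite ij; apply/eqP; congr (_, _);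
    exact: val_inj.
  by rewrite neq_ltn => /orP[] /qn[].
(* The condition rN + 1 < r(N+1) on the degree is where 1 < r is used. *)
have KI : (#|{: 'I_r * 'I_N}|.+1 < #|{: 'I_r * 'I_N.+1}|)%N.
  by rewrite !card_prod !card_ord mulnS -addn2 addnC leq_add2r.
rewrite -[RHS](@well_poised_partial_fractions C _ _ a c e a0 c0 ca cc KI).
under eq_bigr do rewrite big_mkord mulr_sumr.
rewrite pair_bigA /=; apply: eq_bigr => -[i k] _ /=.
rewrite summand; congr (_ * _ / _); first by rewrite pair_bigA.
by rewrite (@prod_neq_pair _ _ i k).
Qed.

Let H_bounded i : unif_bounded (H i).
Proof.
apply: unif_bounded_prod => j _; apply: unif_boundedM.
  by apply: unif_boundedM; exact: unif_bounded_qpoch_at.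
apply: unif_boundedVM; first exact: unif_bounded_qpochV_at.
case: (eqVneq j i) => [_|ji]; apply: unif_bounded_qpochV_at => // n.
by apply: sr0; rewrite eq_sym.
Qed.

Let H_cvg i k : H i N k @[N --> \oo] --> \prod_j (pinf (s i * q / x j) * pinf (a * q / (x j * s i))
  / (pinf (s i * s j / a) * (if j == i then pinf q else pinf (s j / s i)))).
Proof.
have addc y : poch y (k + N) @[N --> \oo] --> pinf y.
  by under eq_fun do rewrite addnC; exact: cvg_qpochD.
apply: cvg_prods => j _; apply: cvgM.
  by apply: cvgM; [exact: addc|exact: cvg_qpochB].
apply: cvgV.
  apply: mulf_neq0; first by apply: (qpoch_inf_neq0 gc q1) => n; exact: ss0.
  by case: (eqVneq j i) => [_|ji]; apply: (qpoch_inf_neq0 gc q1) => // n;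
    apply: sr0; rewrite eq_sym.
apply: cvgM.
  have := addc (s i * s j / a); rewrite -(cvg_shiftS (fun N => poch _ (k + N))).
  by apply.
case: (eqVneq j i) => _; first exact: cvg_qpochB.
have := @cvg_qpochB _ gc q q1 (s j / s i) k.
by rewrite -(cvg_shiftS (fun N => poch _ (N - k))); apply.
Qed.

Let slater_term_bounded i : unif_bounded (fun (_ : nat) k => slater_term i k).
Proof.
apply: unif_boundedM.
  apply: unif_boundedB; first exact: unif_bounded_cst.
  apply: unif_boundedM; [exact: unif_bounded_cst|].
  by apply: unif_bounded_expn; exact: ltW.
by apply: unif_bounded_prod => j _; apply: unif_boundedM; apply: unif_boundedM;
  (exact: unif_bounded_qpoch_at || exact: unif_bounded_qpochV_at).
Qed.

(** The limit N -> oo of [finite_sum], taken in each of the r sums over k separately. *)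
Theorem slater_transformation : `|slater_arg| < 1 ->
  \sum_i slater_coef i * limn (series (fun k => slater_term i k * slater_arg ^+ k)) = 0.
Proof.
move=> Z1; pose K i := \prod_j (pinf (s i * q / x j) * pinf (a * q / (x j * s i))
  / (pinf (s i * s j / a) * (if j == i then pinf q else pinf (s j / s i)))).
have lim_i i : \sum_(0 <= k < N.+1) slater_term i k * H i N k * slater_arg ^+ k
    @[N --> \oo] --> K i * limn (series (fun k => slater_term i k * slater_arg ^+ k)).
  rewrite -lim_series_scale; last exact: cvg_series_bounded.
  have -> : (fun k => K i * (slater_term i k * slater_arg ^+ k))
      = (fun k => slater_term i k * K i * slater_arg ^+ k).
    by apply/funext => k; rewrite mulrA [K i * _]mulrC.
  apply: tannery_finite => //.
    by apply: unif_boundedM; [exact: slater_term_bounded|exact: H_bounded].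
  by move=> k; apply: cvgMl_tmp; exact: H_cvg.
have c0 : (0 : C) @[N --> \oo] --> \sum_i (s i)^-1 *
    (K i * limn (series (fun k => slater_term i k * slater_arg ^+ k))).
  have : \sum_i (s i)^-1 * \sum_(0 <= k < N.+1) slater_term i k * H i N k * slater_arg ^+ k
      @[N --> \oo] --> \sum_i (s i)^-1 *
    (K i * limn (series (fun k => slater_term i k * slater_arg ^+ k))).
    apply: cvg_big => [|i _]; first exact: add_continuous.
    by apply: cvgMl_tmp; exact: lim_i.
  by under eq_fun do rewrite finite_sum.
rewrite (eq_bigr (fun i => (s i)^-1 *
  (K i * limn (series (fun k => slater_term i k * slater_arg ^+ k))))) => [|i _].
  exact: (cvg_unique (@norm_hausdorff _ _) c0 (cvg_cst _)).
by rewrite /slater_coef mulrA.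
Qed.

End Slater.

(** * Theta functions *)

Section Theta.
Variables (C : numFieldType) (gc : geometrically_complete C) (q : C).
Hypothesis q0 : q != 0.
Hypothesis q1 : `|q| < 1.
Local Notation poch := (qpoch q).
Local Notation pinf := (qpoch_inf q).

Let qq0 n : poch q n != 0.
Proof. exact: qpoch_small_neq0. Qed.

(** The term (-1)^n q^(n(n-1)/2) y^n of the theta series, written as a product so that it satisfies
    a first-order recurrence. *)
Let pp (y : C) n := \prod_(0 <= i < n) (- y * q ^+ i).

Let ppS y n : pp y n.+1 = pp y n * (- y * q ^+ n).
Proof. by rewrite /pp big_nat_recr. Qed.

Let pp0 y : pp y 0 = 1. Proof. by rewrite /pp big_geq. Qed.

Let ppE y n : pp y n = (- 1) ^+ n * q ^+ 'C(n, 2) * y ^+ n.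
Proof.
elim: n => [|n ih]; first by rewrite pp0 !expr0 !mulr1.
by rewrite ppS ih binS bin1 exprD !exprS; ring.
Qed.

Lemma q_binomial y M : \sum_(0 <= k < M.+1)
  pp y k * (poch q M / (poch q k * poch q (M - k))) = poch y M.
Proof.
elim: M => [|M ih]; first by rewrite big_nat1 pp0 !qpochn0; field.
pose t k := pp y k * (poch q M / (poch q k * poch q (M - k))).
rewrite (qpochSr q y M) -ih mulrBr mulr1 mulr_suml -sumrN.
rewrite [in RHS]big_nat_recl // [X in _ + X]big_nat_recr //= big_nat_recl // big_nat_recr //=.
have e0 : pp y 0 * (poch q M.+1 / (poch q 0 * poch q (M.+1 - 0)))
    = pp y 0 * (poch q M / (poch q 0 * poch q (M - 0))).
  by rewrite !subn0 !qpochn0 !mul1r !divff.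
have eM : pp y M.+1 * (poch q M.+1 / (poch q M.+1 * poch q (M.+1 - M.+1)))
    = - (pp y M * (poch q M / (poch q M * poch q (M - M))) * (y * q ^+ M)).
  by rewrite !subnn !qpochn0 !mulr1 !divff // !mulr1 ppS; ring.
rewrite e0 eM -!addrA; congr (_ + _); rewrite !addrA; congr (_ + _).
rewrite -big_split /=; apply: eq_big_nat => k /andP[_ kM].
rewrite subSS -(subnSK kM); set j := (M - k.+1)%N.
have -> : q ^+ M = q ^+ k * q * q ^+ j by rewrite -exprSr -exprD subnKC.
rewrite ppS [poch q M.+1]qpochSr (qpochSr q q k) (qpochSr q q j).
have -> : q ^+ M = q ^+ k * q * q ^+ j by rewrite -exprSr -exprD subnKC.
have n1 := qq0 k; have n2 := qq0 j; have := qq0 k.+1; have := qq0 j.+1.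
rewrite !qpochSr !mulf_eq0 !negb_or => /andP[_ n3] /andP[_ n4].
move: n1 n2 n3 n4; move: (poch q M) (poch q k) (poch q j) (q ^+ k) (q ^+ j) (pp y k).
by move=> P A B K J p n1 n2 n3 n4; field; rewrite n1 n2 n3 n4.
Qed.

Let weight N n := poch q (N + N.+1) / (poch q (N.+1 + n) * poch q (N - n)).

(** The q-binomial theorem of order 2N+1 at y = x q^(-N-1), folded around its middle: the indices
    N+1+n and N-n carry the same q-binomial coefficient [weight N n] and give the terms n and -n-1
    of the theta series. The powers of q coming from the shift form a common factor [R]. *)
Let finite_triple x N : x != 0 ->
  \sum_(0 <= n < N.+1) weight N n * (pp x n + pp (q / x) n.+1)
  = poch x N * poch (q / x) N.+1.
Proof.
move=> x0; have h n : q ^+ n != 0 by rewrite expf_neq0.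
pose y := x / q ^+ N.+1; pose R := pp y N.+1.
have y0 : y != 0 by rewrite mulf_neq0 ?invr_neq0.
have pp_neq0 z n : z != 0 -> pp z n != 0.
  by move=> z0; elim: n => [|n ih]; rewrite ?pp0 ?oner_eq0 // ppS !mulf_neq0 ?oppr_eq0.
have R0 : R != 0 by exact: pp_neq0.
have pos n : pp y (N.+1 + n) = R * pp x n.
  elim: n => [|n ih]; first by rewrite addn0 pp0 mulr1.
  by rewrite addnS (ppS y (N.+1 + n)) (ppS x n) ih exprD /y; field; rewrite !h.
have neg n : (n <= N)%N -> pp y (N - n) = R * pp (q / x) n.+1.
  elim: n => [|n ih] nN.
    by rewrite subn0 /R !ppS pp0 expr0 /y exprS; field; rewrite q0 x0 h.
  have e : (N - n = (N - n.+1).+1)%N by lia.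
  have := ih (ltnW nN); rewrite e ppS => ih'.
  have c0 : - y * q ^+ (N - n.+1) != 0 by rewrite mulf_neq0 ?oppr_eq0.
  apply: (mulIf c0); rewrite ih' [in RHS]ppS.
  have -> : q ^+ (N - n.+1) = q ^+ N.+1 / (q ^+ n.+1 * q).
    rewrite -exprSr; apply: (mulIf (h n.+2)); rewrite divfK // -exprD; congr (_ ^+ _); lia.
  by rewrite /y; field; rewrite x0 q0 !h.
have := q_binomial y (N + N.+1).
rewrite (@big_cat_nat _ _ _ N.+1) //=; last by lia.
rewrite -[X in \sum_(X <= _ < (N + N.+1).+1) _]add0n big_addn.
have -> : ((N + N.+1).+1 - N.+1 = N.+1)%N by lia.
rewrite big_nat_rev /= add0n -big_split /=.
have -> : poch y (N + N.+1) = R * (poch x N * poch (q / x) N.+1).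
  rewrite addnC qpoch_addn divfK // [poch y N.+1](_ : _ = R * poch (q / x) N.+1); first by ring.
  rewrite /y /qpoch big_nat_rev /R /pp [X in _ = X * _]big_nat_rev -big_split /=.
  apply: eq_big_nat => i /andP[_ iN]; rewrite add0n subSS.
  have e : q ^+ N.+1 = q ^+ (N - i) * (q * q ^+ i).
    by rewrite -exprS -exprD addnS subnK.
  by rewrite /y e; field; rewrite x0 q0 !h.
move=> hh; apply: (mulfI R0); rewrite -hh mulr_sumr; apply: eq_big_nat => n /andP[_ nN].
rewrite /weight subSS neg // [(n + N.+1)%N]addnC pos.
have -> : (N + N.+1 - (N - n) = N.+1 + n)%N by lia.
have -> : (N + N.+1 - (N.+1 + n) = N - n)%N by lia.
rewrite [poch q (N - n) * _]mulrC; ring.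
Qed.

Let pp_bounded y : unif_bounded (fun (_ : nat) n => pp y n).
Proof.
have /cvgrPdist_le /(_ _ ltr01) [M _ hM] := @cvg_geometric0 _ gc q q1 y.
exists ((1 + `|y|) ^+ M); near=> N => n.
have y1 : 1 <= 1 + `|y| by rewrite lerDl.
have : `|pp y n| <= (1 + `|y|) ^+ minn n M.
  elim: n => [|n ih]; first by rewrite min0n pp0 normr1.
  rewrite ppS normrM mulNr normrN; have [Mn|nM] := leqP M n.
    move: ih; rewrite (minn_idPr Mn) (minn_idPr (leqW Mn)) => ih.
    rewrite -[leRHS]mulr1 ler_pM //; have := hM n Mn; by rewrite sub0r normrN.
  move: ih; rewrite (minn_idPl nM) (minn_idPl (ltnW nM)) => ih.
  rewrite exprSr ler_pM // normrM normrX (@le_trans _ _ `|y|) ?lerDr //.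
  by rewrite ler_piMr // exprn_ile1 // ltW.
by move=> /le_trans; apply; rewrite ler_weXn2l // geq_minr.
Unshelve. all: by end_near. Qed.

Let half : `|2^-1 : C| < 1.
Proof. by rewrite ger0_norm ?invr_ge0 // invf_lt1 // ltr1n. Qed.

(** The terms decrease faster than any geometric sequence; this displays them as bounded
    coefficients times powers of 1/2, the form that Tannery's theorem takes. *)
Let pp_half y n : pp y n = pp (2 * y) n * 2^-1 ^+ n.
Proof.
have h : (2 : C) != 0 by rewrite pnatr_eq0.
by rewrite !ppE [(2 * y) ^+ n]exprMn -!mulrA; congr (_ * (_ * _));
  rewrite mulrCA -exprMn divff // expr1n mulr1.
Qed.

Theorem jacobi_triple_product x : x != 0 -> theta q x = pinf x * pinf (q / x).
Proof.
move=> x0.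
have qi0 : pinf q != 0 by exact: (qpoch_inf_neq0 gc q1).
have posE k : (-1) ^ (Posz k) * q ^ ((Posz k) * ((Posz k) - 1) %/ 2)%Z * x ^ (Posz k) = pp x k.
  rewrite ppE -!exprnP; congr (_ * _ * _).
  have -> : ((Posz k * (Posz k - 1)) %/ 2)%Z = 'C(k, 2) :> int.
    case: k => [|k]; first by rewrite mul0r.
    by rewrite bin2 -divn2 subzSS subr0 -PoszM divz_nat.
  by [].
(* At n = -(k+1) the exponent n(n-1)/2 is C(k+1,2) + (k+1), so the negative half is the series in
   q/x started at index 1. *)
have negE k : (-1) ^ (Negz k) * q ^ ((Negz k) * ((Negz k) - 1) %/ 2)%Z * x ^ (Negz k)
    = pp (q / x) k.+1.
  rewrite ppE NegzE -!exprnN.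
  have -> : (- (Posz k.+1) * (- (Posz k.+1) - 1) %/ 2)%Z = ('C(k.+1, 2) + k.+1)%N :> int.
    have -> : - (Posz k.+1) * (- (Posz k.+1) - 1) = (k.+2 * k.+1)%N :> int by lia.
    by rewrite divz_nat divn2 -[X in (X * _)%N]/(k.+2) -bin2 binS bin1.
  rewrite -exprnP exprD expr_div_n -[in LHS]exprVn invrN1.
  by move: ((-1) ^+ k.+1) (q ^+ k.+1) (x ^- k.+1) => u v w; rewrite [q ^+ _ * v]mulrC; ring.
have qx0 : q / x != 0 by rewrite mulf_neq0 ?invr_neq0.
have weight_bounded : unif_bounded weight.
  apply: unif_boundedM; first exact: (unif_bounded_qpoch_at gc q1 q (fun N _ => N + N.+1)%N).
  by apply: unif_boundedVM; apply: unif_bounded_qpochV_at.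
have weight_cvg k : weight N k @[N --> \oo] --> (pinf q)^-1.
  have -> : (pinf q)^-1 = pinf q / (pinf q * pinf q) by field.
  apply: cvgM.
    apply: (cvg_qpoch_at gc q1) => m; near=> N; apply: leq_trans (leq_addr _ _).
    by near: N; exact: nbhs_infty_ge.
  apply: cvgV; first by rewrite mulf_neq0.
  apply: cvgM; last exact: cvg_qpochB.
  apply: (cvg_qpoch_at gc q1) => m; near=> N; apply: leq_trans (leq_addr _ _); apply: leqW.
  by near: N; exact: nbhs_infty_ge.
have cv y : cvgn (series (fun k => pp y k)).
  under [X in series X]eq_fun do rewrite pp_half.
  exact: (cvg_series_bounded gc half (pp_bounded _)).
have cvS y : cvgn (series (fun k => pp y k.+1)).
  have -> : (fun k => pp y k.+1) = (fun k => pp (2 * y) k.+1 * 2^-1 * 2^-1 ^+ k).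
    by apply/funext => k; rewrite pp_half exprS mulrA.
  apply: (cvg_series_bounded gc half); apply: unif_boundedM; last exact: unif_bounded_cst.
  exact: (unif_bounded_reindex (fun _ k => k.+1) (pp_bounded (2 * y))).
pose u k := pp x k + pp (q / x) k.+1.
pose v k := pp (2 * x) k + pp (2 * (q / x)) k.+1 * 2^-1.
have uE k : u k = v k * 2^-1 ^+ k.
  by rewrite /u /v mulrDl -pp_half; congr (_ + _); rewrite pp_half exprS [LHS]mulrA.
have vb : unif_bounded (fun (_ : nat) k => v k).
  have -> : (fun _ : nat => [eta v])
      = (fun _ k => pp (2 * x) k - (- pp (2 * (q / x)) k.+1 * 2^-1)).
    by apply/funext => N; apply/funext => k; rewrite mulNr opprK.
  apply: unif_boundedB; first exact: pp_bounded.
  apply: unif_boundedM; last exact: unif_bounded_cst.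
  have [K hK] := pp_bounded (2 * (q / x)); exists K; apply: filterS hK => N hN k.
  by rewrite normrN; exact: hN.
have c1 : \sum_(0 <= n < N.+1) weight N n * u n @[N --> \oo]
    --> (pinf q)^-1 * limn (series u).
  rewrite -lim_series_scale; last first.
    by rewrite (funext uE); exact: cvg_series_bounded.
  have -> : (fun k => (pinf q)^-1 * u k) = (fun k => (pinf q)^-1 * v k * 2^-1 ^+ k).
    by apply/funext => k; rewrite uE mulrA.
  have -> : (fun N => \sum_(0 <= n < N.+1) weight N n * u n)
      = (fun N => \sum_(0 <= n < N.+1) weight N n * v n * 2^-1 ^+ n).
    by apply/funext => N; apply: eq_bigr => k _; rewrite uE mulrA.
  apply: tannery_finite => //; first by apply: unif_boundedM.
  by move=> k; apply: cvgMr_tmp; exact: weight_cvg.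
have c2 : \sum_(0 <= n < N.+1) weight N n * u n @[N --> \oo]
    --> pinf x * pinf (q / x).
  under eq_fun do rewrite finite_triple //.
  apply: cvgM; first exact: qpoch_cvg.
  by rewrite (cvg_shiftS (poch (q / x))); exact: qpoch_cvg.
rewrite -(cvg_unique (@norm_hausdorff _ _) c1 c2) /theta /bilateral_sum; congr (_ * _).
by rewrite (funext posE) (funext negE) -lim_seriesD.
Unshelve. all: by end_near. Qed.

End Theta.

(** * Expansion of 8psi8 in two 8W7 *)

Section BilateralExpansion.
Variables (C : numFieldType) (gc : geometrically_complete C) (q : C).
Hypothesis q0 : q != 0.
Hypothesis q1 : `|q| < 1.
Local Notation poch := (qpoch q).
Local Notation pinf := (qpoch_inf q).

(** x is not an integral power of q. The pair of natural exponents avoids negative powers and makes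
    the condition visibly stable under inversion and under multiplication by powers of q. *)
Definition off_lattice (x : C) : Prop := forall i j : nat, x * q ^+ i != q ^+ j.

Lemma off_lattice_qpoch i j x y n : off_lattice x -> y * q ^+ j = x * q ^+ i -> poch y n != 0.
Proof.
move=> ox e; move: n; apply/qpoch_neq0P => n; rewrite subr_eq0 eq_sym.
apply: contra (ox (i + n)%N j) => /eqP h; apply/eqP.
by rewrite exprD mulrA -e mulrAC h mul1r.
Qed.

Lemma off_lattice_qpochV i j x y n :
  off_lattice x -> y * x * q ^+ j = q ^+ i -> poch y n != 0.
Proof.
move=> ox e; move: n; apply/qpoch_neq0P => n; rewrite subr_eq0 eq_sym.
apply: contra (ox j (i + n)%N) => /eqP h; apply/eqP.
rewrite exprD -e; transitivity (x * q ^+ j * (y * q ^+ n)); last by ring.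
by rewrite h mulr1.
Qed.

Arguments off_lattice_qpoch i j {x y n}.
Arguments off_lattice_qpochV i j {x y n}.

Section Four.
Variables (a s1 s2 s3 s4 x1 x2 x3 x4 : C).
Let ss := [:: s1; s2; s3; s4].
Let xs := [:: x1; x2; x3; x4].
Let s (i : 'I_4) := nth 0 ss i.
Let x (i : 'I_4) := nth 0 xs i.
Let term u k := (1 - u ^+ 2 / a * q ^+ (2 * k)) *
  \prod_(v <- ss) (poch (u * v / a) k / poch (u * q / v) k)
  * \prod_(v <- xs) (poch (u * v / a) k / poch (u * q / v) k).
Let coef u t1 t2 t3 := u^-1 * \prod_(v <- xs) (pinf (u * q / v) * pinf (a * q / (v * u)))
  / (pinf (u * u / a) * pinf q * \prod_(t <- [:: t1; t2; t3]) (pinf (u * t / a) * pinf (t / u))).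
Let Z := a ^+ 4 * q ^+ 3 / (s1 * s2 * s3 * s4 * (x1 * x2 * x3 * x4)).

Lemma slater_four : a != 0 -> all (fun u => u != 0) ss -> all (fun u => u != 0) xs ->
  (forall u v n, u \in ss -> v \in ss -> poch (u * v / a) n != 0) ->
  (forall i j n, (i < 4)%N -> (j < 4)%N -> i != j -> poch (nth 0 ss j / nth 0 ss i) n != 0) ->
  (forall u v n, u \in ss -> v \in xs -> poch (u * q / v) n != 0) ->
  `|Z| < 1 ->
  coef s1 s2 s3 s4 * limn (series (fun k => term s1 k * Z ^+ k))
  + coef s2 s1 s3 s4 * limn (series (fun k => term s2 k * Z ^+ k))
  + coef s3 s1 s2 s4 * limn (series (fun k => term s3 k * Z ^+ k))
  + coef s4 s1 s2 s3 * limn (series (fun k => term s4 k * Z ^+ k)) = 0.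
Proof.
move=> a0 s0 x0 hss hsr hsx Z1.
have sin i : s i \in ss by apply: mem_nth.
have xin i : x i \in xs by apply: mem_nth.
have s0' i : s i != 0 by move/allP: s0; apply.
have x0' i : x i != 0 by move/allP: x0; apply.
have argE : slater_arg q a s x = Z.
  rewrite /slater_arg !big_ord_recr big_ord0 /= /s /x /Z /=.
  have := s0' ord0; have := s0' 1; have := s0' 2; have := s0' ord_max.
  have := x0' ord0; have := x0' 1; have := x0' 2; have := x0' ord_max.
  rewrite /s /x /= => h1 h2 h3 h4 h5 h6 h7 h8; field.
  by rewrite q0 h1 h2 h3 h4 h5 h6 h7 h8.
have termE i : slater_term q a s x i = term (s i).
  apply/funext => k; rewrite /slater_term /term.
  rewrite !big_ord_recr big_ord0 !big_cons !big_nil /=.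
  by rewrite [s ord_max]/s [x ord_max]/x /=; ring.
have := @slater_transformation C gc q q0 q1 4 a s x isT a0 s0' x0'
  (fun i j n => hss _ _ n (sin i) (sin j))
  (fun i j n ij => hsr i j n (ltn_ord i) (ltn_ord j) ij)
  (fun i j n => hsx _ _ n (sin i) (xin j)).
rewrite argE => /(_ Z1) <-.
rewrite !big_ord_recr big_ord0 /= add0r !termE.
have coefE i t1 t2 t3 : \prod_(j | j != i) (pinf (s i * s j / a) * pinf (s j / s i))
    = \prod_(t <- [:: t1; t2; t3]) (pinf (s i * t / a) * pinf (t / s i)) ->
    slater_coef q a s x i = coef (s i) t1 t2 t3.
  move=> h; rewrite /slater_coef /coef -h prodf_div mulrA; congr (_ * _ / _).
    by rewrite !big_ord_recr big_ord0 !big_cons big_nil /= [x ord_max]/x /=; ring.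
  rewrite (bigD1 i) //= eqxx; congr (_ * _).
  by apply: eq_bigr => j /negPf ->.
have sE j (lj : (j < 4)%N) : s (Ordinal lj) = nth 0 ss j by [].
have prodE i : \prod_(j | j != i) (pinf (s i * s j / a) * pinf (s j / s i))
  = \prod_(j <- iota 0 4 | j != i) (pinf (s i * nth 0 ss j / a) * pinf (nth 0 ss j / s i)).
  by rewrite -[iota 0 4]/(index_iota 0 4) big_mkord.
have e1 : slater_coef q a s x (widen_ord (leqnSn 3)
      (widen_ord (leqnSn 2) (widen_ord (leqnSn 1) ord_max))) = coef s1 s2 s3 s4.
  by apply: coefE; rewrite prodE /= !big_cons !big_nil.
have e2 : slater_coef q a s x (widen_ord (leqnSn 3) (widen_ord (leqnSn 2) ord_max))
    = coef s2 s1 s3 s4.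
  by apply: coefE; rewrite prodE /= !big_cons !big_nil.
have e3 : slater_coef q a s x (widen_ord (leqnSn 3) ord_max) = coef s3 s1 s2 s4.
  by apply: coefE; rewrite prodE /= !big_cons !big_nil.
have e4 : slater_coef q a s x ord_max = coef s4 s1 s2 s3.
  by apply: coefE; rewrite prodE /= !big_cons !big_nil.
by rewrite e1 e2 e3 e4.
Qed.

Lemma cvg_slater_four u :
  (forall v n, v \in ss ++ xs -> poch (u * q / v) n != 0) -> `|Z| < 1 ->
  cvgn (series (fun k => term u k * Z ^+ k)).
Proof.
move=> hu Z1; apply: cvg_series_bounded => //.
have hb (l : seq C) : {subset l <= ss ++ xs} ->
    unif_bounded (fun (_ : nat) k => \prod_(v <- l) (poch (u * v / a) k / poch (u * q / v) k)).
  move=> hl; have [K hK] : unif_bounded (fun (_ : nat) k =>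
      \prod_(v <- l | v \in l) (poch (u * v / a) k / poch (u * q / v) k)).
    apply: unif_bounded_prod => v vl; apply: unif_boundedM; first exact: unif_bounded_qpoch_at.
    by apply: unif_bounded_qpochV_at => // n; apply: hu; exact: hl.
  by exists K; apply: filterS hK => N hN k; rewrite big_seq; exact: hN.
apply: unif_boundedM; last by apply: hb => v vx; rewrite mem_cat vx orbT.
apply: unif_boundedM; last by apply: hb => v vx; rewrite mem_cat vx.
apply: unif_boundedB; first exact: unif_bounded_cst.
apply: unif_boundedM; first exact: unif_bounded_cst.
by apply: unif_bounded_expn; exact: ltW.
Qed.

End Four.

Section Expansion.
Variables (a b c x1 x2 x3 x4 : C).
Hypotheses (a0 : a != 0) (b0 : b != 0) (c0 : c != 0) (x10 : x1 != 0) (x20 : x2 != 0)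
  (x30 : x3 != 0) (x40 : x4 != 0).
Hypotheses (oa : off_lattice a) (ob : off_lattice b) (oc : off_lattice c)
  (oba : off_lattice (b / a)) (oca : off_lattice (c / a))
  (obb : off_lattice (b ^+ 2 / a)) (occ : off_lattice (c ^+ 2 / a))
  (obca : off_lattice (b * c / a)) (obc : off_lattice (b / c)).
Hypothesis ox : forall v, v \in [:: x1; x2; x3; x4] ->
  [/\ off_lattice v, off_lattice (v / a), forall n, poch (b * q / v) n != 0
    & forall n, poch (c * q / v) n != 0].
Let Z := a ^+ 3 * q ^+ 2 / (b * c * (x1 * x2 * x3 * x4)).
Hypothesis Z1 : `|Z| < 1.

(** Slater's coefficients for the bases a and b without the factors 1 - a and 1 - b^2/a, which
    [psi88] and [W87] already contain as denominators of their terms. *)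
Definition psi_coef := \prod_(v <- [:: x1; x2; x3; x4]) (pinf (a * q / v) * pinf (q / v))
  / (a * pinf (a * q) * pinf q * (pinf q * pinf (q / a)) * (pinf b * pinf (b / a))
     * (pinf c * pinf (c / a))).
Definition W_coef b c := \prod_(v <- [:: x1; x2; x3; x4]) (pinf (b * q / v) * pinf (a * q / (v
  * b)))
  / (b * pinf (b ^+ 2 * q / a) * pinf q * (pinf b * pinf (a / b))
     * (pinf (b * q / a) * pinf (q / b)) * (pinf (b * c / a) * pinf (c / b))).

Let qq0 n : poch q n != 0.
Proof. exact: qpoch_small_neq0. Qed.

Let ss := [:: a; q; b; c].
Let xs := [:: x1; x2; x3; x4].

Let hss u v n : u \in ss -> v \in ss -> poch (u * v / a) n != 0.
Proof.
have sym w t : poch (w * t / a) n != 0 -> poch (t * w / a) n != 0 by rewrite [t * w]mulrC.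
have h1 t : poch t n != 0 -> poch (a * t / a) n != 0 by rewrite [a * t]mulrC mulfK.
have h2 t : off_lattice (t / a) -> poch (q * t / a) n != 0.
  by move=> ot; apply: (off_lattice_qpoch 1 0 ot); ring.
have oa' : poch (q * q / a) n != 0.
  by apply: (off_lattice_qpochV 2 0 oa); field.
have obb' : poch (b * b / a) n != 0 by apply: (off_lattice_qpoch 0 0 obb); ring.
have occ' : poch (c * c / a) n != 0 by apply: (off_lattice_qpoch 0 0 occ); ring.
have obc' : poch (b * c / a) n != 0 by apply: (off_lattice_qpoch 0 0 obca); ring.
have pq := qq0 n.
have pa : poch a n != 0 by apply: (off_lattice_qpoch 0 0 oa); ring.
have pb : poch b n != 0 by apply: (off_lattice_qpoch 0 0 ob); ring.
have pc : poch c n != 0 by apply: (off_lattice_qpoch 0 0 oc); ring.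
rewrite !inE => /or4P[] /eqP -> /or4P[] /eqP ->.
- exact: h1.
- exact: h1.
- exact: h1.
- exact: h1.
- by apply: sym; apply: h1.
- exact: oa'.
- exact: h2.
- exact: h2.
- by apply: sym; apply: h1.
- by apply: sym; apply: h2.
- exact: obb'.
- exact: obc'.
- by apply: sym; apply: h1.
- by apply: sym; apply: h2.
- by apply: sym; apply: obc'.
- exact: occ'.
Qed.

Let hsr i j n : (i < 4)%N -> (j < 4)%N -> i != j -> poch (nth 0 ss j / nth 0 ss i) n != 0.
Proof.
have inv w : off_lattice w -> w != 0 -> poch w^-1 n != 0.
  by move=> ow w0; apply: (off_lattice_qpochV 0 0 ow); field.
have dir w : off_lattice w -> poch w n != 0.
  by move=> ow; apply: (off_lattice_qpoch 0 0 ow); ring.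
have hq w : off_lattice w -> w != 0 -> poch (q / w) n != 0.
  by move=> ow w0; apply: (off_lattice_qpochV 1 0 ow); field.
have hq' w : off_lattice w -> w != 0 -> poch (w / q) n != 0.
  by move=> ow w0; apply: (off_lattice_qpoch 0 1 ow); field.
have d0 (u v : C) : u != 0 -> v != 0 -> u / v != 0 by move=> *; rewrite mulf_neq0 ?invr_neq0.
case: i => [|[|[|[|//]]]]; case: j => [|[|[|[|//]]]] //= _ _ _;
  first [exact: hq|exact: hq'|exact: dir|by rewrite -invf_div; apply: inv; rewrite ?d0].
Qed.

Let hsx u v n : u \in ss -> v \in xs -> poch (u * q / v) n != 0.
Proof.
move=> us vx; have [p1 p2 p3 p4] := ox vx.
have v0 : v != 0 by move: vx; rewrite !inE => /or4P[] /eqP ->.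
move: us; rewrite !inE => /or4P[] /eqP ->.
- by apply: (off_lattice_qpochV 1 0 p2); field; rewrite a0 v0.
- by apply: (off_lattice_qpochV 2 0 p1); field.
- exact: p3.
- exact: p4.
Qed.

Let ZE : a ^+ 4 * q ^+ 3 / (a * q * b * c * (x1 * x2 * x3 * x4)) = Z.
Proof. by rewrite /Z; field; rewrite x40 x30 x20 x10 c0 b0 a0 q0. Qed.

Let xs0 v : v \in xs -> v != 0.
Proof. by rewrite !inE => /or4P[] /eqP ->. Qed.

Let slater_at u t1 t2 t3 := u^-1 * \prod_(v <- xs) (pinf (u * q / v) * pinf (a * q / (v * u)))
  / (pinf (u * u / a) * pinf q * \prod_(t <- [:: t1; t2; t3]) (pinf (u * t / a) * pinf (t / u))).
Let term u k := (1 - u ^+ 2 / a * q ^+ (2 * k)) *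
  \prod_(v <- ss) (poch (u * v / a) k / poch (u * q / v) k)
  * \prod_(v <- xs) (poch (u * v / a) k / poch (u * q / v) k) * Z ^+ k.

Let four_terms : slater_at a q b c * limn (series (term a))
  + slater_at q a b c * limn (series (term q))
  + slater_at b a q c * limn (series (term b))
  + slater_at c a q b * limn (series (term c)) = 0.
Proof.
have := @slater_four a a q b c x1 x2 x3 x4 a0; rewrite /= ZE a0 q0 b0 c0 x10 x20 x30 x40.
by move=> /(_ isT isT hss hsr hsx Z1).
Qed.

Let cvg_term u : u \in ss -> cvgn (series (term u)).
Proof.
move=> us; have := @cvg_slater_four a a q b c x1 x2 x3 x4 u; rewrite ZE; apply => // v n.
rewrite mem_cat => /orP[vs|vx]; last exact: hsx.
have [i ilt ->] : exists2 i, (i < 4)%N & v = nth 0 ss i.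
  by exists (index v ss); rewrite ?index_mem ?nth_index.
have [j jlt ->] : exists2 j, (j < 4)%N & u = nth 0 ss j.
  by exists (index u ss); rewrite ?index_mem ?nth_index.
have [->|ij] := eqVneq i j.
  by rewrite mulrAC divff ?mul1r //; case: j jlt => [|[|[|[|//]]]].
have := hsr n.+1 ilt jlt ij; rewrite qpochSl mulrAC mulf_eq0 negb_or => /andP[] //.
Qed.

Let a1 : 1 - a != 0.
Proof. by rewrite subr_eq0 eq_sym; have := oa 0 0; rewrite !mulr1. Qed.

Let mulKa v : a * v / a = v.
Proof. by rewrite mulrAC divff // mul1r. Qed.

Let term_psi k : term a k = (1 - a) * psi_term q a [:: b; c; x1; x2; x3; x4] Z (Posz k).
Proof.
rewrite /term /psi_term !big_cons !big_nil /= !mulKa ?expr2 ?mulKa.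
rewrite [a * q / q]mulfK // [q ^ _](_ : _ = q ^+ (2 * k)) //.
have n1 := hss k (mem_head _ _) (mem_head _ _); rewrite mulKa in n1; have n2 := qq0 k.
rewrite -exprnP; move: (poch (a * q / b) k)^-1 (poch (a * q / c) k)^-1 (poch (a * q / x1) k)^-1
  (poch (a * q / x2) k)^-1 (poch (a * q / x3) k)^-1 (poch (a * q / x4) k)^-1.
by move=> y1 y2 y3 y4 y5 y6; field; rewrite n1 n2 a1.
Qed.

Let term_W u w k : (u = b /\ w = c) \/ (u = c /\ w = b) ->
  term u k = (1 - u ^+ 2 / a) * W_term q (u ^+ 2 / a)
    [:: u * w / a; u * x1 / a; u * x2 / a; u * x3 / a; u * x4 / a] Z k.
Proof.
move=> uw.
have u0 : u != 0 by case: uw => [[-> _]|[-> _]].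
have w0 : w != 0 by case: uw => [[_ ->]|[_ ->]].
have u1 : 1 - u ^+ 2 / a != 0.
  rewrite subr_eq0 eq_sym; case: uw => [[-> _]|[-> _]].
    by have := obb 0 0; rewrite !mulr1.
  by have := occ 0 0; rewrite !mulr1.
have us : u \in ss by case: uw => [[-> _]|[-> _]]; rewrite !inE eqxx !orbT.
have e2 : u * a / a = u by rewrite mulfK.
have n1 : poch u k != 0 by rewrite -e2; apply: hss => //; exact: mem_head.
have n2 : poch (u * q / a) k != 0 by apply: hss => //; rewrite !inE eqxx orbT.
have -> : term u k = (1 - u ^+ 2 / a * q ^+ (2 * k)) *
  (\prod_(v <- [:: a; q; u; w]) (poch (u * v / a) k / poch (u * q / v) k)
  * \prod_(v <- xs) (poch (u * v / a) k / poch (u * q / v) k)) * Z ^+ k.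
  rewrite /term !mulrA; congr (_ * _ * _ * _).
  by case: uw => [[-> ->]|[-> ->]] //; rewrite !big_cons; congr (_ * (_ * _)); rewrite mulrCA.
have e1 : u * q / q = u by rewrite mulfK.
have e3 : u * q / u = q by rewrite mulrAC divff ?mul1r.
have e4 v : v != 0 -> u ^+ 2 / a * q / (u * v / a) = u * q / v.
  by move=> v0; field; rewrite v0 u0 a0.
rewrite /W_term !big_cons !big_nil /= e1 e2 e3 !e4 // -expr2.
have n3 : poch q k != 0 by [].
move: (poch (u * q / w) k)^-1 (poch (u * q / x1) k)^-1 (poch (u * q / x2) k)^-1
  (poch (u * q / x3) k)^-1 (poch (u * q / x4) k)^-1.
move: u1; move: (u ^+ 2 / a) => A A1.
by move=> y1 y2 y3 y4 y5; field; rewrite n1 n2 n3 A1.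
Qed.

(** The constant ratio between the term of index -1-k of the bilateral series and the k-th term of
    the series with base q^2/a. *)
Let kappa := - a * Z / (1 - a) * \prod_(v <- [:: b; c; x1; x2; x3; x4]) ((1 - v / a) / (1 - q / v)).

Let term_psi_neg k : psi_term q a [:: b; c; x1; x2; x3; x4] Z (Negz k) = kappa * term q k.
Proof.
have h n : q ^+ n != 0 by rewrite expf_neq0.
have bcx0 v : v \in [:: b; c; x1; x2; x3; x4] -> v != 0.
  by rewrite !inE => /or4P[/eqP->|/eqP->|/eqP->|/or3P[] /eqP ->].
have hneg v : v != 0 -> qpochz q v (Negz k) / qpochz q (a * q / v) (Negz k)
  = (a * q / v ^+ 2) ^+ k.+1 * ((1 - v / a) / (1 - q / v) * (poch (q * v / a) k / poch (q * q /
    v) k)).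
  move=> v0; have w0 : a * q / v != 0 by rewrite !mulf_neq0 ?invr_neq0.
  rewrite /qpochz invrK mulrC qpoch_div_ratio //.
  have -> : a * q / v / v = a * q / v ^+ 2 by field.
  have -> : q / (a * q / v) = v / a by field; rewrite v0 a0 q0.
  have -> : q * v / a = v / a * q by ring.
  have -> : q * q / v = q / v * q by ring.
  by rewrite !qpochSl mulf_div.
rewrite /psi_term /kappa big_seq_cond.
rewrite (eq_bigr (fun v => (a * q / v ^+ 2) ^+ k.+1 *
  ((1 - v / a) / (1 - q / v) * (poch (q * v / a) k / poch (q * q / v) k)))); last first.
  by move=> v /andP[vin _]; apply: hneg; exact: bcx0.
rewrite -big_seq_cond big_split big_split /= -[in RHS]mulrA; set R := \prod_(v <- _) ((1 - v /
  a) / _).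
have -> : term q k = (1 - q ^+ 2 / a * q ^+ (2 * k)) *
  \prod_(v <- [:: b; c; x1; x2; x3; x4]) (poch (q * v / a) k / poch (q * q / v) k) * Z ^+ k.
  rewrite /term !big_cons !big_nil /= (mulfK a0) (mulfK q0).
  have n1 := qq0 k; have n2 : poch (q * q / a) k != 0 by apply: hss; rewrite !inE eqxx orbT.
  move: (poch (q * q / b) k)^-1 (poch (q * q / c) k)^-1 (poch (q * q / x1) k)^-1
    (poch (q * q / x2) k)^-1 (poch (q * q / x3) k)^-1 (poch (q * q / x4) k)^-1.
  by move=> y1 y2 y3 y4 y5 y6; field; rewrite a0 n1 n2.
have key : (1 - a * q ^ (2 * Negz k)) * (\prod_(v <- [:: b; c; x1; x2; x3; x4])
    (a * q / v ^+ 2) ^+ k.+1) * Z ^ (Negz k) = - a * Z * (1 - q ^+ 2 / a * q ^+ (2 * k)) * Z ^+ k.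
  have Z0 : Z != 0 by rewrite /Z !mulf_neq0 ?invr_neq0 ?mulf_neq0 ?expf_neq0.
  have e6 : \prod_(v <- [:: b; c; x1; x2; x3; x4]) (a * q / v ^+ 2) = q ^+ 2 * Z * Z.
    rewrite !big_cons big_nil /Z; field.
    by rewrite b0 c0 x10 x20 x30 x40.
  rewrite prodrXl e6 (exprMn k.+1 (q ^+ 2 * Z) Z) (exprMn k.+1 (q ^+ 2) Z) NegzE.
  have -> : q ^ (2 * - Posz k.+1) = (q ^+ 2 * q ^+ (2 * k))^-1.
    by rewrite mulrN -PoszM -exprnN -exprD mulnS.
  rewrite -exprnN -exprM.
  have -> : q ^+ (2 * k.+1) = q ^+ 2 * q ^+ (2 * k) by rewrite -exprD mulnS.
  have Zk : Z ^+ k != 0 by rewrite expf_neq0.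
  by rewrite !exprS; move: Z0 Zk; generalize Z => ZZ Z0 Zk; field; rewrite Z0 Zk q0 a0 h.
set T := \prod_(v <- _) (poch (q * v / a) k / _).
move: key; set P := \prod_(v <- _) (a * q / v ^+ 2) ^+ k.+1 => key.
transitivity ((1 - a * q ^ (2 * Negz k)) * P * Z ^ Negz k * (R * T / (1 - a))).
  by ring.
by rewrite key; ring.
Qed.

Let split x : pinf x = (1 - x) * pinf (x * q).
Proof. exact: qpoch_infS. Qed.

Let pinf0 x : (forall n, poch x n != 0) -> pinf x != 0.
Proof. exact: qpoch_inf_neq0. Qed.

(** Slater's coefficients of the bases a and q differ exactly by the factor that joins the two
    halves of the bilateral series; otherwise they would not combine into one 8psi8. *)
Let kappa_coef : slater_at q a b c = psi_coef * kappa.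
Proof.
have px v : v \in xs -> pinf (q * q / v) * pinf (a * q / (v * q))
    = pinf (a * q / v) * pinf (q / v) * ((1 - a / v) / (1 - q / v)).
  move=> vx; have v0 := xs0 vx; have [p1 _ _ _] := ox vx.
  have -> : a * q / (v * q) = a / v by field; rewrite v0 q0.
  rewrite (split (a / v)) (split (q / v)).
  have -> : a / v * q = a * q / v by ring.
  have -> : q / v * q = q * q / v by ring.
  have n1 : 1 - q / v != 0.
    have : forall n, poch (q / v) n != 0.
      by move=> n; apply: (off_lattice_qpochV 1 0 p1); field.
    by move/qpoch_neq0P => /(_ 0%N); rewrite expr0 mulr1.
  by move: n1; move: (q / v) (pinf _) (pinf _) => t u w n1; field; rewrite ?q0 ?n1.
have pb t : t != 0 -> off_lattice (t / a) -> off_lattice t ->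
    pinf (q * t / a) * pinf (t / q) = pinf t * pinf (t / a) * ((1 - t / q) / (1 - t / a)).
  move=> t0 ota ot; rewrite (split (t / a)) (split (t / q)).
  have -> : t / q * q = t by field.
  have -> : t / a * q = q * t / a by ring.
  have n1 : 1 - t / a != 0.
    by rewrite subr_eq0 eq_sym; have := ota 0 0; rewrite !mulr1.
  by move: n1; move: (t / a) (pinf _) (pinf _) => w u v n1; field; rewrite ?q0 ?n1.
rewrite /slater_at /psi_coef /kappa !big_cons !big_nil.
rewrite (px x1 (mem_head _ _)) (px x2) ?(px x3) ?(px x4) ?inE ?eqxx ?orbT //.
rewrite (pb b b0 oba ob) (pb c c0 oca oc).
have -> : q * a / a = q by rewrite mulfK.
have -> : pinf (a / q) = (1 - a / q) * ((1 - a) * pinf (a * q)).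
  by rewrite (split (a / q)) divfK // (split a).
have -> : pinf (q / a) = (1 - q / a) * pinf (q * q / a).
  by rewrite (split (q / a)); congr (_ * pinf _); ring.
rewrite /Z.
have npq : pinf (a * q) != 0.
  by apply: pinf0 => n; apply: (off_lattice_qpoch 1 0 oa); ring.
have nq := pinf0 qq0.
have nqa : pinf (q * q / a) != 0.
  by apply: pinf0 => n; apply: hss; rewrite !inE eqxx orbT.
have nt t : off_lattice t -> pinf t != 0.
  by move=> ot; apply: pinf0 => n; apply: (off_lattice_qpoch 0 0 ot).
have nb := nt _ ob; have nc := nt _ oc; have nba := nt _ oba; have nca := nt _ oca.
have dq t : off_lattice t -> t - q != 0.
  by move=> ot; rewrite subr_eq0; have := ot 0%N 1%N; rewrite expr0 mulr1 expr1.
have da t : off_lattice (t / a) -> a - t != 0.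
  move=> ot; rewrite subr_eq0; have := ot 0%N 0%N; rewrite expr0 mulr1.
  by apply: contra => /eqP <-; rewrite divff.
have dx v : v \in xs -> v - q != 0 by move=> /ox[/dq].
have := dq _ ob; have := dq _ oc; have := da _ oba; have := da _ oca; have := dq _ oa.
have := dx x1 (mem_head _ _); have := dx x2; have := dx x3; have := dx x4.
rewrite !inE !eqxx !orbT => /(_ isT) d4 /(_ isT) d3 /(_ isT) d2 d1 e1 e2 e3 e4 e5.
move: npq nq nqa nb nc nba nca.
move: (pinf (a * q)) (pinf q) (pinf (q * q / a)) (pinf b) (pinf c) (pinf (b / a)) (pinf (c / a)).
move: (pinf (a * q / x1)) (pinf (a * q / x2)) (pinf (a * q / x3)) (pinf (a * q / x4)).
move: (pinf (q / x1)) (pinf (q / x2)) (pinf (q / x3)) (pinf (q / x4)).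
move=> y1 y2 y3 y4 y5 y6 y7 y8 z1 z2 z3 z4 z5 z6 z7 n1 n2 n3 n4 n5 n6 n7.
have sw (t u : C) : t - u != 0 -> u - t != 0 by rewrite -oppr_eq0 opprB.
field.
rewrite n1 n2 n3 n4 n5 n6 n7 d1 d2 d3 d4 e1 e2 e3 e4 e5 x10 x20 x30 x40 a0 b0 c0 q0 a1.
by rewrite (sw _ _ (dq _ oa)) (sw _ _ (dq _ ob)) (sw _ _ (dq _ oc)).
Qed.

Let coef_psi : slater_at a q b c = psi_coef / (1 - a).
Proof.
rewrite /slater_at /psi_coef !big_cons !big_nil /= !mulr1 !mulKa (split a).
have e v : v != 0 -> a * q / (v * a) = q / v by move=> v0; field; rewrite a0 v0.
rewrite !e // !invfM. ring.
Qed.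

Let coef_W u w : u != 0 -> w != 0 -> 1 - u ^+ 2 / a != 0 ->
  slater_at u a q w = W_coef u w / (1 - u ^+ 2 / a).
Proof.
move=> u0 w0 u1; rewrite /slater_at /W_coef !big_cons !big_nil /= !mulr1 mulfK //.
have -> : pinf (u * u / a) = (1 - u ^+ 2 / a) * pinf (u ^+ 2 * q / a).
  by rewrite (split (u * u / a)); congr (_ * pinf _); ring.
by rewrite !invfM; ring.
Qed.

(** As a and q are both among the four bases, their factors cancel. In base a^2/a = a the quotient
    (a;q)_k/(q;q)_k disappears, which leaves the half n >= 0 of the bilateral series; the base q^2/a
    gives the half n < 0. In the bases b^2/a and c^2/a the same cancellation leaves five free
    parameters, hence an 8W7. *)
Lemma psi88_two_W :
  psi_coef * psi88 q a [:: b; c; x1; x2; x3; x4] Z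
  + W_coef b c * W87 q (b ^+ 2 / a)
      [:: b * c / a; b * x1 / a; b * x2 / a; b * x3 / a; b * x4 / a] Z
  + W_coef c b * W87 q (c ^+ 2 / a)
      [:: c * b / a; c * x1 / a; c * x2 / a; c * x3 / a; c * x4 / a] Z = 0.
Proof.
have ca := cvg_term (mem_head _ _).
have cq : cvgn (series (term q)) by apply: cvg_term; rewrite !inE eqxx orbT.
have cb : cvgn (series (term b)) by apply: cvg_term; rewrite !inE eqxx !orbT.
have cc : cvgn (series (term c)) by apply: cvg_term; rewrite !inE eqxx !orbT.
have b1 : 1 - b ^+ 2 / a != 0.
  by rewrite subr_eq0 eq_sym; have := obb 0 0; rewrite !mulr1.
have c1 : 1 - c ^+ 2 / a != 0.
  by rewrite subr_eq0 eq_sym; have := occ 0 0; rewrite !mulr1.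
rewrite /psi88 /bilateral_sum /W87.
have -> : (fun k => psi_term q a [:: b; c; x1; x2; x3; x4] Z (Posz k))
    = (fun k => (1 - a)^-1 * term a k).
  by apply/funext => k; rewrite term_psi mulKf.
have -> : (fun k => psi_term q a [:: b; c; x1; x2; x3; x4] Z (Negz k))
    = (fun k => kappa * term q k).
  by apply/funext => k; rewrite term_psi_neg.
have -> : W_term q (b ^+ 2 / a)
      [:: b * c / a; b * x1 / a; b * x2 / a; b * x3 / a; b * x4 / a] Z
    = (fun k => (1 - b ^+ 2 / a)^-1 * term b k).
  by apply/funext => k; rewrite (@term_W b c) ?mulKf //; left.
have -> : W_term q (c ^+ 2 / a)
      [:: c * b / a; c * x1 / a; c * x2 / a; c * x3 / a; c * x4 / a] Z
    = (fun k => (1 - c ^+ 2 / a)^-1 * term c k).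
  by apply/funext => k; rewrite (@term_W c b) ?mulKf //; right.
rewrite !lim_series_scale //.
have := four_terms; rewrite coef_psi kappa_coef !coef_W // => <-.
ring.
Qed.

End Expansion.
End BilateralExpansion.

Arguments off_lattice_qpoch {C q} i j {x y n}.
Arguments off_lattice_qpochV {C q} i j {x y n}.

(** * The three-term relation for theta functions *)

Section ThetaAddition.
Variables (C : numFieldType) (gc : geometrically_complete C) (q : C).
Hypothesis q0 : q != 0.
Hypothesis q1 : `|q| < 1.
Local Notation poch := (qpoch q).
Local Notation pinf := (qpoch_inf q).
Local Notation off := (off_lattice q).

Definition theta_prod (x : C) := pinf x * pinf (q / x).
Local Notation th := theta_prod.

Lemma theta_prodV x : x != 0 -> th x^-1 = - x^-1 * th x.
Proof.
move=> x0; have split y : pinf y = (1 - y) * pinf (y * q) by exact: qpoch_infS.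
have [->|x1] := eqVneq x 1.
  by rewrite /th invr1 (split 1) subrr !mul0r mulr0.
rewrite /th (split x^-1) (split x).
have -> : q / x^-1 = x * q by rewrite invrK mulrC.
have -> : x^-1 * q = q / x by rewrite mulrC.
by move: (pinf _) (pinf _) => u v; field.
Qed.

Lemma theta_prod_q x : x != 0 -> th (x / q) = - (x / q) * th x.
Proof.
move=> x0; have split y : pinf y = (1 - y) * pinf (y * q) by exact: qpoch_infS.
rewrite /th (split (x / q)) divfK // (split (q / x)).
have -> : q / (x / q) = q / x * q by field; rewrite x0 q0.
by move: (pinf _) (pinf _) => u v; field; rewrite x0 q0.
Qed.

Lemma theta_prod1 : th 1 = 0.
Proof. by rewrite /th (qpoch_infS gc q1) subrr !mul0r. Qed.

Lemma off_lattice_pinf_neq0 x : off x -> pinf x != 0.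
Proof.
move=> ox; apply: (qpoch_inf_neq0 gc q1) => n.
by apply: (off_lattice_qpoch 0 0 ox).
Qed.

Lemma off_lattice_theta_neq0 x : x != 0 -> off x -> th x != 0.
Proof.
move=> x0 ox; apply: mulf_neq0; first exact: off_lattice_pinf_neq0.
apply: (qpoch_inf_neq0 gc q1) => n.
by apply: (off_lattice_qpochV 1 0 ox); field.
Qed.

Lemma off_lattice_eq i j x y : off x -> y * q ^+ j = x * q ^+ i -> off y.
Proof.
move=> ox e k l; apply/negP => /eqP h.
have /negP := ox (i + k)%N (l + j)%N; apply; apply/eqP.
rewrite !exprD -h; transitivity (x * q ^+ i * q ^+ k); first by ring.
by rewrite -e; ring.
Qed.

Lemma off_lattice_eqV i j x y : off x -> y * x * q ^+ j = q ^+ i -> off y.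
Proof.
move=> ox e k l; apply/negP => /eqP h.
have /negP := ox (l + j)%N (i + k)%N; apply; apply/eqP.
by rewrite !exprD -h -e; ring.
Qed.

Arguments off_lattice_eq i j {x y}.
Arguments off_lattice_eqV i j {x y}.

(** The pair x, Aq/x contributes mutually inverse quotients, so the 8psi8 of the next relation does
    not depend on x. *)
Lemma psi_term_cancel A l x n : A != 0 -> x != 0 -> off x -> off (x / A) ->
  psi_term q A (l ++ [:: x; A * q / x]) q n = psi_term q A l q n.
Proof.
move=> A0 x0 ox oxA; rewrite /psi_term big_cat /= !big_cons big_nil.
have -> : A * q / (A * q / x) = x by field; rewrite x0 A0 q0.
have h m : q ^+ m != 0 by rewrite expf_neq0.
have nz y : off y -> qpochz q y n != 0.
  move=> oy; case: n => [m|m] /=; first by apply: (off_lattice_qpoch 0 0 oy).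
  by rewrite invr_neq0 //; apply: (off_lattice_qpoch 0 m.+1 oy); field; rewrite h.
have n1 := nz _ ox; have n2 : qpochz q (A * q / x) n != 0.
  by apply: nz; apply: (off_lattice_eqV 1 0 oxA); field; rewrite x0 A0.
congr (_ * _ * _); move: (\prod_(_ <- l) _) => P.
by move: n1 n2; move: (qpochz _ _ _) (qpochz _ _ _) => u v n1 n2; field; rewrite n1 n2.
Qed.

Lemma W87_one A l Z : 1 - A != 0 -> 1 \in l -> W87 q A l Z = 1.
Proof.
move=> A1 l1; rewrite /W87 (@lim_series_finite _ _ 1) => [|k k0].
  rewrite big_ord1 /W_term !qpochn0 muln0 expr0 mulr1 divff // invr1 !mulr1 mul1r.
  by rewrite big1 // => v _; rewrite !qpochn0 divr1.
have p0 : poch 1 k = 0.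
  by case: k k0 => // k _; rewrite qpochSl subrr mul0r.
by rewrite /W_term (big_rem 1) //= p0 !mul0r mulr0 mul0r.
Qed.

Section Addition.
Variables (A b c : C).
Hypotheses (A0 : A != 0) (b0 : b != 0) (c0 : c != 0).
Hypotheses (oA : off A) (ob : off b) (oc : off c)
  (obA : off (b / A)) (ocA : off (c / A))
  (obb : off (b ^+ 2 / A)) (occ : off (c ^+ 2 / A))
  (obcA : off (b * c / A)) (obc : off (b / c)).

(** [psi88_two_W] with the parameters A/b, A/c, x, Aq/x and argument q: both 8W7's have a parameter
    equal to 1 and reduce to their first term, and x cancels from the 8psi8, whose value is absorbed
    in K0. The conditions on x are weak enough to allow x = b and x = c. *)
Let relation : exists K0 Kb Kc, Kc != 0 /\ forall x, x != 0 -> off x -> off (x / A) ->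
  (forall n, poch (b * q / x) n != 0) -> (forall n, poch (c * q / x) n != 0) ->
  (forall n, poch (b * x / A) n != 0) -> (forall n, poch (c * x / A) n != 0) ->
  K0 * (th x * th (x / A)) + Kb * (th (x / b) * th (b * x / A))
  + Kc * (th (x / c) * th (c * x / A)) = 0.
Proof.
have oAb : off (A / b) by apply: (off_lattice_eqV 0 0 obA); field; rewrite A0 b0.
have oAc : off (A / c) by apply: (off_lattice_eqV 0 0 ocA); field; rewrite A0 c0.
pose P (K : C -> C) := \prod_(v <- [:: A / b; A / c]) K v.
exists (P (fun v => pinf (A * q / v) * pinf (q / v))
   / (A * pinf (A * q) * pinf q * (pinf q * pinf (q / A)) * (pinf b * pinf (b / A))
     * (pinf c * pinf (c / A))) * psi88 q A [:: b; c; A / b; A / c] q).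
pose D b c := b * pinf (b ^+ 2 * q / A) * pinf q * (pinf b * pinf (A / b))
     * (pinf (b * q / A) * pinf (q / b)) * (pinf (b * c / A) * pinf (c / b)).
exists (P (fun v => pinf (b * q / v) * pinf (A * q / (v * b))) / D b c).
exists (P (fun v => pinf (c * q / v) * pinf (A * q / (v * c))) / D c b).
have qi0 : pinf q != 0.
  by apply: (qpoch_inf_neq0 gc q1) => n; exact: qpoch_small_neq0.
have offp y i j z : off z -> y * q ^+ j = z * q ^+ i -> pinf y != 0.
  by move=> oz e; apply: (qpoch_inf_neq0 gc q1) => n; apply: (off_lattice_qpoch i j oz e).
have offpV y i j z : off z -> y * z * q ^+ j = q ^+ i -> pinf y != 0.
  by move=> oz e; apply: (qpoch_inf_neq0 gc q1) => n; apply: (off_lattice_qpochV i j oz e).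
split.
  rewrite /P /D !big_cons big_nil mulr1.
  have h1 : pinf (c * q / (A / b)) != 0 by apply: (offp _ 1 0 _ obcA); field; rewrite A0 b0.
  have h2 : pinf (A * q / (A / b * c)) != 0 by apply: (offp _ 1 0 _ obc); field; rewrite A0 b0 c0.
  have h3 : pinf (c * q / (A / c)) != 0 by apply: (offp _ 1 0 _ occ); field; rewrite A0 c0.
  have h4 : pinf (A * q / (A / c * c)) != 0.
    by have -> : A * q / (A / c * c) = q by field; rewrite A0 c0.
  have h5 : pinf (c ^+ 2 * q / A) != 0 by apply: (offp _ 1 0 _ occ); ring.
  have h6 : pinf c != 0 by apply: (offp _ 0 0 _ oc).
  have h7 : pinf (A / c) != 0 by apply: (offp _ 0 0 _ oAc).
  have h8 : pinf (c * q / A) != 0 by apply: (offp _ 1 0 _ ocA); ring.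
  have h9 : pinf (q / c) != 0 by apply: (offpV _ 1 0 _ oc); field.
  have h10 : pinf (c * b / A) != 0 by apply: (offp _ 0 0 _ obcA); ring.
  have h11 : pinf (b / c) != 0 by apply: (offp _ 0 0 _ obc).
  by rewrite !mulf_neq0 ?invr_neq0 ?mulf_neq0.
move=> x x0 ox oxA hb hc hbx hcx.
have Zq : A ^+ 3 * q ^+ 2 / (b * c * (A / b * (A / c) * x * (A * q / x))) = q.
  by field; rewrite x0 b0 c0 A0 q0.
have Ab0 : A / b != 0 by rewrite mulf_neq0 ?invr_neq0.
have Ac0 : A / c != 0 by rewrite mulf_neq0 ?invr_neq0.
have Ax0 : A * q / x != 0 by rewrite !mulf_neq0 ?invr_neq0.
have ox4 v : v \in [:: A / b; A / c; x; A * q / x] ->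
  [/\ off v, off (v / A), forall n, poch (b * q / v) n != 0 & forall n, poch (c * q / v) n != 0].
  rewrite !inE => /or4P[] /eqP ->; split => //.
  - by apply: (off_lattice_eqV 0 0 ob); field; rewrite A0 b0.
  - by move=> n; apply: (off_lattice_qpoch 1 0 obb); field; rewrite A0 b0.
  - by move=> n; apply: (off_lattice_qpoch 1 0 obcA); field; rewrite A0 b0.
  - by apply: (off_lattice_eqV 0 0 oc); field; rewrite A0 c0.
  - by move=> n; apply: (off_lattice_qpoch 1 0 obcA); field; rewrite A0 c0.
  - by move=> n; apply: (off_lattice_qpoch 1 0 occ); field; rewrite A0 c0.
  - by apply: (off_lattice_eqV 1 0 oxA); field; rewrite A0 x0.
  - by apply: (off_lattice_eqV 1 0 ox); field; rewrite A0 x0.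
  - by move=> n; have -> : b * q / (A * q / x) = b * x / A by field; rewrite x0 A0 q0.
  - by move=> n; have -> : c * q / (A * q / x) = c * x / A by field; rewrite x0 A0 q0.
have A1 u : off u -> 1 - u != 0.
  by move=> ou; rewrite subr_eq0 eq_sym; have := ou 0%N 0%N; rewrite expr0 mulr1.
have := @psi88_two_W C gc q q0 q1 A b c (A / b) (A / c) x (A * q / x)
  A0 b0 c0 Ab0 Ac0 x0 Ax0 oA ob oc obA ocA obb occ obcA obc ox4.
rewrite Zq => /(_ q1).
have in1 u l : u != 0 -> A / u \in l -> 1 \in [seq u * v / A | v <- l].
  move=> u0 ul; have -> : 1 = u * (A / u) / A by field; rewrite A0 u0.
  exact: (map_f (fun v => u * v / A)).
rewrite (W87_one _ (A1 _ obb)); last first.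
  by apply: (in1 b [:: c; A / b; A / c; x; A * q / x]); rewrite // !inE eqxx orbT.
rewrite (W87_one _ (A1 _ occ)); last first.
  by apply: (in1 c [:: b; A / b; A / c; x; A * q / x]); rewrite // !inE eqxx !orbT.
have -> : psi88 q A [:: b; c; A / b; A / c; x; A * q / x] q
    = psi88 q A [:: b; c; A / b; A / c] q.
  rewrite /psi88; congr bilateral_sum; apply/funext => n.
  exact: (@psi_term_cancel A [:: b; c; A / b; A / c] x n).
move=> <-; rewrite /psi_coef /W_coef /P /D !big_cons !big_nil /th.
have -> : A * q / (A * q / x) = x by field; rewrite A0 x0 q0.
have -> : q / (A * q / x) = x / A by field; rewrite A0 x0 q0.
have -> : b * q / (A * q / x) = b * x / A by field; rewrite A0 x0 q0.
have -> : c * q / (A * q / x) = c * x / A by field; rewrite A0 x0 q0.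
have -> : A * q / (A * q / x * b) = x / b by field; rewrite A0 x0 q0 b0.
have -> : A * q / (A * q / x * c) = x / c by field; rewrite A0 x0 q0 c0.
have -> : q / (x / A) = A * q / x by field; rewrite A0 x0.
have -> : q / (x / b) = b * q / x by field; rewrite b0 x0.
have -> : q / (x / c) = c * q / x by field; rewrite c0 x0.
have -> : q / (b * x / A) = A * q / (x * b) by field; rewrite A0 b0 x0.
have -> : q / (c * x / A) = A * q / (x * c) by field; rewrite A0 c0 x0.
set u1 := (_ * pinf (c / b)); set u2 := (_ * pinf (b / c)).
set u3 := (A * pinf (A * q) * _ * _ * _ * _).
by move: (psi88 _ _ _ _) => S; move: u1^-1 u2^-1 u3^-1 => v1 v2 v3; ring.
Qed.

(** Weierstrass' relation. The ratios of the three constants in [relation] are found at x = b and x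
    = c, where theta(1) = 0 removes one term; Kc != 0 excludes the trivial relation. *)
Theorem theta_addition x : x != 0 -> off x -> off (x / A) -> off (x / b) -> off (x / c) ->
  off (b * x / A) -> off (c * x / A) ->
  - (c / b) * (th x * th (x / A) * th (b / c) * th (b * c / A))
  = th (x / b) * th (b * x / A) * th c * th (c / A)
    - (c / b) * (th (x / c) * th (c * x / A) * th b * th (b / A)).
Proof.
move=> x0 ox oxA oxb oxc obx ocx.
have [K0 [Kb [Kc [Kc0 rel]]]] := relation.
have pq n : poch q n != 0 by exact: qpoch_small_neq0.
have po z n : off z -> poch z n != 0 by move=> oz; apply: (off_lattice_qpoch 0 0 oz).
have Rx : K0 * (th x * th (x / A)) + Kb * (th (x / b) * th (b * x / A))
  + Kc * (th (x / c) * th (c * x / A)) = 0.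
  apply: rel => // n.
  - by apply: (off_lattice_qpochV 1 0 oxb); field; rewrite b0 x0.
  - by apply: (off_lattice_qpochV 1 0 oxc); field; rewrite c0 x0.
  - exact: po.
  - exact: po.
have Rb : K0 * (th b * th (b / A)) + Kc * (th (b / c) * th (b * c / A)) = 0.
  have := rel b b0 ob obA; rewrite divff // theta_prod1 mul0r mulr0 addr0.
  rewrite [c * b]mulrC; apply => n.
  - by rewrite mulrAC divff // mul1r.
  - by apply: (off_lattice_qpochV 1 0 obc); field; rewrite b0 c0.
  - by apply: (off_lattice_qpoch 0 0 obb); ring.
  - exact: po.
have Rc : K0 * (th c * th (c / A)) + Kb * (th (c / b) * th (b * c / A)) = 0.
  have := rel c c0 oc ocA; rewrite divff // theta_prod1 mul0r mulr0 addr0.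
  apply => n.
  - by apply: (off_lattice_qpoch 1 0 obc); field; rewrite ?b0 ?c0.
  - by rewrite mulrAC divff // mul1r.
  - exact: po.
  - by apply: (off_lattice_qpoch 0 0 occ); ring.
have cb : th (c / b) = - (c / b) * th (b / c).
  by rewrite -(invf_div b c) theta_prodV ?mulf_neq0 ?invr_neq0 // invf_div.
rewrite cb in Rc.
have t1 : th (b / c) != 0 by rewrite off_lattice_theta_neq0 // mulf_neq0 ?invr_neq0.
have t2 : th (b * c / A) != 0 by rewrite off_lattice_theta_neq0 // !mulf_neq0 ?invr_neq0.
move: Rx Rb Rc; move: (th (b / c)) (th (b * c / A)) t1 t2 => T1 T2 t1 t2 Rx Rb Rc.
have K00 : K0 != 0.
  apply: contra_neq Kc0 => K00; move: Rb; rewrite K00 mul0r add0r => /eqP.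
  by rewrite !mulf_eq0 (negPf t1) (negPf t2) !orbF => /eqP.
have cb0 : c / b != 0 by rewrite mulf_neq0 ?invr_neq0.
have KcE : Kc = - K0 * (th b * th (b / A)) / (T1 * T2).
  apply: (mulIf (mulf_neq0 t1 t2)); rewrite divfK ?mulf_neq0 //.
  by apply/eqP; rewrite -subr_eq0 -Rb; apply/eqP; ring.
have KbE : Kb = K0 * (th c * th (c / A)) / (c / b * T1 * T2).
  have d0 := mulf_neq0 (mulf_neq0 cb0 t1) t2; apply: (mulIf d0); rewrite divfK //.
  by apply/eqP; rewrite -subr_eq0 -oppr_eq0 -Rc; apply/eqP; ring.
apply: (mulfI K00); apply/eqP; rewrite -subr_eq0; apply/eqP.
rewrite -[RHS](mulr0 (- (c / b) * T1 * T2)) -Rx KcE KbE.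
by field; rewrite b0 c0 t1 t2.
Qed.

End Addition.
End ThetaAddition.

Arguments off_lattice_eq {C q} i j {x y}.
Arguments off_lattice_eqV {C q} i j {x y}.

(** * The identity for generic parameters *)

Section W87Transformation.
Variables (C : numFieldType) (gc : geometrically_complete C) (q : C).
Hypothesis q1 : `|q| < 1.
Local Notation poch := (qpoch q).
Local Notation pinf := (qpoch_inf q).

Lemma W87_transformation a l b c d m e f :
  a = l * m -> l * q = b * c * d * m ->
  l != 0 -> b != 0 -> c != 0 -> d != 0 -> m != 0 -> e != 0 -> f != 0 ->
  `|l * q / (e * f)| < 1 -> `|a * q / (e * f)| < 1 ->
  (forall n, poch a n != 0) -> 1 - l != 0 -> (forall n, poch (l * q) n != 0) ->
  (forall n, poch (a * (l * q / (e * f))) n != 0) ->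
  (forall n, poch (l * q / b) n != 0) -> (forall n, poch (l * q / c) n != 0) ->
  (forall n, poch (l * q / d) n != 0) ->
  (forall n, poch (a * q / e) n != 0) -> (forall n, poch (a * q / f) n != 0) ->
  (forall n, poch (l * q / e) n != 0) -> (forall n, poch (l * q / f) n != 0) ->
  W87 q a [:: b * m; c * m; d * m; e; f] (l * q / (e * f))
  = pinf (a * q) * pinf (a * q / (e * f)) * pinf (l * q / e) * pinf (l * q / f)
    / (pinf (l * q) * pinf (a * q / e) * pinf (a * q / f) * pinf (l * q / (e * f)))
    * W87 q l [:: b; c; d; e; f] (a * q / (e * f)).
Proof.
move=> aE lE l0 b0 c0 d0 m0 e0 f0 z1 w1 pa l1 plq paz pb pc pd pae paf ple plf.
have eb : l * q / b = c * d * m by rewrite lE; field.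
have ec : l * q / c = b * d * m by rewrite lE; field.
have ed : l * q / d = b * c * m by rewrite lE; field.
rewrite eb in pb; rewrite ec in pc; rewrite ed in pd.
have := @well_poised_transformation C gc q q1 a l b c d m e f aE lE e0 f0 z1 w1
  pa l1 plq paz pb pc pd pae paf ple plf.
have -> : (fun k => (1 - a * q ^+ (2 * k)) / (1 - a)
  * (poch a k * poch (b * m) k * poch (c * m) k * poch (d * m) k
     / (poch q k * poch (c * d * m) k * poch (b * d * m) k * poch (b * c * m) k))
  * (poch e k * poch f k / (poch (a * q / e) k * poch (a * q / f) k)) * (l * q / (e * f)) ^+ k)
  = W_term q a [:: b * m; c * m; d * m; e; f] (l * q / (e * f)).
  apply/funext => k; rewrite /W_term !big_cons big_nil.
  have -> : a * q / (b * m) = c * d * m by rewrite -eb aE; field; rewrite b0 m0.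
  have -> : a * q / (c * m) = b * d * m by rewrite -ec aE; field; rewrite c0 m0.
  have -> : a * q / (d * m) = b * c * m by rewrite -ed aE; field; rewrite d0 m0.
  by rewrite !invfM; ring.
have -> : (fun k => (1 - l * q ^+ (2 * k)) / (1 - l)
  * (poch l k * poch b k * poch c k * poch d k
     / (poch q k * poch (c * d * m) k * poch (b * d * m) k * poch (b * c * m) k))
  * (poch e k * poch f k / (poch (l * q / e) k * poch (l * q / f) k)) * (a * q / (e * f)) ^+ k)
  = W_term q l [:: b; c; d; e; f] (a * q / (e * f)).
  apply/funext => k; rewrite /W_term !big_cons big_nil eb ec ed.
  by rewrite !invfM; ring.
by [].
Qed.

End W87Transformation.

(* The denominators met below are infinite products: apart from those whose argument has
   norm less than 1, they vanish only if one of these monomials is a power of [q]. *)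
Definition generic_monomials (C : numFieldType) (a b c d e f g : C) : seq C :=
  [:: b * c * d * e / a;
  b;
  c;
  a / (c * d * e);
  a / (b * d * e);
  a * b / (c * d * e);
  a * c / (b * d * e);
  a / (d * e);
  b / c;
  d;
  a / (b * c * e);
  b / d;
  c / d;
  e;
  a / (b * c * d);
  b / e;
  c / e;
  b * c * d * e * f / a ^+ 2;
  f / a;
  a ^+ 2 / (c * d * e * f);
  a ^+ 2 / (b * d * e * f);
  b * c * d * e * g / a ^+ 2;
  g / a;
  a ^+ 2 / (c * d * e * g);
  a ^+ 2 / (b * d * e * g);
  b ^+ 2 * c ^+ 2 * d ^+ 2 * e ^+ 2 / a ^+ 3;
  b ^+ 2 * c * d * e / a ^+ 2;
  b * c ^+ 2 * d * e / a ^+ 2;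
  b ^+ 2 / a;
  c ^+ 2 / a;
  b * c / a;
  b * c * d ^+ 2 * e / a ^+ 2;
  b * c * d * e ^+ 2 / a ^+ 2;
  a * f / (b * c * d * e);
  b / f;
  c / f;
  a * g / (b * c * d * e);
  b / g;
  c / g;
  a ^+ 2 * b / (c * d * e * f * g);
  a ^+ 2 * c / (b * d * e * f * g);
  a / e;
  b * e / a;
  c * e / a;
  b ^+ 2 * e / a;
  c ^+ 2 * e / a;
  b * c * d * e / a ^+ 2;
  a / (c * d);
  a / (b * d);
  c * f / a;
  c * g / a;
  b * f / a;
  b * g / a].

Definition psi88_coef1 (C : numFieldType) (q a b c d e f g z : C) : C :=
  (1 - z^-1) * ((theta q (b * z / a) * theta q (z / b)) / (theta q (z / a) * theta q z)) *
    (qpoch_inf q (b ^+ 2 * q / a) / Omega q [:: a * q / b; b * q] [:: f; g]) * ((Omega q [:: q]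
    [:: b; c; d; e] * Omega q [:: a * q] [:: f; g; c * d; c * e; d * e; f * g; f * z; g * z]) /
    (Omega q [:: b * q] [:: b; c; d; e] * Omega q [:: z^-1] [:: b^-1; c^-1; d^-1; e^-1; f * g /
    (a ^+ 2 * q)])).

Definition psi88_coef2 (C : numFieldType) (q a b c d e f g z : C) : C :=
  (qpoch_inf q (z * q / b) / qpoch_inf q (z ^+ 2 * q / a)) * (theta q b^-1 / theta q (z / a)) *
    ((Omega q [:: b / a] [:: (b * q)^-1; c^-1; d^-1; e^-1] * Omega q [:: z * q] [:: f; g]) /
    (Omega q [:: z^-1] [:: z / (a * q); c^-1; d^-1; e^-1] * Omega q [:: a * q / b] [:: f; g]))
    * (Omega q [:: a * q / z] [:: b; c; d; e; f; g] / Omega q [:: b * q] [:: b; c; d; e; f; g]).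

(** * The two expansions and the elimination of the auxiliary 8W7 *)

Section Generic.
Variables (C : numFieldType) (gc : geometrically_complete C) (q : C).
Hypothesis q0 : q != 0.
Hypothesis q1 : `|q| < 1.
Local Notation poch := (qpoch q).
Local Notation pinf := (qpoch_inf q).
Local Notation off := (off_lattice q).
Local Notation th := (theta_prod q).

Variables (a b c d e f g z : C).
Hypotheses (a0 : a != 0) (b0 : b != 0) (c0 : c != 0) (d0 : d != 0) (e0 : e != 0)
  (f0 : f != 0) (g0 : g != 0).
Hypothesis zE : z = b * c * d * e / (a * q).
Hypothesis Z2 : `|a ^+ 2 * q / (f * g * z)| < 1.
Hypothesis Z1 : `|a * q / (f * g)| < 1.
Hypothesis gen : forall k, (k < 53)%N -> off (nth 1 (generic_monomials a b c d e f g) k).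

Let z0 : z != 0.
Proof. by rewrite zE !mulf_neq0 ?invr_neq0 ?mulf_neq0. Qed.

Ltac nzs := by rewrite ?a0 ?b0 ?c0 ?d0 ?e0 ?f0 ?g0 ?q0 ?z0.
Ltac mono := rewrite /= ?zE; field; nzs.
(* [off_mono i j k] shows that [y] avoids the powers of [q] when [y * q ^+ j] is the
   [k]-th generic monomial times [q ^+ i]; the suffix [V] is for its inverse. *)
Ltac off_mono i j k := apply: (off_lattice_eq i j (@gen k isT)); mono.
Ltac off_monoV i j k := apply: (off_lattice_eqV i j (@gen k isT)); mono.
Ltac poch_mono i j k := apply: (off_lattice_qpoch i j (@gen k isT)); mono.
Ltac poch_monoV i j k := apply: (off_lattice_qpochV i j (@gen k isT)); mono.

(** Base z, with d, e, fz/a, gz/a as the four parameters besides b and c. The companion relation has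
    base z^2/a and all six parameters multiplied by z/a, so that (bz/a)^2/(z^2/a) = b^2/a and the
    wanted 8W7 appears. *)
Lemma psi88_W87_relation1 : psi_coef q z b c d e (f * z / a) (g * z / a)
    * psi88 q z [:: b; c; d; e; f * z / a; g * z / a] (a * q / (f * g))
  + W_coef q z d e (f * z / a) (g * z / a) b c * W87 q (b ^+ 2 / z)
      [:: b * c / z; b * d / z; b * e / z; b * f / a; b * g / a] (a * q / (f * g))
  + W_coef q z d e (f * z / a) (g * z / a) c b * W87 q (c ^+ 2 / z)
      [:: c * b / z; c * d / z; c * e / z; c * f / a; c * g / a] (a * q / (f * g)) = 0.
Proof.
have h5 : (f * z / a) != 0 by rewrite ?mulf_neq0 ?invr_neq0 ?expf_neq0.
have h6 : (g * z / a) != 0 by rewrite ?mulf_neq0 ?invr_neq0 ?expf_neq0.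
have h7 : off (z) by off_mono 0%N 1%N 0%N.
have h8 : off (b) by off_mono 0%N 0%N 1%N.
have h9 : off (c) by off_mono 0%N 0%N 2%N.
have h10 : off ((b)/(z)) by off_mono 1%N 0%N 3%N.
have h11 : off ((c)/(z)) by off_mono 1%N 0%N 4%N.
have h12 : off ((b)^+2/(z)) by off_mono 1%N 0%N 5%N.
have h13 : off ((c)^+2/(z)) by off_mono 1%N 0%N 6%N.
have h14 : off ((b)*(c)/(z)) by off_mono 1%N 0%N 7%N.
have h15 : off ((b)/(c)) by off_mono 0%N 0%N 8%N.
have ox v : v \in [:: d; e; f * z / a; g * z / a] ->
  [/\ off v, off (v / (z)), forall n, poch ((b) * q / v) n != 0 & forall n, poch ((c) * q / v)
    n != 0].
  rewrite !inE => /or4P[] /eqP ->; split.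
  - off_mono 0%N 0%N 9%N.
  - off_mono 1%N 0%N 10%N.
  - move=> n; poch_mono 1%N 0%N 11%N.
  - move=> n; poch_mono 1%N 0%N 12%N.
  - off_mono 0%N 0%N 13%N.
  - off_mono 1%N 0%N 14%N.
  - move=> n; poch_mono 1%N 0%N 15%N.
  - move=> n; poch_mono 1%N 0%N 16%N.
  - off_mono 0%N 1%N 17%N.
  - off_mono 0%N 0%N 18%N.
  - move=> n; poch_mono 2%N 0%N 19%N.
  - move=> n; poch_mono 2%N 0%N 20%N.
  - off_mono 0%N 1%N 21%N.
  - off_mono 0%N 0%N 22%N.
  - move=> n; poch_mono 2%N 0%N 23%N.
  - move=> n; poch_mono 2%N 0%N 24%N.
have R := @psi88_two_W C gc q q0 q1 (z) (b) (c) (d) (e) (f * z / a) (g * z / a) z0 b0 c0 d0 e0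
  h5 h6 h7 h8 h9 h10 h11 h12 h13 h14 h15 ox.
have zz : z ^+ 3 * q ^+ 2 / (b * c * (d * e * (f * z / a) * (g * z / a))) = a * q / (f * g).
  by rewrite zE; field; nzs.
rewrite zz in R.
have e1 u v : u * (v * z / a) / z = u * v / a by field; nzs.
by have := R Z1; rewrite !e1.
Qed.

Lemma psi88_W87_relation2 : psi_coef q (z ^+ 2 / a) (b * z / a) (c * z / a) (d * z / a) (e * z
  / a) (f * z / a) (g * z / a)
    * psi88 q (z ^+ 2 / a) [:: b * z / a; c * z / a; d * z / a; e * z / a; f * z / a; g * z / a]
        (a ^+ 2 * q / (f * g * z))
  + W_coef q (z ^+ 2 / a) (d * z / a) (e * z / a) (f * z / a) (g * z / a) (b * z / a) (c * z / a)
    * W87 q (b ^+ 2 / a) [:: b * c / a; b * d / a; b * e / a; b * f / a; b * g / a]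
        (a ^+ 2 * q / (f * g * z))
  + W_coef q (z ^+ 2 / a) (d * z / a) (e * z / a) (f * z / a) (g * z / a) (c * z / a) (b * z / a)
    * W87 q (c ^+ 2 / a) [:: c * b / a; c * d / a; c * e / a; c * f / a; c * g / a]
        (a ^+ 2 * q / (f * g * z)) = 0.
Proof.
have h0 : (z ^+ 2 / a) != 0 by rewrite ?mulf_neq0 ?invr_neq0 ?expf_neq0.
have h1 : (b * z / a) != 0 by rewrite ?mulf_neq0 ?invr_neq0 ?expf_neq0.
have h2 : (c * z / a) != 0 by rewrite ?mulf_neq0 ?invr_neq0 ?expf_neq0.
have h3 : (d * z / a) != 0 by rewrite ?mulf_neq0 ?invr_neq0 ?expf_neq0.
have h4 : (e * z / a) != 0 by rewrite ?mulf_neq0 ?invr_neq0 ?expf_neq0.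
have h5 : (f * z / a) != 0 by rewrite ?mulf_neq0 ?invr_neq0 ?expf_neq0.
have h6 : (g * z / a) != 0 by rewrite ?mulf_neq0 ?invr_neq0 ?expf_neq0.
have h7 : off (z ^+ 2 / a) by off_mono 0%N 2%N 25%N.
have h8 : off (b * z / a) by off_mono 0%N 1%N 26%N.
have h9 : off (c * z / a) by off_mono 0%N 1%N 27%N.
have h10 : off ((b * z / a)/(z ^+ 2 / a)) by off_mono 1%N 0%N 3%N.
have h11 : off ((c * z / a)/(z ^+ 2 / a)) by off_mono 1%N 0%N 4%N.
have h12 : off ((b * z / a)^+2/(z ^+ 2 / a)) by off_mono 0%N 0%N 28%N.
have h13 : off ((c * z / a)^+2/(z ^+ 2 / a)) by off_mono 0%N 0%N 29%N.
have h14 : off ((b * z / a)*(c * z / a)/(z ^+ 2 / a)) by off_mono 0%N 0%N 30%N.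
have h15 : off ((b * z / a)/(c * z / a)) by off_mono 0%N 0%N 8%N.
have ox v : v \in [:: d * z / a; e * z / a; f * z / a; g * z / a] ->
  [/\ off v, off (v / (z ^+ 2 / a)), forall n, poch ((b * z / a) * q / v) n != 0 & forall n,
    poch ((c * z / a) * q / v) n != 0].
  rewrite !inE => /or4P[] /eqP ->; split.
  - off_mono 0%N 1%N 31%N.
  - off_mono 1%N 0%N 10%N.
  - move=> n; poch_mono 1%N 0%N 11%N.
  - move=> n; poch_mono 1%N 0%N 12%N.
  - off_mono 0%N 1%N 32%N.
  - off_mono 1%N 0%N 14%N.
  - move=> n; poch_mono 1%N 0%N 15%N.
  - move=> n; poch_mono 1%N 0%N 16%N.
  - off_mono 0%N 1%N 17%N.
  - off_mono 1%N 0%N 33%N.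
  - move=> n; poch_mono 1%N 0%N 34%N.
  - move=> n; poch_mono 1%N 0%N 35%N.
  - off_mono 0%N 1%N 21%N.
  - off_mono 1%N 0%N 36%N.
  - move=> n; poch_mono 1%N 0%N 37%N.
  - move=> n; poch_mono 1%N 0%N 38%N.
have R := @psi88_two_W C gc q q0 q1 (z ^+ 2 / a) (b * z / a) (c * z / a) (d * z / a) (e * z /
  a) (f * z / a) (g * z / a) h0 h1 h2 h3 h4 h5 h6 h7 h8 h9 h10 h11 h12 h13 h14 h15 ox.
have zz : (z ^+ 2 / a) ^+ 3 * q ^+ 2 / (b * z / a * (c * z / a)
    * (d * z / a * (e * z / a) * (f * z / a) * (g * z / a))) = a ^+ 2 * q / (f * g * z).
  by rewrite zE; field; nzs.
rewrite zz in R.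
have e1 u v : u * z / a * (v * z / a) / (z ^+ 2 / a) = u * v / a by field; nzs.
have e2 u : (u * z / a) ^+ 2 / (z ^+ 2 / a) = u ^+ 2 / a by field; nzs.
by have := R Z2; rewrite !e2 !e1.
Qed.

Let kappa_b := pinf (b ^+ 2 * q / a) * pinf (a * q / (f * g)) * pinf (b * a * q / (z * f))
    * pinf (b * a * q / (z * g))
  / (pinf (b ^+ 2 * q / z) * pinf (b * q / f) * pinf (b * q / g) * pinf (a ^+ 2 * q / (f * g * z))).

(** Bailey's transformation from b^2/a to b^2/z, with multiplier m = z/a and fixed parameters bf/a,
    bg/a. Its balancing condition, b^2 q/z equal to the product of bc/z, bd/z, be/z and z/a, is the
    relation z = bcde/(aq). *)
Lemma W87_transformation_b : W87 q (b ^+ 2 / a) [:: b * c / a; b * d / a; b * e / a; b * f / a;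
  b * g / a]
    (a ^+ 2 * q / (f * g * z))
  = kappa_b * W87 q (b ^+ 2 / z) [:: b * c / z; b * d / z; b * e / z; b * f / a; b * g / a]
      (a * q / (f * g)).
Proof.
have e1 : b ^+ 2 / z * q / (b * f / a * (b * g / a)) = a ^+ 2 * q / (f * g * z).
  by field; nzs.
have e2 : b ^+ 2 / a * q / (b * f / a * (b * g / a)) = a * q / (f * g).
  by field; nzs.
have e3 v : b * v / z * (z / a) = b * v / a by field; nzs.
have e4 v : v != 0 -> b ^+ 2 / a * q / (b * v / a) = b * q / v by move=> v0; field; rewrite v0; nzs.
have e5 v : v != 0 -> b ^+ 2 / z * q / (b * v / a) = b * a * q / (z * v).
  by move=> v0; field; rewrite v0; nzs.
have e6 v : v != 0 -> b ^+ 2 / z * q / (b * v / z) = b * q / v by move=> v0; field; rewrite v0; nzs.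
have e7 t : t * q / z = t / z * q by ring.
have e8 t : t * q / a = t / a * q by ring.
have nzd (t s r : C) : t != 0 -> s != 0 -> r != 0 -> t * s / r != 0.
  by move=> *; rewrite !mulf_neq0 ?invr_neq0.
have l1 : 1 - b ^+ 2 / z != 0.
  have : forall n, poch (b ^+ 2 / z) n != 0 by move=> n; poch_mono 1%N 0%N 5%N.
  by move/qpoch_neq0P => /(_ 0%N); rewrite expr0 mulr1.
have T := @W87_transformation C gc q q1 (b ^+ 2 / a) (b ^+ 2 / z) (b * c / z) (b * d / z)
  (b * e / z) (z / a) (b * f / a) (b * g / a).
rewrite e1 e2 !e3 !e4 // !e5 // !e6 // in T.
rewrite T.
- by rewrite /kappa_b (e7 (b ^+ 2)) (e8 (b ^+ 2)).
- by field; nzs.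
- by rewrite zE; field; nzs.
- by rewrite mulf_neq0 ?invr_neq0 ?expf_neq0.
- exact: nzd.
- exact: nzd.
- exact: nzd.
- by rewrite mulf_neq0 ?invr_neq0.
- exact: nzd.
- exact: nzd.
- exact: Z2.
- exact: Z1.
- move=> n; poch_mono 0%N 0%N 28%N.
- exact: l1.
- move=> n; poch_mono 2%N 0%N 5%N.
- move=> n; poch_mono 2%N 0%N 39%N.
- move=> n; poch_mono 1%N 0%N 8%N.
- move=> n; poch_mono 1%N 0%N 11%N.
- move=> n; poch_mono 1%N 0%N 15%N.
- move=> n; poch_mono 1%N 0%N 34%N.
- move=> n; poch_mono 1%N 0%N 37%N.
- move=> n; poch_mono 2%N 0%N 19%N.
- move=> n; poch_mono 2%N 0%N 23%N.
Qed.

Let kappa_c := pinf (c ^+ 2 * q / a) * pinf (a * q / (f * g)) * pinf (c * a * q / (z * f))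
    * pinf (c * a * q / (z * g))
  / (pinf (c ^+ 2 * q / z) * pinf (c * q / f) * pinf (c * q / g) * pinf (a ^+ 2 * q / (f * g * z))).

Lemma W87_transformation_c : W87 q (c ^+ 2 / a) [:: c * b / a; c * d / a; c * e / a; c * f / a;
  c * g / a]
    (a ^+ 2 * q / (f * g * z))
  = kappa_c * W87 q (c ^+ 2 / z) [:: c * b / z; c * d / z; c * e / z; c * f / a; c * g / a]
      (a * q / (f * g)).
Proof.
have e1 : c ^+ 2 / z * q / (c * f / a * (c * g / a)) = a ^+ 2 * q / (f * g * z).
  by field; nzs.
have e2 : c ^+ 2 / a * q / (c * f / a * (c * g / a)) = a * q / (f * g).
  by field; nzs.
have e3 v : c * v / z * (z / a) = c * v / a by field; nzs.
have e4 v : v != 0 -> c ^+ 2 / a * q / (c * v / a) = c * q / v by move=> v0; field; rewrite v0; nzs.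
have e5 v : v != 0 -> c ^+ 2 / z * q / (c * v / a) = c * a * q / (z * v).
  by move=> v0; field; rewrite v0; nzs.
have e6 v : v != 0 -> c ^+ 2 / z * q / (c * v / z) = c * q / v by move=> v0; field; rewrite v0; nzs.
have e7 t : t * q / z = t / z * q by ring.
have e8 t : t * q / a = t / a * q by ring.
have nzd (t s r : C) : t != 0 -> s != 0 -> r != 0 -> t * s / r != 0.
  by move=> *; rewrite !mulf_neq0 ?invr_neq0.
have l1 : 1 - c ^+ 2 / z != 0.
  have : forall n, poch (c ^+ 2 / z) n != 0 by move=> n; poch_mono 1%N 0%N 6%N.
  by move/qpoch_neq0P => /(_ 0%N); rewrite expr0 mulr1.
have T := @W87_transformation C gc q q1 (c ^+ 2 / a) (c ^+ 2 / z) (c * b / z) (c * d / z)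
  (c * e / z) (z / a) (c * f / a) (c * g / a).
rewrite e1 e2 !e3 !e4 // !e5 // !e6 // in T.
rewrite T.
- by rewrite /kappa_c (e7 (c ^+ 2)) (e8 (c ^+ 2)).
- by field; nzs.
- by rewrite zE; field; nzs.
- by rewrite mulf_neq0 ?invr_neq0 ?expf_neq0.
- exact: nzd.
- exact: nzd.
- exact: nzd.
- by rewrite mulf_neq0 ?invr_neq0.
- exact: nzd.
- exact: nzd.
- exact: Z2.
- exact: Z1.
- move=> n; poch_mono 0%N 0%N 29%N.
- exact: l1.
- move=> n; poch_mono 2%N 0%N 6%N.
- move=> n; poch_mono 2%N 0%N 40%N.
- move=> n; poch_monoV 1%N 0%N 8%N.
- move=> n; poch_mono 1%N 0%N 12%N.
- move=> n; poch_mono 1%N 0%N 16%N.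
- move=> n; poch_mono 1%N 0%N 35%N.
- move=> n; poch_mono 1%N 0%N 38%N.
- move=> n; poch_mono 2%N 0%N 20%N.
- move=> n; poch_mono 2%N 0%N 24%N.
Qed.

Let split x : pinf x = (1 - x) * pinf (x * q).
Proof. exact: qpoch_infS. Qed.

Let pinf0 x : (forall n, poch x n != 0) -> pinf x != 0.
Proof. exact: qpoch_inf_neq0. Qed.

Let lin0 x : (forall n, poch x n != 0) -> 1 - x != 0.
Proof. by move/qpoch_neq0P => /(_ 0%N); rewrite expr0 mulr1. Qed.

Let pq n : poch q n != 0.
Proof. exact: qpoch_small_neq0. Qed.

Let pZ1 n : poch (a * q / (f * g)) n != 0.
Proof. exact: qpoch_small_neq0. Qed.

Let pZ2 n : poch (a ^+ 2 * q / (f * g * z)) n != 0.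
Proof. exact: qpoch_small_neq0. Qed.

Ltac pinf_mono i j k := apply: pinf0 => ?; poch_mono i j k.
Ltac pinf_monoV i j k := apply: pinf0 => ?; poch_monoV i j k.
Ltac lin_mono i j k := apply: lin0 => ?; poch_mono i j k.
Ltac lin_monoV i j k := apply: lin0 => ?; poch_monoV i j k.
Ltac pinf_shift0 := congr (qpoch_inf _ _); mono.
Ltac pinf_shift1 := rewrite [LHS]split; congr (_ * qpoch_inf _ _); mono.

(** The factor common to the quotients [quot_b] and [quot_c], symmetric in b and c. What remains of
    each quotient consists of theta functions only, which makes the three-term relation
    applicable. *)
Let M := z / a * pinf (a ^+ 2 * q / (f * g * z)) / pinf (a * q / (f * g)) * pinf (b * c / a)
  / (pinf (a * q / (d * e)) * pinf (a * q / (b * d)) * pinf (a * q / (b * e))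
     * pinf (a * q / (c * d)) * pinf (a * q / (c * e))).

(** To be verified by [field], the coefficient identities need infinite products that are
    independent of each other. Those whose arguments agree, or differ by one factor q, are reduced
    by the equations [ep] to the same nonzero product [np]. The linear factors split off are also
    normalised up to a monomial, so that 1 - b/c and 1 - c/b become one factor [nl]. *)
Let np0 : pinf (a ^+ 2 * q / (f * g * z)) != 0. Proof. by apply: pinf0 => n; exact: pZ2. Qed.
Let np1 : pinf (a * q / (f * g)) != 0. Proof. by apply: pinf0 => n; exact: pZ1. Qed.
Let np2 : pinf (b * c / a) != 0. Proof. by pinf_mono 0%N 0%N 30%N. Qed.
Let np3 : pinf (a * q / (d * e)) != 0. Proof. by pinf_mono 1%N 0%N 7%N. Qed.
Let np4 : pinf (a * q / (b * d)) != 0. Proof. by pinf_mono 1%N 0%N 48%N. Qed.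
Let np5 : pinf (a * q / (b * e)) != 0. Proof. by pinf_monoV 1%N 0%N 42%N. Qed.
Let np6 : pinf (a * q / (c * d)) != 0. Proof. by pinf_mono 1%N 0%N 47%N. Qed.
Let np7 : pinf (a * q / (c * e)) != 0. Proof. by pinf_monoV 1%N 0%N 43%N. Qed.
Let np8 : pinf (b ^+ 2 * q / a) != 0. Proof. by pinf_mono 1%N 0%N 28%N. Qed.
Let np9 : pinf (b * a * q / (z * f)) != 0. Proof. by pinf_mono 2%N 0%N 19%N. Qed.
Let np10 : pinf (b * a * q / (z * g)) != 0. Proof. by pinf_mono 2%N 0%N 23%N. Qed.
Let np11 : pinf (b ^+ 2 * q / z) != 0. Proof. by pinf_mono 2%N 0%N 5%N. Qed.
Let np12 : pinf (b * q / f) != 0. Proof. by pinf_mono 1%N 0%N 34%N. Qed.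
Let np13 : pinf (b * q / g) != 0. Proof. by pinf_mono 1%N 0%N 37%N. Qed.
Let np14 : pinf (b * q / d) != 0. Proof. by pinf_mono 1%N 0%N 11%N. Qed.
Let np15 : pinf (z * q / (d * b)) != 0. Proof. by pinf_mono 0%N 0%N 43%N. Qed.
Let np16 : pinf (b * q / e) != 0. Proof. by pinf_mono 1%N 0%N 15%N. Qed.
Let np17 : pinf (z * q / (e * b)) != 0. Proof. by pinf_monoV 0%N 0%N 47%N. Qed.
Let ep0 : pinf (b * q / (f * z / a)) = pinf (b * a * q / (z * f)). Proof. by pinf_shift0. Qed.
Let np18 : pinf (z * q / (f * z / a * b)) != 0. Proof. by pinf_monoV 1%N 0%N 51%N. Qed.
Let ep1 : pinf (b * q / (g * z / a)) = pinf (b * a * q / (z * g)). Proof. by pinf_shift0. Qed.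
Let np19 : pinf (z * q / (g * z / a * b)) != 0. Proof. by pinf_monoV 1%N 0%N 52%N. Qed.
Let np20 : pinf (q) != 0. Proof. by apply: pinf0 => n; exact: (pq n). Qed.
Let np21 : pinf (q / b^-1) != 0. Proof. by pinf_mono 1%N 0%N 1%N. Qed.
Let nl0 : 1 - b != 0. Proof. by lin_mono 0%N 0%N 1%N. Qed.
Let ep2 : pinf (b) = (1 - b) * pinf (q / b^-1). Proof. by pinf_shift1. Qed.
Let np22 : pinf (z * q / b) != 0. Proof. by pinf_monoV 0%N 0%N 3%N. Qed.
Let nl1 : 1 - c * d * e / (a * q) != 0. Proof. by lin_monoV 0%N 1%N 3%N. Qed.
Let ep3 : pinf (z / b) = (1 - c * d * e / (a * q)) * pinf (z * q / b). Proof. by pinf_shift1. Qed.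
Let np23 : pinf (b * q / z) != 0. Proof. by pinf_mono 2%N 0%N 3%N. Qed.
Let np24 : pinf (q / b) != 0. Proof. by pinf_monoV 1%N 0%N 1%N. Qed.
Let ep4 : pinf (b * c / z) = pinf (a * q / (d * e)). Proof. by pinf_shift0. Qed.
Let np25 : pinf (q / (b / c)) != 0. Proof. by pinf_monoV 1%N 0%N 8%N. Qed.
Let nl2 : 1 - c / b != 0. Proof. by lin_monoV 0%N 0%N 8%N. Qed.
Let ep5 : pinf (c / b) = (1 - c / b) * pinf (q / (b / c)). Proof. by pinf_shift1. Qed.
Let ep6 : pinf (b * z / a * q / (d * z / a)) = pinf (b * q / d). Proof. by pinf_shift0. Qed.
Let ep7 : pinf (z ^+ 2 / a * q / (d * z / a * (b * z / a))) = pinf (a * q / (b * d)).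
Proof. by pinf_shift0. Qed.
Let ep8 : pinf (b * z / a * q / (e * z / a)) = pinf (b * q / e). Proof. by pinf_shift0. Qed.
Let ep9 : pinf (z ^+ 2 / a * q / (e * z / a * (b * z / a))) = pinf (a * q / (b * e)).
Proof. by pinf_shift0. Qed.
Let ep10 : pinf (b * z / a * q / (f * z / a)) = pinf (b * q / f). Proof. by pinf_shift0. Qed.
Let ep11 : pinf (z ^+ 2 / a * q / (f * z / a * (b * z / a))) = pinf (z * q / (f * z / a * b)).
Proof. by pinf_shift0. Qed.
Let ep12 : pinf (b * z / a * q / (g * z / a)) = pinf (b * q / g). Proof. by pinf_shift0. Qed.
Let ep13 : pinf (z ^+ 2 / a * q / (g * z / a * (b * z / a))) = pinf (z * q / (g * z / a * b)).
Proof. by pinf_shift0. Qed.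
Let ep14 : pinf ((b * z / a) ^+ 2 * q / (z ^+ 2 / a)) = pinf (b ^+ 2 * q / a).
Proof. by pinf_shift0. Qed.
Let np26 : pinf (b * z / a) != 0. Proof. by pinf_mono 0%N 1%N 26%N. Qed.
Let ep15 : pinf (z ^+ 2 / a / (b * z / a)) = (1 - c * d * e / (a * q)) * pinf (z * q / b).
Proof. by pinf_shift1. Qed.
Let ep16 : pinf (b * z / a * q / (z ^+ 2 / a)) = pinf (b * q / z). Proof. by pinf_shift0. Qed.
Let np27 : pinf (q / (b * z / a)) != 0. Proof. by pinf_monoV 2%N 0%N 26%N. Qed.
Let ep17 : pinf (b * z / a * (c * z / a) / (z ^+ 2 / a)) = pinf (b * c / a).
Proof. by pinf_shift0. Qed.
Let ep18 : pinf (c * z / a / (b * z / a)) = (1 - c / b) * pinf (q / (b / c)).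
Proof. by pinf_shift1. Qed.
Let ep19 : pinf (c * e / a) = pinf (z * q / (d * b)). Proof. by pinf_shift0. Qed.
Let ep20 : pinf (q / (c * e / a)) = pinf (a * q / (c * e)). Proof. by pinf_shift0. Qed.
Let ep21 : pinf (c * d / a) = pinf (z * q / (e * b)). Proof. by pinf_shift0. Qed.
Let ep22 : pinf (q / (c * d / a)) = pinf (a * q / (c * d)). Proof. by pinf_shift0. Qed.
Let np28 : pinf (c ^+ 2 * q / a) != 0. Proof. by pinf_mono 1%N 0%N 29%N. Qed.
Let np29 : pinf (c * a * q / (z * f)) != 0. Proof. by pinf_mono 2%N 0%N 20%N. Qed.
Let np30 : pinf (c * a * q / (z * g)) != 0. Proof. by pinf_mono 2%N 0%N 24%N. Qed.
Let np31 : pinf (c ^+ 2 * q / z) != 0. Proof. by pinf_mono 2%N 0%N 6%N. Qed.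
Let np32 : pinf (c * q / f) != 0. Proof. by pinf_mono 1%N 0%N 35%N. Qed.
Let np33 : pinf (c * q / g) != 0. Proof. by pinf_mono 1%N 0%N 38%N. Qed.
Let np34 : pinf (c * q / d) != 0. Proof. by pinf_mono 1%N 0%N 12%N. Qed.
Let np35 : pinf (z * q / (d * c)) != 0. Proof. by pinf_mono 0%N 0%N 42%N. Qed.
Let np36 : pinf (c * q / e) != 0. Proof. by pinf_mono 1%N 0%N 16%N. Qed.
Let np37 : pinf (z * q / (e * c)) != 0. Proof. by pinf_monoV 0%N 0%N 48%N. Qed.
Let ep23 : pinf (c * q / (f * z / a)) = pinf (c * a * q / (z * f)). Proof. by pinf_shift0. Qed.
Let np38 : pinf (z * q / (f * z / a * c)) != 0. Proof. by pinf_monoV 1%N 0%N 49%N. Qed.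
Let ep24 : pinf (c * q / (g * z / a)) = pinf (c * a * q / (z * g)). Proof. by pinf_shift0. Qed.
Let np39 : pinf (z * q / (g * z / a * c)) != 0. Proof. by pinf_monoV 1%N 0%N 50%N. Qed.
Let np40 : pinf (c) != 0. Proof. by pinf_mono 0%N 0%N 2%N. Qed.
Let np41 : pinf (z / c) != 0. Proof. by pinf_monoV 0%N 1%N 4%N. Qed.
Let np42 : pinf (c * q / z) != 0. Proof. by pinf_mono 2%N 0%N 4%N. Qed.
Let np43 : pinf (q / c) != 0. Proof. by pinf_monoV 1%N 0%N 2%N. Qed.
Let ep25 : pinf (c * b / z) = pinf (a * q / (d * e)). Proof. by pinf_shift0. Qed.
Let np44 : pinf (b * q / c) != 0. Proof. by pinf_mono 1%N 0%N 8%N. Qed.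
Let ep26 : pinf (b / c) = (- (b / c) * (1 - c / b)) * pinf (b * q / c). Proof. by pinf_shift1. Qed.
Let ep27 : pinf (c * z / a * q / (d * z / a)) = pinf (c * q / d). Proof. by pinf_shift0. Qed.
Let ep28 : pinf (z ^+ 2 / a * q / (d * z / a * (c * z / a))) = pinf (a * q / (c * d)).
Proof. by pinf_shift0. Qed.
Let ep29 : pinf (c * z / a * q / (e * z / a)) = pinf (c * q / e). Proof. by pinf_shift0. Qed.
Let ep30 : pinf (z ^+ 2 / a * q / (e * z / a * (c * z / a))) = pinf (a * q / (c * e)).
Proof. by pinf_shift0. Qed.
Let ep31 : pinf (c * z / a * q / (f * z / a)) = pinf (c * q / f). Proof. by pinf_shift0. Qed.
Let ep32 : pinf (z ^+ 2 / a * q / (f * z / a * (c * z / a))) = pinf (z * q / (f * z / a * c)).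
Proof. by pinf_shift0. Qed.
Let ep33 : pinf (c * z / a * q / (g * z / a)) = pinf (c * q / g). Proof. by pinf_shift0. Qed.
Let ep34 : pinf (z ^+ 2 / a * q / (g * z / a * (c * z / a))) = pinf (z * q / (g * z / a * c)).
Proof. by pinf_shift0. Qed.
Let ep35 : pinf ((c * z / a) ^+ 2 * q / (z ^+ 2 / a)) = pinf (c ^+ 2 * q / a).
Proof. by pinf_shift0. Qed.
Let np45 : pinf (c * z / a) != 0. Proof. by pinf_mono 0%N 1%N 27%N. Qed.
Let ep36 : pinf (z ^+ 2 / a / (c * z / a)) = pinf (z / c). Proof. by pinf_shift0. Qed.
Let ep37 : pinf (c * z / a * q / (z ^+ 2 / a)) = pinf (c * q / z). Proof. by pinf_shift0. Qed.
Let np46 : pinf (q / (c * z / a)) != 0. Proof. by pinf_monoV 2%N 0%N 27%N. Qed.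
Let ep38 : pinf (c * z / a * (b * z / a) / (z ^+ 2 / a)) = pinf (b * c / a).
Proof. by pinf_shift0. Qed.
Let ep39 : pinf (b * z / a / (c * z / a)) = (- (b / c) * (1 - c / b)) * pinf (b * q / c).
Proof. by pinf_shift1. Qed.
Let ep40 : pinf (b * e / a) = pinf (z * q / (d * c)). Proof. by pinf_shift0. Qed.
Let ep41 : pinf (q / (b * e / a)) = pinf (a * q / (b * e)). Proof. by pinf_shift0. Qed.
Let ep42 : pinf (b * d / a) = pinf (z * q / (e * c)). Proof. by pinf_shift0. Qed.
Let ep43 : pinf (q / (b * d / a)) = pinf (a * q / (b * d)). Proof. by pinf_shift0. Qed.
Let ep44 : pinf (q / (z / b)) = pinf (b * q / z). Proof. by pinf_shift0. Qed.
Let np47 : pinf (z / a) != 0. Proof. by pinf_mono 0%N 1%N 46%N. Qed.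
Let np48 : pinf (q / (z / a)) != 0. Proof. by pinf_monoV 2%N 0%N 46%N. Qed.
Let np49 : pinf (z * q) != 0. Proof. by pinf_mono 0%N 0%N 0%N. Qed.
Let nl3 : 1 - b * c * d * e / (a * q) != 0. Proof. by lin_mono 0%N 1%N 0%N. Qed.
Let ep45 : pinf (z) = (1 - b * c * d * e / (a * q)) * pinf (z * q). Proof. by pinf_shift1. Qed.
Let np50 : pinf (q / z) != 0. Proof. by pinf_monoV 2%N 0%N 0%N. Qed.
Let ep46 : pinf (a * q / b / f) = pinf (z * q / (f * z / a * b)). Proof. by pinf_shift0. Qed.
Let ep47 : pinf (a * q / b / g) = pinf (z * q / (g * z / a * b)). Proof. by pinf_shift0. Qed.
Let np51 : pinf (q / d) != 0. Proof. by pinf_monoV 1%N 0%N 9%N. Qed.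
Let np52 : pinf (q / e) != 0. Proof. by pinf_monoV 1%N 0%N 13%N. Qed.
Let np53 : pinf (a * q / f) != 0. Proof. by pinf_monoV 1%N 0%N 18%N. Qed.
Let np54 : pinf (a * q / g) != 0. Proof. by pinf_monoV 1%N 0%N 22%N. Qed.
Let np55 : pinf (a * q / (f * z)) != 0. Proof. by pinf_monoV 2%N 0%N 17%N. Qed.
Let np56 : pinf (a * q / (g * z)) != 0. Proof. by pinf_monoV 2%N 0%N 21%N. Qed.
Let ep48 : pinf (b * q / b) = pinf (q). Proof. by pinf_shift0. Qed.
Let ep49 : pinf (z^-1 / b^-1) = (- (a * q / (c * d * e)) * (1 - c * d * e / (a * q))) * pinf (b * q / z).
Proof. by pinf_shift1. Qed.
Let nl4 : 1 - a * q / (b * d * e) != 0. Proof. by lin_mono 1%N 0%N 4%N. Qed.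
Let ep50 : pinf (z^-1 / c^-1) = (1 - a * q / (b * d * e)) * pinf (c * q / z).
Proof. by pinf_shift1. Qed.
Let np57 : pinf (q / (z / d)) != 0. Proof. by pinf_mono 2%N 0%N 10%N. Qed.
Let nl5 : 1 - a * q / (b * c * e) != 0. Proof. by lin_mono 1%N 0%N 10%N. Qed.
Let ep51 : pinf (z^-1 / d^-1) = (1 - a * q / (b * c * e)) * pinf (q / (z / d)).
Proof. by pinf_shift1. Qed.
Let np58 : pinf (q / (z / e)) != 0. Proof. by pinf_mono 2%N 0%N 14%N. Qed.
Let nl6 : 1 - a * q / (b * c * d) != 0. Proof. by lin_mono 1%N 0%N 14%N. Qed.
Let ep52 : pinf (z^-1 / e^-1) = (1 - a * q / (b * c * d)) * pinf (q / (z / e)).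
Proof. by pinf_shift1. Qed.
Let ep53 : pinf (z^-1 / (f * g / (a ^+ 2 * q))) = pinf (a ^+ 2 * q / (f * g * z)).
Proof. by pinf_shift0. Qed.
Let np59 : pinf (z * q / d) != 0. Proof. by pinf_monoV 0%N 0%N 10%N. Qed.
Let ep54 : pinf (z / d) = (- (b * c * e / (a * q)) * (1 - a * q / (b * c * e))) * pinf (z * q / d).
Proof. by pinf_shift1. Qed.
Let np60 : pinf (z * q / e) != 0. Proof. by pinf_monoV 0%N 0%N 14%N. Qed.
Let ep55 : pinf (z / e) = (- (b * c * d / (a * q)) * (1 - a * q / (b * c * d))) * pinf (z * q / e).
Proof. by pinf_shift1. Qed.
Let ep56 : pinf (z * q / (f * z / a)) = pinf (a * q / f). Proof. by pinf_shift0. Qed.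
Let ep57 : pinf (q / (f * z / a)) = pinf (a * q / (f * z)). Proof. by pinf_shift0. Qed.
Let ep58 : pinf (z * q / (g * z / a)) = pinf (a * q / g). Proof. by pinf_shift0. Qed.
Let ep59 : pinf (q / (g * z / a)) = pinf (a * q / (g * z)). Proof. by pinf_shift0. Qed.
Let ep60 : pinf (b / z) = (- (a * q / (c * d * e)) * (1 - c * d * e / (a * q))) * pinf (b * q / z).
Proof. by pinf_shift1. Qed.
Let ep61 : pinf (c / z) = (1 - a * q / (b * d * e)) * pinf (c * q / z). Proof. by pinf_shift1. Qed.
Let np61 : pinf (z ^+ 2 * q / a) != 0. Proof. by pinf_mono 0%N 1%N 25%N. Qed.
Let ep62 : pinf (b^-1) = (- (1 / b) * (1 - b)) * pinf (q / b). Proof. by pinf_shift1. Qed.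
Let ep63 : pinf (b / a / ((b * q)^-1)) = pinf (b ^+ 2 * q / a). Proof. by pinf_shift0. Qed.
Let ep64 : pinf (b / a / c^-1) = pinf (b * c / a). Proof. by pinf_shift0. Qed.
Let ep65 : pinf (b / a / d^-1) = pinf (z * q / (e * c)). Proof. by pinf_shift0. Qed.
Let ep66 : pinf (b / a / e^-1) = pinf (z * q / (d * c)). Proof. by pinf_shift0. Qed.
Let np62 : pinf (z * q / f) != 0. Proof. by pinf_monoV 0%N 0%N 33%N. Qed.
Let np63 : pinf (z * q / g) != 0. Proof. by pinf_monoV 0%N 0%N 36%N. Qed.
Let np64 : pinf (z^-1 / (z / (a * q))) != 0. Proof. by pinf_monoV 3%N 0%N 25%N. Qed.
Let ep67 : pinf (a * q / z / b) = pinf (q / (b * z / a)). Proof. by pinf_shift0. Qed.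
Let ep68 : pinf (a * q / z / c) = pinf (q / (c * z / a)). Proof. by pinf_shift0. Qed.
Let np65 : pinf (a * q / z / d) != 0. Proof. by pinf_monoV 2%N 0%N 31%N. Qed.
Let np66 : pinf (a * q / z / e) != 0. Proof. by pinf_monoV 2%N 0%N 32%N. Qed.
Let ep69 : pinf (a * q / z / f) = pinf (a * q / (f * z)). Proof. by pinf_shift0. Qed.
Let ep70 : pinf (a * q / z / g) = pinf (a * q / (g * z)). Proof. by pinf_shift0. Qed.
Let ep71 : pinf (z ^+ 2 / a * q / (d * z / a)) = pinf (z * q / d). Proof. by pinf_shift0. Qed.
Let ep72 : pinf (q / (d * z / a)) = pinf (a * q / z / d). Proof. by pinf_shift0. Qed.
Let ep73 : pinf (z ^+ 2 / a * q / (e * z / a)) = pinf (z * q / e). Proof. by pinf_shift0. Qed.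
Let ep74 : pinf (q / (e * z / a)) = pinf (a * q / z / e). Proof. by pinf_shift0. Qed.
Let ep75 : pinf (z ^+ 2 / a * q / (f * z / a)) = pinf (z * q / f). Proof. by pinf_shift0. Qed.
Let ep76 : pinf (z ^+ 2 / a * q / (g * z / a)) = pinf (z * q / g). Proof. by pinf_shift0. Qed.
Let ep77 : pinf (z ^+ 2 / a * q) = pinf (z ^+ 2 * q / a). Proof. by pinf_shift0. Qed.
Let ep78 : pinf (q / (z ^+ 2 / a)) = pinf (z^-1 / (z / (a * q))). Proof. by pinf_shift0. Qed.
Let ep79 : pinf (b * z / a / (z ^+ 2 / a)) = (- (a * q / (c * d * e)) * (1 - c * d * e / (a * q))) * pinf (b * q / z).
Proof. by pinf_shift1. Qed.
Let ep80 : pinf (c * z / a / (z ^+ 2 / a)) = (1 - a * q / (b * d * e)) * pinf (c * q / z).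
Proof. by pinf_shift1. Qed.
Let pinfE := (ep0, ep1, ep2, ep3, ep4, ep5, ep6, ep7, ep8, ep9, ep10, ep11, ep12, ep13, ep14,
  ep15, ep16, ep17, ep18, ep19, ep20, ep21, ep22, ep23, ep24, ep25, ep26, ep27, ep28, ep29,
  ep30, ep31, ep32, ep33, ep34, ep35, ep36, ep37, ep38, ep39, ep40, ep41, ep42, ep43, ep44,
  ep45, ep46, ep47, ep48, ep49, ep50, ep51, ep52, ep53, ep54, ep55, ep56, ep57, ep58, ep59,
  ep60, ep61, ep62, ep63, ep64, ep65, ep66, ep67, ep68, ep69, ep70, ep71, ep72, ep73, ep74,
  ep75, ep76, ep77, ep78, ep79, ep80).

(* This is where the facts [np_] and [nl_] are used: the match finds them in the context. *)
Ltac abstract_atoms := repeat match goal with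
  | H : is_true (pinf ?x != 0) |- context [pinf ?x] =>
    generalize H; move: (pinf x) => ? ?
  | H : is_true (1 - ?x != 0) |- context [1 - ?x] =>
    generalize H; move: (1 - x) => ? ?
  end.
Ltac nonzeros := repeat match goal with
  | |- is_true (_ && _) => apply/andP; split
  | |- is_true (_ * _ != 0) => apply: mulf_neq0
  | |- is_true (_^-1 != 0) => apply: invr_neq0
  | |- is_true (- _ != 0) => rewrite oppr_eq0
  | |- is_true (_ ^+ _ != 0) => apply: expf_neq0
  | |- is_true (1 != 0) => exact: oner_neq0
  | H : is_true (?x != 0) |- is_true (?x != 0) => exact: H
  end.

Let quot_b : W_coef q z d e (f * z / a) (g * z / a) b c / (kappa_b * W_coef q (z ^+ 2 / a) (d *
  z / a) (e * z / a) (f * z / a) (g * z / a) (b * z / a) (c * z / a))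
  = M * (th (b * z / a) * th (c * e / a) * th (c * d / a) / th b).
Proof.
rewrite /M /kappa_b /psi_coef /W_coef /theta_prod !big_cons !big_nil.
rewrite !pinfE; abstract_atoms; rewrite ?zE; field; nonzeros.
Qed.

Let quot_c : W_coef q z d e (f * z / a) (g * z / a) c b / (kappa_c * W_coef q (z ^+ 2 / a) (d *
  z / a) (e * z / a) (f * z / a) (g * z / a) (c * z / a) (b * z / a))
  = M * (th (c * z / a) * th (b * e / a) * th (b * d / a) / th c).
Proof.
rewrite /M /kappa_c /psi_coef /W_coef /theta_prod !big_cons !big_nil.
rewrite !pinfE; abstract_atoms; rewrite ?zE; field; nonzeros.
Qed.

(** The determinant of the elimination, the right-hand side of [quot_b] minus that of [quot_c], in
    the product form supplied by [three_terms]. *)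
Let N := - M * (a * q / (b * z)) * (th (z / a) * th (z / d) * th (z / e) * th (b / c))
  / (th b * th c).

(** Cramer's rule for the first coefficient of the theorem, with the denominators [W_coef] and [N]
    moved to the left. The right-hand side has no theta factor, since the first relation enters the
    elimination with coefficient -1; in [coef2] the second one enters with the quotient of
    [quot_c]. *)
Let coef1 : (1 - z^-1) * ((th (b * z / a) * th (z / b)) / (th (z / a) * th z)) * (pinf (b ^+ 2
  * q / a) / Omega q [:: a * q / b; b * q] [:: f; g]) * ((Omega q [:: q] [:: b; c; d; e] *
  Omega q [:: a * q] [:: f; g; c * d; c * e; d * e; f * g; f * z; g * z]) / (Omega q [:: b * q]
  [:: b; c; d; e] * Omega q [:: z^-1] [:: b^-1; c^-1; d^-1; e^-1; f * g / (a ^+ 2 * q)])) *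
  W_coef q (z ^+ 2 / a) (d * z / a) (e * z / a) (f * z / a) (g * z / a) (b * z / a) (c * z / a)
  * N = - psi_coef q z b c d e (f * z / a) (g * z / a).
Proof.
rewrite /N /M /Omega /psi_coef /W_coef /theta_prod !big_cons !big_nil.
have -> : 1 - z^-1 = - z^-1 * (1 - b * c * d * e / (a * q)) by rewrite -zE; field; nzs.
rewrite !pinfE; abstract_atoms; rewrite ?zE; field; nonzeros.
Qed.

Let coef2 : (pinf (z * q / b) / pinf (z ^+ 2 * q / a)) * (th b^-1 / th (z / a)) * ((Omega q [::
  b / a] [:: (b * q)^-1; c^-1; d^-1; e^-1] * Omega q [:: z * q] [:: f; g]) / (Omega q [:: z^-1]
  [:: z / (a * q); c^-1; d^-1; e^-1] * Omega q [:: a * q / b] [:: f; g])) * (Omega q [:: a * q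
  / z] [:: b; c; d; e; f; g] / Omega q [:: b * q] [:: b; c; d; e; f; g]) * W_coef q (z ^+ 2 /
  a) (d * z / a) (e * z / a) (f * z / a) (g * z / a) (b * z / a) (c * z / a) * N = M * (th (c *
  z / a) * th (b * e / a) * th (b * d / a) / th c) * psi_coef q (z ^+ 2 / a) (b * z / a) (c * z
  / a) (d * z / a) (e * z / a) (f * z / a) (g * z / a).
Proof.
rewrite /N /M /Omega /psi_coef /W_coef /theta_prod !big_cons !big_nil.
rewrite !pinfE; abstract_atoms; rewrite ?zE; field; nonzeros.
Qed.

Let N_neq0 : N != 0.
Proof.
rewrite ?/N ?/M ?/kappa_b ?/kappa_c ?/W_coef ?/theta_prod ?big_cons ?big_nil.
rewrite !pinfE; nonzeros.
Qed.

Let kappaW_b_neq0 : kappa_b * W_coef q (z ^+ 2 / a) (d * z / a) (e * z / a) (f * z / a) (g * z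
  / a) (b * z / a) (c * z / a) != 0.
Proof.
rewrite ?/N ?/M ?/kappa_b ?/kappa_c ?/W_coef ?/theta_prod ?big_cons ?big_nil.
rewrite !pinfE; nonzeros.
Qed.

Let kappaW_c_neq0 : kappa_c * W_coef q (z ^+ 2 / a) (d * z / a) (e * z / a) (f * z / a) (g * z
  / a) (c * z / a) (b * z / a) != 0.
Proof.
rewrite ?/N ?/M ?/kappa_b ?/kappa_c ?/W_coef ?/theta_prod ?big_cons ?big_nil.
rewrite !pinfE; nonzeros.
Qed.

(** [theta_addition] with A = a/e and x = z/e. Three of the resulting arguments, zq/d, cd/(aq) and
    bd/(aq), are off by a factor q, which the quasi-periodicity of theta corrects. *)
Let three_terms : th (b * z / a) * th c * th (c * e / a) * th (c * d / a)
  - th (c * z / a) * th b * th (b * e / a) * th (b * d / a)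
  = - (a * q / (b * z)) * (th (z / a) * th (z / d) * th (z / e) * th (b / c)).
Proof.
have A0 : a / e != 0 by rewrite mulf_neq0 ?invr_neq0.
have x0 : z / e != 0 by rewrite mulf_neq0 ?invr_neq0.
have o0 : off (a / e) by off_mono 0%N 0%N 41%N.
have o1 : off (b) by off_mono 0%N 0%N 1%N.
have o2 : off (c) by off_mono 0%N 0%N 2%N.
have o3 : off (b / (a / e)) by off_mono 0%N 0%N 42%N.
have o4 : off (c / (a / e)) by off_mono 0%N 0%N 43%N.
have o5 : off (b ^+ 2 / (a / e)) by off_mono 0%N 0%N 44%N.
have o6 : off (c ^+ 2 / (a / e)) by off_mono 0%N 0%N 45%N.
have o7 : off (b * c / (a / e)) by off_monoV 0%N 0%N 10%N.
have o8 : off (b / c) by off_mono 0%N 0%N 8%N.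
have o9 : off (z / e) by off_monoV 0%N 1%N 14%N.
have o10 : off (z / e / (a / e)) by off_mono 0%N 1%N 46%N.
have o11 : off (z / e / b) by off_monoV 0%N 1%N 47%N.
have o12 : off (z / e / c) by off_monoV 0%N 1%N 48%N.
have o13 : off (b * (z / e) / (a / e)) by off_mono 0%N 1%N 26%N.
have o14 : off (c * (z / e) / (a / e)) by off_mono 0%N 1%N 27%N.
have T := @theta_addition C gc q q0 q1 (a / e) b c A0 b0 c0 o0 o1 o2 o3 o4 o5 o6 o7 o8 (z / e)
  x0 o9 o10 o11 o12 o13 o14.
have r1 : z / e / (a / e) = z / a by field; nzs.
have r2 : b * c / (a / e) = z / d * q by rewrite zE; field; nzs.
have r3 : z / e / b = c * d / a / q by rewrite zE; field; nzs.
have r4 : z / e / c = b * d / a / q by rewrite zE; field; nzs.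
have r5 (u : C) : u * (z / e) / (a / e) = u * z / a by field; nzs.
have r6 (u : C) : u / (a / e) = u * e / a by field; nzs.
have nzm (u v : C) : u != 0 -> v != 0 -> u * v / a != 0 by move=> *; rewrite !mulf_neq0 ?invr_neq0.
rewrite r1 r2 r3 r4 !r5 !r6 !(theta_prod_q gc q0 q1) ?nzm // in T.
have zd : th (z / d) = - (z / d) * th (z / d * q).
  have := @theta_prod_q C gc q q0 q1 (z / d * q); rewrite mulfK // => -> //.
  by rewrite !mulf_neq0 ?invr_neq0.
have zdq : th (z / d * q) = - (d / z) * th (z / d) by rewrite zd; field; nzs.
rewrite zdq in T.
have k0 : - (c * d / a / q) != 0 by rewrite oppr_eq0 !mulf_neq0 ?invr_neq0.
apply: (mulfI k0).
transitivity (- (c / b) * (th (z / e) * th (z / a) * th (b / c) * (- (d / z) * th (z / d)))).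
  by rewrite T; field; nzs.
by rewrite zE; field; nzs.
Qed.

Theorem W87_two_psi88_generic :
  W87 q (b ^+ 2 / a) [:: b * c / a; b * d / a; b * e / a; b * f / a; b * g / a]
    (a ^+ 2 * q / (f * g * z))
  = psi88_coef1 q a b c d e f g z
    * psi88 q z [:: b; c; d; e; f * z / a; g * z / a] (a * q / (f * g))
  + psi88_coef2 q a b c d e f g z
    * psi88 q (z ^+ 2 / a) [:: b * z / a; c * z / a; d * z / a; e * z / a; f * z / a; g * z / a]
        (a ^+ 2 * q / (f * g * z)).
Proof.
have thE x : x != 0 -> theta q x = th x by exact: jacobi_triple_product.
have nzr (u v : C) : u != 0 -> v != 0 -> u / v != 0.
  by move=> *; rewrite mulf_neq0 ?invr_neq0.
rewrite /psi88_coef1 /psi88_coef2 !thE ?nzr ?mulf_neq0 ?invr_neq0 //.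
have := psi88_W87_relation1.
have := psi88_W87_relation2.
have := W87_transformation_b.
have := W87_transformation_c.
rewrite -/kappa_b -/kappa_c.
move: N_neq0 kappaW_b_neq0 kappaW_c_neq0 quot_b quot_c coef1 coef2.
set k1 := kappa_b; set k2 := kappa_c; set W2b := W_coef q (z ^+ 2 / a) _ _ _ _ (b * z / a) _.
set W2c := W_coef q (z ^+ 2 / a) _ _ _ _ (c * z / a) _.
set W1b := W_coef q z _ _ _ _ b c; set W1c := W_coef q z _ _ _ _ c b.
set p1 := psi_coef q z _ _ _ _ _ _.
set p2 := psi_coef q (z ^+ 2 / a) _ _ _ _ _ _.
set F1 := psi88 q z _ _; set F2 := psi88 q (z ^+ 2 / a) _ _.
set V1 := W87 q (b ^+ 2 / z) _ _; set V2 := W87 q (c ^+ 2 / z) _ _.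
set U1 := W87 q (b ^+ 2 / a) _ _; set U2 := W87 q (c ^+ 2 / a) _ _.
move=> N0 kb0 kc0 Eb Ec.
set Y := (X in X * W2b * N = M * _ * _).
set X := (X in X * W2b * N = - p1).
move=> E1 E2 Tc Tb R2 R1.
have [kb1 Wb0] : k1 != 0 /\ W2b != 0 by move: kb0; rewrite mulf_eq0 negb_or => /andP[].
have [kc1 Wc0] : k2 != 0 /\ W2c != 0 by move: kc0; rewrite mulf_eq0 negb_or => /andP[].
set Qb := M * _ in Eb; set Qc := M * _ in Ec E2.
have tb0 : th b != 0.
  by apply: contraNneq N0 => t0; rewrite /N t0 mul0r invr0 mulr0.
have tc0 : th c != 0.
  by apply: contraNneq N0 => t0; rewrite /N t0 mulr0 invr0 mulr0.
have NE : N = Qb - Qc.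
  transitivity (M * ((th (b * z / a) * th c * th (c * e / a) * th (c * d / a)
     - th (c * z / a) * th b * th (b * e / a) * th (b * d / a)) / (th b * th c))).
    by rewrite three_terms /N; field; rewrite tb0 tc0; nzs.
  by rewrite /Qb /Qc; field; rewrite tb0 tc0.
have Eb' : W1b = Qb * (k1 * W2b) by rewrite -Eb divfK.
have Ec' : W1c = Qc * (k2 * W2c) by rewrite -Ec divfK.
(* After multiplication by W2b N the right-hand side is - p1 F1 + Qc p2 F2. The terms in U2 cancel,
   and (Qb - Qc) W2b U1 = N W2b U1 remains. *)
apply: (mulIf (mulf_neq0 Wb0 N0)).
have -> : (X * F1 + Y * F2) * (W2b * N) = (X * W2b * N) * F1 + (Y * W2b * N) * F2 by ring.
rewrite E1 E2.
have R1' : p1 * F1 = - (Qb * W2b * U1) - Qc * W2c * U2.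
  by move: R1 => /eqP; rewrite Eb' Ec' Tb Tc -addrA addr_eq0 => /eqP ->; ring.
have R2' : p2 * F2 = - (W2b * U1) - W2c * U2.
  by move: R2 => /eqP; rewrite -addrA addr_eq0 => /eqP ->; ring.
rewrite mulNr R1' -(mulrA Qc p2) R2' NE; ring.
Qed.

End Generic.

(** * Continuity in the parameters *)

Section Tame.
Variables (C : numFieldType) (gc : geometrically_complete C) (q : C).
Hypothesis q0 : q != 0.
Hypothesis q1 : `|q| < 1.
Local Notation poch := (qpoch q).
Implicit Types (f g : nat -> nat -> C) (u v : nat -> C).

(** The two hypotheses of Tannery's theorem on the coefficients of a power series, joined because
    both are stable under products and differences. *)
Definition tame f u := unif_bounded f /\ forall k, f N k @[N --> \oo] --> u k.

Lemma tameM f u g v : tame f u -> tame g v ->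
  tame (fun N k => f N k * g N k) (fun k => u k * v k).
Proof.
by move=> [bf cf] [bg cg]; split=> [|k]; [exact: unif_boundedM|exact: cvgM].
Qed.

Lemma tameB f u g v : tame f u -> tame g v ->
  tame (fun N k => f N k - g N k) (fun k => u k - v k).
Proof.
by move=> [bf cf] [bg cg]; split=> [|k]; [exact: unif_boundedB|exact: cvgB].
Qed.

Lemma tame_prod n (f : 'I_n -> nat -> nat -> C) (u : 'I_n -> nat -> C) :
  (forall i, tame (f i) (u i)) ->
  tame (fun N k => \prod_(i < n) f i N k) (fun k => \prod_(i < n) u i k).
Proof.
move=> h; split=> [|k]; first by apply: unif_bounded_prod => i _; case: (h i).
by apply: cvg_prods => i _; case: (h i).
Qed.

Lemma tame_cvg (x_ : nat -> C) x : x_ N @[N --> \oo] --> x ->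
  tame (fun N _ => x_ N) (fun _ => x).
Proof. by move=> cx; split=> //; exact: unif_bounded_cvg cx. Qed.

Lemma tame_reindex f u (h : nat -> nat) : tame f u -> tame (fun N k => f N (h k)) (u \o h).
Proof. by move=> [bf cf]; split=> [|k]; [exact: unif_bounded_reindex bf|exact: cf]. Qed.

Lemma tame_expq (h : nat -> nat) : tame (fun _ k => q ^+ h k) (fun k => q ^+ h k).
Proof. by split=> [|k]; [apply: unif_bounded_expn; exact: ltW|exact: cvg_cst]. Qed.

Lemma tame_qpoch (x_ : nat -> C) x : x_ N @[N --> \oo] --> x ->
  tame (fun N k => poch (x_ N) k) (poch x).
Proof.
by move=> cx; split=> [|k]; [exact: unif_bounded_qpoch cx|exact: cvg_qpoch].
Qed.

Lemma tame_qpochV (x_ : nat -> C) x : x_ N @[N --> \oo] --> x ->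
  (forall n, poch x n != 0) ->
  tame (fun N k => (poch (x_ N) k)^-1) (fun k => (poch x k)^-1).
Proof.
move=> cx x0; split=> [|k]; first exact: unif_bounded_qpochV cx x0.
by apply: cvgV => //; exact: cvg_qpoch.
Qed.

Lemma tame_lim_series f u (z_ : nat -> C) z : tame f u ->
  z_ N @[N --> \oo] --> z -> `|z| < 1 ->
  limn (series (fun k => f N k * z_ N ^+ k)) @[N --> \oo]
    --> limn (series (fun k => u k * z ^+ k)).
Proof.
move=> [[K bf] cf] cz z1.
(* The argument varies with N as well; the midpoint of |z| and 1 leaves room for z_N near z. *)
pose r := (1 + `|z|) / 2.
have zr : `|z| < r by rewrite /r ltr_pdivlMr // mulr_natr mulr2n ltrD2r.
have r1 : r < 1 by rewrite /r ltr_pdivrMr // mul1r -[2]/(1 + 1) ltrD2l.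
have r0 : 0 <= r by apply: le_trans (ltW zr).
apply: (tannery gc (K := K) r0 r1); last first.
  by move=> k; apply: cvgM => //; exact: cvg_powers.
have bz : \forall N \near \oo, `|z_ N| < r.
  have /cvgrPdist_lt /(_ (r - `|z|)) := cz; rewrite subr_gt0 => /(_ zr).
  apply: filterS => N h; have -> : z_ N = z - (z - z_ N) by ring.
  by rewrite (le_lt_trans (ler_normB _ _)) // -ltrBrDl.
apply: filterS2 bf bz => N hf hz k.
by rewrite normrM normrX ler_pM ?exprn_ge0 // lerXn2r ?nnegrE ?normr_ge0 // ltW.
Qed.

Definition cvg_list (l_ : nat -> seq C) (l : seq C) : Prop :=
  (forall N, size (l_ N) = size l) /\
  (forall i, nth 0 (l_ N) i @[N --> \oo] --> nth 0 l i).

Lemma cvg_list_nil : cvg_list (fun=> [::]) [::].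
Proof. by split=> // i; rewrite nth_nil; exact: cvg_cst. Qed.

Lemma cvg_list_cons (x_ : nat -> C) x l_ l : x_ N @[N --> \oo] --> x ->
  cvg_list l_ l -> cvg_list (fun N => x_ N :: l_ N) (x :: l).
Proof.
by move=> cx [sl cl]; split=> [N|[|i]] /=; [rewrite sl|exact: cx|exact: cl].
Qed.

Lemma big_cvg_list (F : C -> C) l_ l N : cvg_list l_ l ->
  \prod_(x <- l_ N) F x = \prod_(i < size l) F (nth 0 (l_ N) i).
Proof. by move=> [sl _]; rewrite (big_nth 0) sl big_mkord. Qed.

Lemma W87_cvg (a_ : nat -> C) a l_ l (z_ : nat -> C) z :
  a_ N @[N --> \oo] --> a -> cvg_list l_ l -> z_ N @[N --> \oo] --> z ->
  `|z| < 1 -> {in l, forall x, x != 0} -> W_regular q a l ->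
  W87 q (a_ N) (l_ N) (z_ N) @[N --> \oo] --> W87 q a l z.
Proof.
move=> ca cl cz z1 l0 [a1 lr].
apply: tame_lim_series => //.
have -> : (fun N k => (1 - a_ N * q ^+ (2 * k)) / (1 - a_ N) * (poch (a_ N) k / poch q k)
    * \prod_(x <- l_ N) (poch x k / poch (a_ N * q / x) k))
  = (fun N k => (1 - a_ N * q ^+ (2 * k)) / (1 - a_ N) * (poch (a_ N) k / poch q k)
    * \prod_(i < size l) (poch (nth 0 (l_ N) i) k / poch (a_ N * q / (nth 0 (l_ N) i)) k)).
  by apply/funext => N; apply/funext => k; rewrite (big_cvg_list _ _ cl).
have -> : (fun k => (1 - a * q ^+ (2 * k)) / (1 - a) * (poch a k / poch q k)
    * \prod_(x <- l) (poch x k / poch (a * q / x) k))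
  = (fun k => (1 - a * q ^+ (2 * k)) / (1 - a) * (poch a k / poch q k)
    * \prod_(i < size l) (poch (nth 0 l i) k / poch (a * q / (nth 0 l i)) k)).
  by apply/funext => k; rewrite (big_nth 0) big_mkord.
have c1 : (1 : C) @[_ --> \oo] --> (1 : C) by exact: cvg_cst.
apply: tameM; first apply: tameM.
- apply: tameM; first apply: tameB.
  + exact: tame_cvg.
  + by apply: tameM; [exact: tame_cvg|exact: tame_expq].
  + by apply: tame_cvg; apply: cvgV => //; apply: cvgB.
- apply: tameM; first exact: tame_qpoch.
  by apply: tame_qpochV; [exact: cvg_cst|move=> n; exact: qpoch_small_neq0].
- apply: tame_prod => i; have [_ /(_ i) ci] := cl.
  have li : nth 0 l i \in l by exact: mem_nth.
  apply: tameM; first exact: tame_qpoch.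
  apply: tame_qpochV; last by move=> n; exact: lr.
  apply: cvgM; last by apply: cvgV => //; exact: l0.
  by apply: cvgM => //; exact: cvg_cst.
Qed.

(** Reversing the six quotients gives the (n+1)-st power of the product of the aq/x^2, which is z^2
    q^2 by the relation between z and the parameters. It turns z^(-n-1) into z^(n+1), so the
    negative half is again a power series in z and converges for |z| < 1. *)
Lemma psi_term_neg a l z n : a != 0 -> {in l, forall x, x != 0} -> size l = 6%N ->
  z * \prod_(x <- l) x = a ^+ 3 * q ^+ 2 ->
  psi_term q a l z (Negz n)
  = - a / (1 - a) * (1 - q ^+ (2 * n.+1) / a)
    * (\prod_(x <- l) (poch (x / a) n.+1 / poch (q / x) n.+1)) * z ^+ n.+1.
Proof.
move=> a0 l0 sl zE.
have qn k : q ^+ k != 0 by rewrite expf_neq0.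
have prod0 : \prod_(x <- l) x != 0.
  by rewrite prodf_seq_neq0; apply/allP => x /l0.
have z0 : z != 0.
  apply: contra_eq_neq zE => ->; rewrite mul0r eq_sym.
  by rewrite mulf_neq0 ?expf_neq0.
rewrite /psi_term.
have fac x : x \in l -> qpochz q x (Negz n) / qpochz q (a * q / x) (Negz n)
    = (a * q / x ^+ 2) ^+ n.+1 * (poch (x / a) n.+1 / poch (q / x) n.+1).
  move=> /l0 x0 /=; rewrite invrK mulrC qpoch_div_ratio ?mulf_neq0 ?invr_neq0 //.
  by congr (_ ^+ _ * (poch _ _ / _)); field; rewrite ?a0 ?q0 x0.
rewrite (eq_big_seq _ fac) big_split /= prodrXl.
have -> : \prod_(x <- l) (a * q / x ^+ 2) = a ^+ 6 * q ^+ 6 / (\prod_(x <- l) x) ^+ 2.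
  rewrite prodf_div prodrXl; congr (_ / _).
  by move: sl; case: (l) => [|? [|? [|? [|? [|? [|? []]]]]]] //= _; rewrite !big_cons big_nil; ring.
have -> : z ^ Negz n = z ^- n.+1 by [].
have -> : q ^ (2 * Negz n) = q ^- (2 * n.+1) by rewrite NegzE mulrN -exprnN.
set P := \prod_(x <- l) (poch _ _ / _).
have -> : a ^+ 6 * q ^+ 6 / (\prod_(x <- l) x) ^+ 2 = z ^+ 2 * q ^+ 2.
  have -> : a ^+ 6 * q ^+ 6 = (z * \prod_(x <- l) x) ^+ 2 * q ^+ 2 by rewrite zE; ring.
  by field.
have -> : (z ^+ 2 * q ^+ 2) ^+ n.+1 = z ^+ n.+1 * z ^+ n.+1 * q ^+ (2 * n.+1).
  by rewrite exprMn -!exprM mulnC -exprD addnn -mul2n mulnC.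
have := qn (2 * n.+1)%N; have := expf_neq0 n.+1 z0.
move: (z ^+ n.+1) (q ^+ (2 * n.+1)) (1 - a)^-1 => Zn Qn V Zn0 Qn0.
by field; rewrite a0 Zn0 Qn0.
Qed.

Lemma psi88_cvg (a_ : nat -> C) a l_ l (z_ : nat -> C) z :
  a_ N @[N --> \oo] --> a -> cvg_list l_ l -> z_ N @[N --> \oo] --> z ->
  `|z| < 1 -> size l = 6%N -> a != 0 -> {in l, forall x, x != 0} ->
  (forall N, a_ N != 0) -> (forall N, {in l_ N, forall x, x != 0}) ->
  (forall N, z_ N * \prod_(x <- l_ N) x = a_ N ^+ 3 * q ^+ 2) ->
  z * \prod_(x <- l) x = a ^+ 3 * q ^+ 2 ->
  psi_regular q a l ->
  psi88 q (a_ N) (l_ N) (z_ N) @[N --> \oo] --> psi88 q a l z.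
Proof.
move=> ca cl cz z1 sl a0 l0 aN0 lN0 zNE zE [a1 lr].
have c1 : (1 : C) @[_ --> \oo] --> (1 : C) by exact: cvg_cst.
have li (i : 'I_(size l)) : nth 0 l i \in l by exact: mem_nth.
apply: cvgD.
- apply: tame_lim_series => //=.
  have -> : (fun N k => (1 - a_ N * q ^ (2 * Posz k)) / (1 - a_ N)
      * \prod_(x <- l_ N) (poch x k / poch (a_ N * q / x) k))
    = (fun N k => (1 - a_ N * q ^+ (2 * k)) / (1 - a_ N)
      * \prod_(i < size l) (poch (nth 0 (l_ N) i) k / poch (a_ N * q / (nth 0 (l_ N) i)) k)).
    by apply/funext => N; apply/funext => k; rewrite (big_cvg_list _ _ cl).
  have -> : (fun k => (1 - a * q ^ (2 * Posz k)) / (1 - a)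
      * \prod_(x <- l) (poch x k / poch (a * q / x) k))
    = (fun k => (1 - a * q ^+ (2 * k)) / (1 - a)
      * \prod_(i < size l) (poch (nth 0 l i) k / poch (a * q / (nth 0 l i)) k)).
    by apply/funext => k; rewrite (big_nth 0) big_mkord.
  apply: tameM.
  + apply: tameM; first apply: tameB.
    * exact: tame_cvg.
    * by apply: tameM; [exact: tame_cvg|exact: tame_expq].
    * by apply: tame_cvg; apply: cvgV => //; apply: cvgB.
  + apply: tame_prod => i; have [_ /(_ i) ci] := cl.
    apply: tameM; first exact: tame_qpoch.
    apply: tame_qpochV; last by move=> n; case: (lr _ (li i) n).
    apply: cvgM; last by apply: cvgV => //; exact: l0.
    by apply: cvgM => //; exact: cvg_cst.
- pose f N k := - a_ N / (1 - a_ N) * (1 - q ^+ (2 * k.+1) / a_ N)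
    * (\prod_(i < size l) (poch (nth 0 (l_ N) i / a_ N) k.+1 / poch (q / nth 0 (l_ N) i) k.+1))
    * z_ N.
  pose u k := - a / (1 - a) * (1 - q ^+ (2 * k.+1) / a)
    * (\prod_(i < size l) (poch (nth 0 l i / a) k.+1 / poch (q / nth 0 l i) k.+1)) * z.
  have fE N : (fun k => psi_term q (a_ N) (l_ N) (z_ N) (Negz k)) = (fun k => f N k * z_ N ^+ k).
    apply/funext => k; rewrite psi_term_neg //; last by have [-> _] := cl.
    by rewrite (big_cvg_list _ _ cl) exprS mulrA.
  have -> : (fun k => psi_term q a l z (Negz k)) = (fun k => u k * z ^+ k).
    apply/funext => k; rewrite psi_term_neg //.
    by rewrite (big_nth 0) big_mkord exprS mulrA.
  under eq_fun do rewrite fE.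
  apply: tame_lim_series => //.
  have cV : (a_ N)^-1 @[N --> \oo] --> a^-1 by apply: cvgV.
  apply: tameM; last exact: tame_cvg.
  apply: tameM; first apply: tameM.
  + apply: tame_cvg; apply: cvgM; first exact: cvgN.
    by apply: cvgV => //; apply: cvgB.
  + apply: tameB; first exact: tame_cvg.
    by apply: tameM; [exact: tame_expq|exact: tame_cvg].
  + apply: tame_prod => i; have [_ /(_ i) ci] := cl.
    apply: tameM.
      apply: (tame_reindex S (tame_qpoch _)); exact: cvgM.
    apply: (tame_reindex S (tame_qpochV _ _)).
      by apply: cvgM; [exact: cvg_cst|apply: cvgV => //; exact: l0].
    (* Regularity is stated for (x q^-n;q)_n, which equals (q/x;q)_n up to a monomial. *)
    move=> n; have x0 := l0 _ (li i); have [_] := lr _ (li i) n.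
    by rewrite qpoch_rev // mulf_eq0 negb_or => /andP[].
Qed.

Lemma theta_cvg (x_ : nat -> C) x : x_ N @[N --> \oo] --> x -> x != 0 ->
  (forall N, x_ N != 0) -> theta q (x_ N) @[N --> \oo] --> theta q x.
Proof.
move=> cx x0 xN0; rewrite (jacobi_triple_product gc q0 q1 x0).
under eq_fun do rewrite (jacobi_triple_product gc q0 q1 (xN0 _)).
apply: cvgM; apply: cvg_qpoch_inf => //.
by apply: cvgM; [exact: cvg_cst|exact: cvgV].
Qed.

Lemma Omega_cvg xs_ xs ys_ ys : cvg_list xs_ xs -> cvg_list ys_ ys ->
  {in ys, forall y, y != 0} ->
  Omega q (xs_ N) (ys_ N) @[N --> \oo] --> Omega q xs ys.
Proof.
move=> cx cy y0; rewrite /Omega.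
under eq_fun do (rewrite (big_cvg_list _ _ cx); under eq_bigr do rewrite (big_cvg_list _ _ cy)).
rewrite (big_nth 0) big_mkord; apply: cvg_prods => i _.
rewrite (big_nth 0) big_mkord; apply: cvg_prods => j _.
have [_ ci] := cx; have [_ cj] := cy; apply: cvg_qpoch_inf => //.
apply: cvgM; first exact: ci.
by apply: cvgV; [apply: y0; exact: mem_nth|exact: cj].
Qed.
End Tame.

(** * Removal of the genericity assumption *)

Section Perturbation.
Variables (C : numFieldType) (gc : geometrically_complete C) (q : C).
Hypothesis q0 : q != 0.
Hypothesis q1 : `|q| < 1.
Local Notation off := (off_lattice q).

(** A real factor larger than 1 and strictly decreasing in N. The choice of |q|^(N+1) instead of
    1/(N+1) makes its convergence to 1 a consequence of geometric completeness, without an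
    archimedean property. *)
Definition perturb (N : nat) : C := 1 + `|q| ^+ N.+1.
Local Notation t := perturb.

Let qgt0 n : 0 < `|q| ^+ n.
Proof. by rewrite exprn_gt0 // normr_gt0. Qed.

Lemma perturb_gt1 N : 1 < t N.
Proof. by rewrite ltrDl. Qed.

Lemma perturb_neq0 N : t N != 0.
Proof. by rewrite gt_eqF // (lt_trans _ (perturb_gt1 N)). Qed.

Lemma perturb_cvg : t N @[N --> \oo] --> (1 : C).
Proof.
rewrite -[X in _ --> X]addr0; apply: cvgD; first exact: cvg_cst.
have -> : (fun N => `|q| ^+ N.+1) = (fun N => `|q| * `|q| ^+ N) by apply/funext => N; rewrite exprS.
by apply: (@cvg_geometric0 _ gc); rewrite normr_id.
Qed.

Let perturbX_ge1 w N : 1 <= t N ^+ w.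
Proof. by rewrite exprn_ege1 // ltW // perturb_gt1. Qed.

Let perturbX_decr w M N : (0 < w)%N -> (M < N)%N -> t N ^+ w < t M ^+ w.
Proof.
move=> w0 MN; rewrite ltrXn2r ?nnegrE ?(le_trans ler01) ?ltW ?perturb_gt1 //.
  by rewrite -lt0n.
by rewrite ltrD2l ltr_iXn2l ?normr_gt0.
Qed.

(* Two bad values of N would force a ratio of powers of t N, which lies strictly
   between 1 and 1/|q|, to be a power of |q|. *)
Lemma near_off_lattice (x : C) w : x != 0 -> (0 < w)%N ->
  \forall N \near \oo, off (x * t N ^+ w).
Proof.
move=> x0 w0.
have [N0 _ hN0] : \forall N \near \oo, t N ^+ w * `|q| < 1.
  have : t N ^+ w @[N --> \oo] --> (1 : C) by rewrite -(expr1n C w); apply: cvg_powers; exact: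
    perturb_cvg.
  move=> /cvgrPdist_lt /(_ (`|q|^-1 - 1)).
  rewrite subr_gt0 invf_gt1 ?normr_gt0 // => /(_ q1); apply: filterS => N.
  rewrite distrC ger0_norm ?subr_ge0 // ltrBlDr subrK.
  by move=> h; rewrite -ltr_pdivlMr ?normr_gt0 // mul1r.
have [allN|bad] := pselect (forall N, (N0 <= N)%N -> off (x * t N ^+ w)).
  by exists N0.
have {bad}[N [NN0 [i [j e1]]]] : exists N, (N0 <= N)%N /\ exists i j, x * t N ^+ w * q ^+ i = q
  ^+ j.
  apply: contrapT => no; apply: bad => M NM i j; apply/negP => /eqP e.
  by apply: no; exists M; split=> //; exists i, j.
exists N.+1 => // M /= NM i' j'; apply/negP => /eqP e2.
have tnorm K : `|t K ^+ w| = t K ^+ w by rewrite ger0_norm // (le_trans ler01).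
have e : t N ^+ w * `|q| ^+ (i + j') = t M ^+ w * `|q| ^+ (i' + j).
  have nx0 : `|x| != 0 by rewrite normr_eq0.
  apply: (mulfI nx0); transitivity (`|q| ^+ (j + j')).
    by rewrite -(tnorm N) -!normrX -!normrM exprD !mulrA e1 exprD.
  by rewrite -(tnorm M) -!normrX -!normrM (exprD _ i') !mulrA e2 -exprD addnC.
have TNM := perturbX_decr w0 NM.
have TN0 : 0 < t N ^+ w by rewrite (lt_le_trans ltr01).
have [mn|nm] := leqP (i + j') (i' + j).
- have : t M ^+ w * `|q| ^+ (i' + j) < t N ^+ w * `|q| ^+ (i + j').
    apply: (@lt_le_trans _ _ (t N ^+ w * `|q| ^+ (i' + j))); first by rewrite ltr_pM2r.
    by rewrite ler_pM2l // ler_wiXn2l // ltW.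
  by rewrite e ltxx.
- have : t N ^+ w * `|q| ^+ (i + j') < t M ^+ w * `|q| ^+ (i' + j).
    apply: (@le_lt_trans _ _ (t N ^+ w * `|q| * `|q| ^+ (i' + j))).
      by rewrite -mulrA ler_pM2l // -exprS ler_wiXn2l // ltW.
    rewrite ltr_pM2r //; apply: lt_le_trans (perturbX_ge1 w M); exact: hN0.
  by rewrite e ltxx.
Qed.

Lemma near_off_latticeM x w (y_ : nat -> C) : x != 0 -> (0 < w)%N ->
  (forall N, y_ N = x * t N ^+ w) -> \forall N \near \oo, off (y_ N).
Proof. by move=> x0 w0 yE; apply: filterS (near_off_lattice x0 w0) => N; rewrite yE. Qed.

Lemma near_off_latticeV x w (y_ : nat -> C) : x != 0 -> (0 < w)%N ->
  (forall N, y_ N = x / t N ^+ w) -> \forall N \near \oo, off (y_ N).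
Proof.
move=> x0 w0 yE; have xV0 : x^-1 != 0 by rewrite invr_eq0.
apply: filterS (near_off_lattice xV0 w0) => N o.
apply: (off_lattice_eqV 0 0 o); rewrite yE expr0 mulr1.
by field; rewrite x0 expf_neq0 // perturb_neq0.
Qed.

Variables (a b c d e f g : C).
Hypotheses (a0 : a != 0) (b0 : b != 0) (c0 : c != 0) (d0 : d != 0) (e0 : e != 0)
  (f0 : f != 0) (g0 : g != 0).

Ltac neq0 := match goal with
  | |- is_true (_ * _ != 0) => apply: mulf_neq0; neq0
  | |- is_true (_^-1 != 0) => apply: invr_neq0; neq0
  | |- is_true (_ ^+ _ != 0) => apply: expf_neq0; neq0
  | _ => assumption end.
Ltac near_monoM k w :=
  apply: (near_off_latticeM (x := nth 1 (generic_monomials a b c d e f g) k) (w := w) _ isT)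
    => [|N] /=; [by neq0 | by field; rewrite ?a0 ?b0 ?c0 ?d0 ?e0 ?f0 ?g0 ?perturb_neq0].
Ltac near_monoV k w :=
  apply: (near_off_latticeV (x := nth 1 (generic_monomials a b c d e f g) k) (w := w) _ isT)
    => [|N] /=; [by neq0 | by field; rewrite ?a0 ?b0 ?c0 ?d0 ?e0 ?f0 ?g0 ?perturb_neq0].

(* The exponents are chosen so that every generic monomial gets a nonzero power of [t N]. *)
Lemma near_generic : \forall N \near \oo, forall k, (k < 53)%N ->
  off (nth 1 (generic_monomials (a * t N) (b * t N ^+ 2) (c * t N) (d * t N ^+ 3) (e * t N ^+
    3) (f * t N ^+ 3) (g * t N ^+ 3)) k).
Proof.
suff h (k : 'I_53) : \forall N \near \oo, off (nth 1 (generic_monomials (a * t N) (b * t N ^+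
  2) (c * t N) (d * t N ^+ 3) (e * t N ^+ 3) (f * t N ^+ 3) (g * t N ^+ 3)) k).
  have H := filter_forall (F := \oo) _ h.
  by apply: (filterS _ (H _)) => N hN k k53; exact: (hN (Ordinal k53)).
case: k => k /=.
case: k => [_|k]; first by near_monoM 0%N 8%N.
case: k => [_|k]; first by near_monoM 1%N 2%N.
case: k => [_|k]; first by near_monoM 2%N 1%N.
case: k => [_|k]; first by near_monoV 3%N 6%N.
case: k => [_|k]; first by near_monoV 4%N 7%N.
case: k => [_|k]; first by near_monoV 5%N 4%N.
case: k => [_|k]; first by near_monoV 6%N 6%N.
case: k => [_|k]; first by near_monoV 7%N 5%N.
case: k => [_|k]; first by near_monoM 8%N 1%N.
case: k => [_|k]; first by near_monoM 9%N 3%N.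
case: k => [_|k]; first by near_monoV 10%N 5%N.
case: k => [_|k]; first by near_monoV 11%N 1%N.
case: k => [_|k]; first by near_monoV 12%N 2%N.
case: k => [_|k]; first by near_monoM 13%N 3%N.
case: k => [_|k]; first by near_monoV 14%N 5%N.
case: k => [_|k]; first by near_monoV 15%N 1%N.
case: k => [_|k]; first by near_monoV 16%N 2%N.
case: k => [_|k]; first by near_monoM 17%N 10%N.
case: k => [_|k]; first by near_monoM 18%N 2%N.
case: k => [_|k]; first by near_monoV 19%N 8%N.
case: k => [_|k]; first by near_monoV 20%N 9%N.
case: k => [_|k]; first by near_monoM 21%N 10%N.
case: k => [_|k]; first by near_monoM 22%N 2%N.
case: k => [_|k]; first by near_monoV 23%N 8%N.
case: k => [_|k]; first by near_monoV 24%N 9%N.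
case: k => [_|k]; first by near_monoM 25%N 15%N.
case: k => [_|k]; first by near_monoM 26%N 9%N.
case: k => [_|k]; first by near_monoM 27%N 8%N.
case: k => [_|k]; first by near_monoM 28%N 3%N.
case: k => [_|k]; first by near_monoM 29%N 1%N.
case: k => [_|k]; first by near_monoM 30%N 2%N.
case: k => [_|k]; first by near_monoM 31%N 10%N.
case: k => [_|k]; first by near_monoM 32%N 10%N.
case: k => [_|k]; first by near_monoV 33%N 5%N.
case: k => [_|k]; first by near_monoV 34%N 1%N.
case: k => [_|k]; first by near_monoV 35%N 2%N.
case: k => [_|k]; first by near_monoV 36%N 5%N.
case: k => [_|k]; first by near_monoV 37%N 1%N.
case: k => [_|k]; first by near_monoV 38%N 2%N.
case: k => [_|k]; first by near_monoV 39%N 9%N.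
case: k => [_|k]; first by near_monoV 40%N 11%N.
case: k => [_|k]; first by near_monoV 41%N 2%N.
case: k => [_|k]; first by near_monoM 42%N 4%N.
case: k => [_|k]; first by near_monoM 43%N 3%N.
case: k => [_|k]; first by near_monoM 44%N 6%N.
case: k => [_|k]; first by near_monoM 45%N 4%N.
case: k => [_|k]; first by near_monoM 46%N 7%N.
case: k => [_|k]; first by near_monoV 47%N 3%N.
case: k => [_|k]; first by near_monoV 48%N 4%N.
case: k => [_|k]; first by near_monoM 49%N 3%N.
case: k => [_|k]; first by near_monoM 50%N 3%N.
case: k => [_|k]; first by near_monoM 51%N 4%N.
case: k => [_|k]; first by near_monoM 52%N 4%N.
by [].
Qed.

End Perturbation.

Lemma near_eq_lim (C : numFieldType) (u v : nat -> C) (l m : C) :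
  u N @[N --> \oo] --> l -> v N @[N --> \oo] --> m ->
  (\forall N \near \oo, u N = v N) -> l = m.
Proof.
move=> cu cv /near_eq_cvg uv.
apply: (cvg_unique (@norm_hausdorff _ _) _ cv); exact: (cvg_trans uv cu).
Qed.

Section VeryWellPoisedArguments.
Variables (C : fieldType) (q a b c d e f g z : C).
Hypotheses (q0 : q != 0) (a0 : a != 0) (f0 : f != 0) (g0 : g != 0) (z0 : z != 0).
Hypothesis zE : z = b * c * d * e / (a * q).

(** The relation between argument and parameters required by [psi_term_neg]; like the next one, it
    is applied both to the given and to the perturbed parameters. *)
Lemma psi88_arg1 :
  a * q / (f * g) * \prod_(x <- [:: b; c; d; e; f * z / a; g * z / a]) x = z ^+ 3 * q ^+ 2.
Proof.
rewrite !big_cons big_nil.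
have -> : z ^+ 3 = z ^+ 2 * (b * c * d * e / (a * q)) by rewrite -zE; ring.
by field; rewrite a0 f0 g0 q0.
Qed.

Lemma psi88_arg2 :
  a ^+ 2 * q / (f * g * z)
    * \prod_(x <- [:: b * z / a; c * z / a; d * z / a; e * z / a; f * z / a; g * z / a]) x
  = (z ^+ 2 / a) ^+ 3 * q ^+ 2.
Proof.
rewrite !big_cons big_nil.
have -> : (z ^+ 2 / a) ^+ 3 = z ^+ 5 * (b * c * d * e / (a * q)) / a ^+ 3.
  by rewrite -zE; field.
by field; rewrite a0 f0 g0 z0 q0.
Qed.

End VeryWellPoisedArguments.

(** * Passage to the limit in the identity *)

Section Limit.
Variables (C : numFieldType) (gc : geometrically_complete C) (q : C).
Hypothesis q0 : q != 0.
Hypothesis q1 : `|q| < 1.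

Local Notation t := (perturb q).
Variables (a b c d e f g z : C).
Hypotheses (a0 : a != 0) (b0 : b != 0) (c0 : c != 0) (d0 : d != 0) (e0 : e != 0)
  (f0 : f != 0) (g0 : g != 0).
Hypothesis zE : z = b * c * d * e / (a * q).
Hypothesis Z2 : `|a ^+ 2 * q / (f * g * z)| < 1.
Hypothesis Z1 : `|a * q / (f * g)| < 1.

Let perturbX_cvg x w : x * t N ^+ w @[N --> \oo] --> x.
Proof.
rewrite -[X in _ --> X]mulr1 -(expr1n C w); apply: cvgMl_tmp.
by apply: cvg_powers; exact: perturb_cvg.
Qed.

Let perturbXV_norm x w N : `|x| < 1 -> `|x / t N ^+ w| < 1.
Proof.
move=> x1; have t1 := perturb_gt1 q0 N; have t0 := lt_trans ltr01 t1.
rewrite normrM normfV (ger0_norm (exprn_ge0 _ (ltW t0))).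
by rewrite ltr_pdivrMr ?exprn_gt0 // mul1r (lt_le_trans x1) // exprn_ege1 // ltW.
Qed.

Let a_ N := a * t N.
Let b_ N := b * t N ^+ 2.
Let c_ N := c * t N.
Let d_ N := d * t N ^+ 3.
Let e_ N := e * t N ^+ 3.
Let f_ N := f * t N ^+ 3.
Let g_ N := g * t N ^+ 3.
(** The exponent 8 = 2 + 1 + 3 + 3 - 1 preserves z = bcde/(aq). *)
Let z_ N := z * t N ^+ 8.

Let t0 N : t N != 0. Proof. exact: perturb_neq0. Qed.
Let z0 : z != 0. Proof. by rewrite zE !mulf_neq0 ?invr_neq0 ?mulf_neq0. Qed.
Let aN0 N : a_ N != 0. Proof. by rewrite mulf_neq0. Qed.
Let bN0 N : b_ N != 0. Proof. by rewrite mulf_neq0 ?expf_neq0. Qed.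
Let cN0 N : c_ N != 0. Proof. by rewrite mulf_neq0. Qed.
Let dN0 N : d_ N != 0. Proof. by rewrite mulf_neq0 ?expf_neq0. Qed.
Let eN0 N : e_ N != 0. Proof. by rewrite mulf_neq0 ?expf_neq0. Qed.
Let fN0 N : f_ N != 0. Proof. by rewrite mulf_neq0 ?expf_neq0. Qed.
Let gN0 N : g_ N != 0. Proof. by rewrite mulf_neq0 ?expf_neq0. Qed.
Let zN0 N : z_ N != 0. Proof. by rewrite mulf_neq0 ?expf_neq0. Qed.
Let ca : a_ N @[N --> \oo] --> a. Proof. exact: (@perturbX_cvg a 1). Qed.
Let cb : b_ N @[N --> \oo] --> b. Proof. exact: perturbX_cvg. Qed.
Let cc : c_ N @[N --> \oo] --> c. Proof. exact: (@perturbX_cvg c 1). Qed.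
Let cd : d_ N @[N --> \oo] --> d. Proof. exact: perturbX_cvg. Qed.
Let ce : e_ N @[N --> \oo] --> e. Proof. exact: perturbX_cvg. Qed.
Let cf : f_ N @[N --> \oo] --> f. Proof. exact: perturbX_cvg. Qed.
Let cg : g_ N @[N --> \oo] --> g. Proof. exact: perturbX_cvg. Qed.
Let cz : z_ N @[N --> \oo] --> z. Proof. exact: perturbX_cvg. Qed.

Ltac nz := match goal with
  | |- is_true (_ * _ != 0) => apply: mulf_neq0; nz
  | |- is_true (_^-1 != 0) => apply: invr_neq0; nz
  | |- is_true (_ ^+ _ != 0) => apply: expf_neq0; nz
  | |- forall _, _ => intro; nz
  | _ => first [assumption | exact: aN0 | exact: bN0 | exact: cN0 | exact: dN0
      | exact: eN0 | exact: fN0 | exact: gN0 | exact: zN0]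
  end.
Let all_neq0 (l : seq C) : all (fun x => x != 0) l -> {in l, forall x, x != 0}.
Proof. by move/allP. Qed.

Ltac nzs := apply: all_neq0; rewrite /= ?andbT; repeat (apply/andP; split); nz.

Ltac cv := lazymatch goal with
  | |- cvg_to _ (nbhs (theta _ _)) => apply: (theta_cvg gc q0 q1); [cv | nz | nz]
  | |- cvg_to _ (nbhs (qpoch_inf _ _)) => apply: (cvg_qpoch_inf gc q1); cv
  | |- cvg_to _ (nbhs (Omega _ _ _)) => apply: (Omega_cvg gc q1); [cvl | cvl | nzs]
  | |- cvg_to _ (nbhs (_ * _)) => apply: cvgM; cv
  | |- cvg_to _ (nbhs (_ - _)) => apply: cvgB; cv
  | |- cvg_to _ (nbhs (_^-1)) => apply: cvgV; [nz | cv]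
  | |- cvg_to _ (nbhs (_ ^+ _)) => apply: cvg_powers; cv
  | _ => first [exact: ca | exact: cb | exact: cc | exact: cd | exact: ce | exact: cf
      | exact: cg | exact: cz | exact: cvg_cst]
  end
with cvl := lazymatch goal with
  | |- cvg_list _ [::] => exact: cvg_list_nil
  | _ => apply: cvg_list_cons; [cv | cvl]
  end.

(** The assumed denominators are those at the limit point; they suffice for continuity of the
    quotients. *)
Let coef1_cvg : theta q (z / a) != 0 -> theta q z != 0 ->
  Omega q [:: a * q / b; b * q] [:: f; g] != 0 ->
  Omega q [:: b * q] [:: b; c; d; e] != 0 ->
  Omega q [:: z^-1] [:: b^-1; c^-1; d^-1; e^-1; f * g / (a ^+ 2 * q)] != 0 ->
  psi88_coef1 q (a_ N) (b_ N) (c_ N) (d_ N) (e_ N) (f_ N) (g_ N) (z_ N) @[N --> \oo]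
    --> psi88_coef1 q a b c d e f g z.
Proof.
move=> h1 h2 h3 h4 h5; rewrite /psi88_coef1; cv.
Qed.

Let coef2_cvg : theta q (z / a) != 0 -> qpoch_inf q (z ^+ 2 * q / a) != 0 ->
  Omega q [:: z^-1] [:: z / (a * q); c^-1; d^-1; e^-1] != 0 ->
  Omega q [:: a * q / b] [:: f; g] != 0 ->
  Omega q [:: b * q] [:: b; c; d; e; f; g] != 0 ->
  psi88_coef2 q (a_ N) (b_ N) (c_ N) (d_ N) (e_ N) (f_ N) (g_ N) (z_ N) @[N --> \oo]
    --> psi88_coef2 q a b c d e f g z.
Proof.
move=> h1 h2 h3 h4 h5; rewrite /psi88_coef2; cv.
Qed.

Let zNE N : z_ N = b_ N * c_ N * d_ N * e_ N / (a_ N * q).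
Proof. by rewrite /z_ /b_ /c_ /d_ /e_ /a_ zE; field; rewrite a0 t0 q0. Qed.

(** The exponent of t in a^2/(fgz) is 2 - 3 - 3 - 8 = -12, and in a/(fg) it is 1 - 3 - 3 = -5. Since
    t > 1, both arguments shrink, and convergence holds for every N. *)
Let Z2N N : `|a_ N ^+ 2 * q / (f_ N * g_ N * z_ N)| < 1.
Proof.
rewrite [X in `|X|](_ : _ = a ^+ 2 * q / (f * g * z) / t N ^+ 12) ?perturbXV_norm //.
by rewrite /a_ /f_ /g_ /z_; field; rewrite f0 g0 z0 t0.
Qed.

Let Z1N N : `|a_ N * q / (f_ N * g_ N)| < 1.
Proof.
rewrite [X in `|X|](_ : _ = a * q / (f * g) / t N ^+ 5) ?perturbXV_norm //.
by rewrite /a_ /f_ /g_; field; rewrite f0 g0 t0.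
Qed.

Theorem W87_two_psi88 :
  W_regular q (b ^+ 2 / a) [:: b * c / a; b * d / a; b * e / a; b * f / a; b * g / a] ->
  psi_regular q z [:: b; c; d; e; f * z / a; g * z / a] ->
  psi_regular q (z ^+ 2 / a)
    [:: b * z / a; c * z / a; d * z / a; e * z / a; f * z / a; g * z / a] ->
  theta q (z / a) != 0 -> theta q z != 0 ->
  Omega q [:: a * q / b; b * q] [:: f; g] != 0 ->
  Omega q [:: b * q] [:: b; c; d; e] != 0 ->
  Omega q [:: z^-1] [:: b^-1; c^-1; d^-1; e^-1; f * g / (a ^+ 2 * q)] != 0 ->
  qpoch_inf q (z ^+ 2 * q / a) != 0 ->
  Omega q [:: z^-1] [:: z / (a * q); c^-1; d^-1; e^-1] != 0 ->
  Omega q [:: a * q / b] [:: f; g] != 0 ->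
  Omega q [:: b * q] [:: b; c; d; e; f; g] != 0 ->
  W87 q (b ^+ 2 / a) [:: b * c / a; b * d / a; b * e / a; b * f / a; b * g / a]
    (a ^+ 2 * q / (f * g * z))
  = psi88_coef1 q a b c d e f g z
    * psi88 q z [:: b; c; d; e; f * z / a; g * z / a] (a * q / (f * g))
  + psi88_coef2 q a b c d e f g z
    * psi88 q (z ^+ 2 / a) [:: b * z / a; c * z / a; d * z / a; e * z / a; f * z / a; g * z / a]
        (a ^+ 2 * q / (f * g * z)).
Proof.
move=> hW hpsi1 hpsi2 hza hz h1 h2 h3 h4 h5 h6 h7.
have cW : W87 q (b_ N ^+ 2 / a_ N)
    [:: b_ N * c_ N / a_ N; b_ N * d_ N / a_ N; b_ N * e_ N / a_ N; b_ N * f_ N / a_ N;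
        b_ N * g_ N / a_ N] (a_ N ^+ 2 * q / (f_ N * g_ N * z_ N)) @[N --> \oo]
    --> W87 q (b ^+ 2 / a) [:: b * c / a; b * d / a; b * e / a; b * f / a; b * g / a]
      (a ^+ 2 * q / (f * g * z)).
  by apply: (W87_cvg gc q1) => //; [cv | cvl | cv | nzs].
have cpsi1 : psi88 q (z_ N) [:: b_ N; c_ N; d_ N; e_ N; f_ N * z_ N / a_ N; g_ N * z_ N / a_ N]
      (a_ N * q / (f_ N * g_ N)) @[N --> \oo]
    --> psi88 q z [:: b; c; d; e; f * z / a; g * z / a] (a * q / (f * g)).
  apply: (psi88_cvg gc q0 q1) => //; [cvl | cv | nzs | by move=> N; nzs | move=> N |];
    exact: psi88_arg1.
have cpsi2 : psi88 q (z_ N ^+ 2 / a_ N)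
      [:: b_ N * z_ N / a_ N; c_ N * z_ N / a_ N; d_ N * z_ N / a_ N; e_ N * z_ N / a_ N;
          f_ N * z_ N / a_ N; g_ N * z_ N / a_ N]
      (a_ N ^+ 2 * q / (f_ N * g_ N * z_ N)) @[N --> \oo]
    --> psi88 q (z ^+ 2 / a)
      [:: b * z / a; c * z / a; d * z / a; e * z / a; f * z / a; g * z / a]
      (a ^+ 2 * q / (f * g * z)).
  apply: (psi88_cvg gc q0 q1) => //; [cv | cvl | cv | nz | nzs | nz | by move=> N; nzs | move=>
    N |];
    exact: psi88_arg2.
have := cvgD (cvgM (coef1_cvg hza hz h1 h2 h3) cpsi1) (cvgM (coef2_cvg hza h4 h5 h6 h7) cpsi2).
move=> cR; apply: (near_eq_lim cW (cR _ _ _)).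
apply: filterS (near_generic gc q0 q1 a0 b0 c0 d0 e0 f0 g0) => N gen.
exact: (W87_two_psi88_generic gc q0 q1).
Qed.

End Limit.

Theorem theorem1p6 (R : realType) (q a b c d e f g z : R[i])
  (q_gt0 : 0 < `|q|) (q_lt1 : `|q| < 1)
  (a0 : a != 0) (b0 : b != 0) (c0 : c != 0) (d0 : d != 0) (e0 : e != 0)
  (f0 : f != 0) (g0 : g != 0)
  (zE : z = b * c * d * e / (a * q))
  (hZ1 : `|a ^+ 2 * q / (f * g * z)| < 1)
  (hZ2 : `|a * q / (f * g)| < 1)
  (* no denominator vanishes in the terms of the three series *)
  (hW : W_regular q (b ^+ 2 / a)
          [:: b * c / a; b * d / a; b * e / a; b * f / a; b * g / a])
  (hpsi1 : psi_regular q z [:: b; c; d; e; f * z / a; g * z / a])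
  (hpsi2 : psi_regular q (z ^+ 2 / a)
             [:: b * z / a; c * z / a; d * z / a; e * z / a; f * z / a;
                 g * z / a])
  (* no denominator vanishes in the coefficients *)
  (hza : theta q (z / a) != 0) (hz : theta q z != 0)
  (h1 : Omega q [:: a * q / b; b * q] [:: f; g] != 0)
  (h2 : Omega q [:: b * q] [:: b; c; d; e] != 0)
  (h3 : Omega q [:: z^-1]
          [:: b^-1; c^-1; d^-1; e^-1; f * g / (a ^+ 2 * q)] != 0)
  (h4 : qpoch_inf q (z ^+ 2 * q / a) != 0)
  (h5 : Omega q [:: z^-1] [:: z / (a * q); c^-1; d^-1; e^-1] != 0)
  (h6 : Omega q [:: a * q / b] [:: f; g] != 0)
  (h7 : Omega q [:: b * q] [:: b; c; d; e; f; g] != 0) :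
  W87 q (b ^+ 2 / a)
    [:: b * c / a; b * d / a; b * e / a; b * f / a; b * g / a]
    (a ^+ 2 * q / (f * g * z))
  = (1 - z^-1)
    * ((theta q (b * z / a) * theta q (z / b)) / (theta q (z / a) * theta q z))
    * (qpoch_inf q (b ^+ 2 * q / a) / Omega q [:: a * q / b; b * q] [:: f; g])
    * ((Omega q [:: q] [:: b; c; d; e]
        * Omega q [:: a * q]
            [:: f; g; c * d; c * e; d * e; f * g; f * z; g * z])
       / (Omega q [:: b * q] [:: b; c; d; e]
          * Omega q [:: z^-1]
              [:: b^-1; c^-1; d^-1; e^-1; f * g / (a ^+ 2 * q)]))
    * psi88 q z [:: b; c; d; e; f * z / a; g * z / a] (a * q / (f * g))
    + (qpoch_inf q (z * q / b) / qpoch_inf q (z ^+ 2 * q / a))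
    * (theta q b^-1 / theta q (z / a))
    * ((Omega q [:: b / a] [:: (b * q)^-1; c^-1; d^-1; e^-1]
        * Omega q [:: z * q] [:: f; g])
       / (Omega q [:: z^-1] [:: z / (a * q); c^-1; d^-1; e^-1]
          * Omega q [:: a * q / b] [:: f; g]))
    * (Omega q [:: a * q / z] [:: b; c; d; e; f; g]
       / Omega q [:: b * q] [:: b; c; d; e; f; g])
    * psi88 q (z ^+ 2 / a)
        [:: b * z / a; c * z / a; d * z / a; e * z / a; f * z / a; g * z / a]
        (a ^+ 2 * q / (f * g * z)).

Proof.
have q0 : q != 0 by rewrite -normr_gt0.
have := W87_two_psi88 (@complex_geometrically_complete R) q0 q_lt1 a0 b0 c0 d0 e0 f0 g0 zE
  hZ1 hZ2 hW hpsi1 hpsi2 hza hz h1 h2 h3 h4 h5 h6 h7.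
by rewrite /psi88_coef1 /psi88_coef2.
Qed.
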